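(* Suppose that $r(m)=\alpha m+O(1)$ as $m\to\infty$, where $0<\alpha\le1$. Then, as $n\to\infty$, $$M_n/n^{\alpha}\longrightarrow W\quad\text{almost surely},$$ for a random variable $W$, which can be represented as $$W=e^{(\alpha-1)\gamma-\alpha\rho-\alpha}\,e^{-\alpha Z},\qquad Z:=\sum_{k=1}^\infty\frac{\delta_k}{r(k)}(E_k-1),\qquad \rho:=\sum_{m=1}^\infty\Bigl(\frac1{r(m)}-\frac1{\alpha m}\Bigr),$$ where $E_1,E_2,\dots$ are i.i.d. $\mathrm{Exp}(1)$ random variables. Furthermore, all moments converge, and for every real $s\ge0$, $$\frac{\mathbb E M_n^s}{n^{\alpha s}}\to\mathbb E W^s=\frac{\Gamma(s+1)}{\Gamma(s\alpha+2)}\prod_{k=1}^\infty\frac{1+s/k}{1+s\alpha/r(k)}<\infty .$$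
   Context: Hiring process. $(r(m))_{m\ge0}$ is a given sequence of integers with $r(0)=1$ and $r(m)\le r(m+1)\le r(m)+1$ for all $m\ge0$ (hence $1\le r(m)\le m+1$). The values $X_1,X_2,\dots$ of the candidates are i.i.d. random variables with a common continuous distribution (so they are a.s. distinct). Candidates are examined one by one in the order $1,2,\dots$. If $m\ge0$ candidates have been accepted so far, then: if $r(m)\le m$, the next candidate is accepted if and only if her value exceeds the $r(m)$-th largest of the $m$ values already accepted; if $r(m)=m+1$, the next candidate is always accepted. (The law of the sequence of accept/reject decisions does not depend on the continuous distribution.) $M_n$ is the number of candidates accepted among the first $n$. Notation: $\delta_k:=1$ if $r(k)=r(k-1)$ and $\delta_k:=0$ if $r(k)=r(k-1)+1$, $k\ge1$; $\gamma$ is Euler's constant; $\mathrm{Exp}(1)$ is the exponential distribution with rate $1$. *)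

(* Defs.v *)
From HB Require Import structures.
From mathcomp Require Import all_boot all_order all_algebra.
From mathcomp Require Import finmap.
From mathcomp Require Import all_classical all_reals all_analysis.

Set Implicit Arguments.
Unset Strict Implicit.
Unset Printing Implicit Defensive.

Import Order.TTheory GRing.Theory Num.Theory.
Import numFieldNormedType.Exports.

Local Open Scope classical_set_scope.
Local Open Scope ring_scope.

(* Sequences of random variables are 0-indexed: X i is the value of candidate
   i + 1, and E i stands for E_{i+1}. *)

Section probability.
Context {d} {T : measurableType d} {R : realType} (P : probability T R).

Definition independent_seq (X : nat -> {RV P >-> R}) : Prop :=
  forall (J : {fset nat}) (A : nat -> set R),
    (forall i, i \in J -> measurable (A i)) ->
    P (\bigcap_(i in [set` J]) (X i @^-1` A i)) =
    (\prod_(i <- J) P (X i @^-1` A i))%E.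

Definition identically_distributed (X : nat -> {RV P >-> R}) : Prop :=
  forall (i j : nat) (A : set R), measurable A ->
    distribution P (X i) A = distribution P (X j) A.

Definition iid (X : nat -> {RV P >-> R}) : Prop :=
  independent_seq X /\ identically_distributed X.

Definition has_exponential_law (rate : R) (X : {RV P >-> R}) : Prop :=
  forall A : set R, measurable A ->
    distribution P X A = exponential_prob rate A.

(* E[Y^s], for Y >= 0 and real s >= 0 *)
Definition real_moment (Y : T -> R) (s : R) : \bar R :=
  ('E_P[fun w => (Y w `^ s)%R])%E.

End probability.

(* (T', P') extends (T, P) through the projection p; a random variable Y on T
   is identified with Y \o p on T'. *)
Definition extends_probability d d' (T : measurableType d)
    (T' : measurableType d') (R : realType) (P : probability T R)
    (P' : probability T' R) (p : T' -> T) : Prop :=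
  measurable_fun setT p /\
  forall A : set T, measurable A -> P' (p @^-1` A) = P A.

Definition rank_sequence (r : nat -> nat) : Prop :=
  r 0%N = 1%N /\ forall m, (r m <= r m.+1 <= (r m).+1)%N.

Section hiring.
Context {R : realType} (r : nat -> nat).

(* the k-th largest element of s, for 1 <= k <= size s *)
Definition kth_largest (k : nat) (s : seq R) : R := nth 0 (sort >=%R s) k.-1.

(* r m <= m.+1, so the second alternative is r m = m.+1 *)
Definition accepts (s : seq R) (x : R) : bool :=
  let m := size s in
  if (r m <= m)%N then kth_largest (r m) s < x else true.

Fixpoint accepted_values (x : nat -> R) (n : nat) : seq R :=
  if n is n'.+1 then
    let s := accepted_values x n' in
    if accepts s (x n') then rcons s (x n') else s
  else [::].

Definition num_accepted (x : nat -> R) (n : nat) : nat :=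
  size (accepted_values x n).

(* delta_k, for k >= 1 *)
Definition delta (k : nat) : R := if r k == r k.-1 then 1 else 0.

(* partial sums of Z for given values e of the E_k *)
Definition Z_series (e : nat -> R) : nat -> R :=
  series (fun k => delta k.+1 / (r k.+1)%:R * (e k - 1)).

Definition rho_series (alpha : R) : nat -> R :=
  series (fun m => (r m.+1)%:R^-1 - (alpha * m.+1%:R)^-1).

Definition moment_product (alpha s : R) (n : nat) : R :=
  \prod_(1 <= k < n.+1) ((1 + s / k%:R) / (1 + s * alpha / (r k)%:R)).

End hiring.

Definition euler_gamma (R : realType) : R :=
  limn (fun n : nat => series harmonic n - ln n%:R : R).

(* Euler's integral, for a > 0 *)
Definition Gamma (R : realType) (a : R) : R :=
  \int[lebesgue_measure]_(x in `]0, +oo[) (x `^ (a - 1) * expR (- x)).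

(* Main.v *)
(* Only the order of the values matters, so they may be replaced by
   - ln (1 - F (X_i)), which are i.i.d. Exp(1). By the memoryless property the
   overshoots of the accepted values above the current threshold are then i.i.d.
   Exp(1) at every stage. An acceptance with r(m) = r(m - 1) moves the threshold up
   to the smallest of r(m) such overshoots, and one with r(m) = r(m - 1) + 1 leaves
   it in place; by Renyi's representation of order statistics the threshold after
   m acceptances is Y_m = sum_(k <= m) delta_k E_k / r(k) with E_k i.i.d. Exp(1).
   The next candidate is accepted with probability e^(- Y_m), so that
   M_n - sum_(k < n) e^(- Y_(M_k)) is a martingale, which is o(n^alpha); a summation
   by parts turns this into sum_(j < M_n) e^(Y_j) ~ n. Since
   Y_m = (1/alpha - 1) ln m + Z + kappa + o(1), the left-hand side grows like
   alpha e^(Z + kappa) M_n^(1/alpha), which gives the almost sure limit.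
   The moments converge because all moments of M_n / n^alpha are bounded, and the
   limit is computed from E e^(- t Y_m) = prod_(k <= m) (1 + t delta_k / r(k))^-1
   and Gauss' product for the Gamma function. *)
Require Import Defs.
From HB Require Import structures.
From mathcomp Require Import all_boot all_order all_algebra.
From mathcomp Require Import finmap.
From mathcomp Require Import all_classical all_reals all_analysis.
From mathcomp Require Import measurable_realfun.
From mathcomp Require Import ring lra zify.

Import Order.TTheory GRing.Theory Num.Theory.
Import numFieldNormedType.Exports.

Local Open Scope classical_set_scope.
Local Open Scope ring_scope.

Set Implicit Arguments.
Unset Strict Implicit.
Unset Printing Implicit Defensive.

Set Bullet Behavior "Strict Subproofs".

(** * The exponential law *)

(** The obstacle is that the increments of the threshold must be extracted from the overshoots
    without conditional laws. Renyi's representation therefore appears as an explicit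
    measure-preserving rearrangement [Theta] of one array of overshoots, which makes the E_k with
    delta_k = 1 functions of the candidates on the original space. Those with delta_k = 0 are not
    produced by it, so the representation of W uses an extension, while W itself is a limit superior
    on the original space. Conditioning on the past is replaced by Tonelli's theorem for a
    coordinate independent of the past. No martingale theorem is invoked: each process is a
    difference or a product of monotone ones, so second moments summed along k^3 or k^c, with
    monotonicity in between, give almost sure convergence, and even an integrable bound for the
    supremum of the exponential martingale e^(-tY_m) / E e^(-tY_m). Read at the random index M_n,
    this supremum bounds the acceptance probability times M_n^(1/alpha - 1) in every L^q, uniformly
    in n, which feeds a recursion for the moments of M_n^(1/alpha). *)

Section density.
Local Open Scope ereal_scope.
Context d (T : measurableType d) (R : realType).
Variables (m m' : {measure set T -> \bar R}) (p : T -> R).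
Hypotheses (mp : measurable_fun setT p) (p0 : forall x, (0 <= p x)%R).
Hypothesis m'E : forall A, measurable A -> m' A = \int[m]_(x in A) (p x)%:E.

Import HBNNSimple.

(** Values on measurable sets determine the integrals of simple functions, and increasing
    approximation carries the formula to nonnegative functions. It applies to [exponential_prob],
    which is defined set by set as an integral of its density. *)
Lemma ge0_integral_density (f : T -> \bar R) :
  measurable_fun setT f -> (forall x, 0 <= f x) ->
  \int[m']_x f x = \int[m]_x (f x * (p x)%:E).
Proof.
move=> mf f0; pose f_ := nnsfun_approx measurableT mf.
have mf_ n : measurable_fun setT (fun x => (f_ n x)%:E) by exact/measurable_EFinP.
have f_f x : EFin \o f_^~ x @ \oo --> f x.
  by apply: cvg_nnsfun_approx => // ? _; exact: f0.
have ndf_ x : {homo (fun n => (f_ n x)%:E) : a b / (a <= b)%N >-> a <= b}.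
  by move=> a b ab; rewrite lee_fin; exact/lefP/nd_nnsfun_approx.
transitivity (limn (fun n => \int[m']_x (f_ n x)%:E)).
{ rewrite -monotone_convergence//.
  - by apply: eq_integral => y _; apply/esym/cvg_lim => //; exact: f_f.
  - by move=> n y _; rewrite lee_fin. }
transitivity (limn (fun n => \int[m]_x ((f_ n x)%:E * (p x)%:E))); last first.
{ rewrite -monotone_convergence//.
  - apply: eq_integral => y _; apply/cvg_lim => //.
    by apply: cvgeZr => //; exact: f_f.
  - by move=> n; apply: emeasurable_funM => //; exact/measurable_EFinP.
  - by move=> n y _; rewrite mule_ge0// lee_fin.
  - by move=> y _ a b ab; rewrite lee_wpmul2r ?lee_fin// -lee_fin; exact: ndf_. }
congr (limn _); apply/funext => n.
have mpre k : measurable (f_ n @^-1` [set k]) by [].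
transitivity (\sum_(k \in range (f_ n))
    \int[m']_x (k * \1_(f_ n @^-1` [set k]) x)%:E).
{ under eq_integral do rewrite fimfunE -fsumEFin//.
  rewrite ge0_integral_fsum//.
  - by move=> k; exact/measurable_EFinP/measurable_funM.
  - by move=> k x _; rewrite nnfun_muleindic_ge0. }
transitivity (\sum_(k \in range (f_ n))
    \int[m]_x ((k * \1_(f_ n @^-1` [set k]) x)%:E * (p x)%:E)); last first.
{ rewrite -ge0_integral_fsum//.
  - apply: eq_integral => x _; rewrite -ge0_mule_fsuml//; last first.
      by move=> k; rewrite nnfun_muleindic_ge0.
    by rewrite fsumEFin// -fimfunE.
  - move=> k; apply: emeasurable_funM; last exact/measurable_EFinP.
    exact/measurable_EFinP/measurable_funM.
  - by move=> k x _; rewrite mule_ge0 ?lee_fin// -lee_fin nnfun_muleindic_ge0. }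
apply: eq_fsbigr => k kr.
have k0 : (0 <= k)%R by move: kr => /set_mem[x _ <-].
under eq_integral do rewrite EFinM.
rewrite ge0_integralZl//; last exact/measurable_EFinP.
rewrite integral_indic// setIT m'E// integral_mkcond.
under [RHS]eq_integral do rewrite EFinM -muleA.
rewrite ge0_integralZl//; last first.
{ by move=> x _; rewrite mule_ge0 ?lee_fin. }
{ by apply: emeasurable_funM; exact/measurable_EFinP. }
congr (_ * _); apply: eq_integral => x _.
by rewrite patchE indicE; case: ifPn => _; rewrite ?mul1e ?mul0e.
Qed.

End density.

(** The measure structure of a pushforward depends on a proof that the map is measurable; behind the
    existential it becomes a bundled measure handled only through its values. *)
Lemma pushforward_measureP d d' (T : measurableType d) (T' : measurableType d')
    (R : realType) (m : {measure set T -> \bar R}) (f : T -> T') :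
  measurable_fun setT f ->
  exists m' : {measure set T' -> \bar R},
    m' = pushforward m f :> (set T' -> \bar R).
Proof.
by move=> mf; exists (@measure_function_pushforward__canonical__measure_function_Measure _ _ _ _ _ m f mf).
Qed.

(** A separate name for the law Exp(1), so that it carries a probability structure over [R]
    itself. *)
Definition nu {R : realType} : set R -> \bar R := exponential_prob 1.

Section nu_probability.
Context {R : realType}.

Let nu0 : nu set0 = 0%E :> \bar R.
Proof. by rewrite /nu /exponential_prob integral_set0. Qed.

Let nu_ge0 (A : set R) : (0 <= nu A)%E.
Proof. by apply: integral_ge0 => x _; rewrite lee_fin exponential_pdf_ge0. Qed.

Let nu_sigma_additive : semi_sigma_additive (@nu R : set R -> \bar R).
Proof. exact: (@measure_semi_sigma_additive _ _ _ (exponential_prob 1)). Qed.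

HB.instance Definition _ := isMeasure.Build _ R R (@nu R)
  nu0 nu_ge0 nu_sigma_additive.

Let nu_setT : nu [set: R] = 1%E.
Proof. by rewrite /nu /exponential_prob integral_exponential_pdf. Qed.

HB.instance Definition _ := Measure_isProbability.Build _ R R (@nu R) nu_setT.

End nu_probability.

Section exponential_integrals.
Context {R : realType}.
Local Notation mu := (@lebesgue_measure R).
Local Notation nu := (@nu R).

Lemma nuE A : nu A = exponential_prob 1 A. Proof. by []. Qed.

Lemma ge0_integral_nu (f : R -> \bar R) :
  measurable_fun setT f -> (forall x, 0 <= f x)%E ->
  (\int[nu]_x f x = \int[mu]_(x in `[0%R, +oo[) (f x * (expR (- x))%:E))%E.
Proof.
move=> mf f0.
have [m' m'E] : exists m' : {measure set (measurableTypeR R) -> \bar R},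
    m' = exponential_prob (1 : R) :> (set R -> \bar R).
{ by exists (@exponential_distribution_exponential_prob__canonical__measure_function_Measure R 1 ltr01). }
transitivity (\int[m']_x f x)%E.
(* [m'] is a measure over [measurableTypeR R]; pushing it forward by the identity relates its
   integrals to those over [R]. *)
{ pose phi : measurableTypeR R -> R := idfun.
  have mphi : measurable_fun setT phi by move=> _ A mA; rewrite setTI.
  have [m2 m2E] := pushforward_measureP m' mphi.
  rewrite (@eq_measure_integral _ _ _ _ m2).
  - by rewrite m2E ge0_integral_pushforward.
  - by move=> A _ _; rewrite m2E /pushforward m'E. }
rewrite (@ge0_integral_density _ _ _ mu m' (exponential_pdf 1))//; last first.
{ by move=> A _; rewrite m'E. }
{ by move=> x; exact: exponential_pdf_ge0. }
{ exact: measurable_exponential_pdf. }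
rewrite [RHS]integral_mkcond; apply: eq_integral => x _.
rewrite patchE /exponential_pdf patchE; case: ifPn => _; last by rewrite mule0.
by rewrite mul1r mulN1r.
Qed.

Lemma is_derive_cvg (F : R -> R) (x l : R) :
  is_derive x (1 : R) F l -> F y @[y --> x] --> F x.
Proof.
move=> dF; apply: differentiable_continuous; apply/derivable1_diffP.
exact: ex_derive.
Qed.

Lemma integral_nu_FTC (f F : R -> R) (l : R) :
  measurable_fun setT f ->
  (forall x, 0 <= f x) ->
  (forall x : R, is_derive x (1 : R) F (f x * expR (- x))) ->
  {within `[0, +oo[, continuous (fun x => f x * expR (- x))} ->
  F x @[x --> +oo] --> l ->
  (\int[nu]_x (f x)%:E = (l - F 0)%:E)%E.
Proof.
move=> mf f0 dF cf Fl; rewrite ge0_integral_nu//; last exact/measurable_EFinP.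
under eq_integral do rewrite -EFinM.
rewrite (@ge0_continuous_FTC2y _ _ F _ l)//.
- by move=> x _; rewrite mulr_ge0// expR_ge0.
- by apply: cvg_at_right_filter; exact: is_derive_cvg.
- by move=> x _; rewrite derive1E; exact: derive_val.
Qed.

Lemma cvg_expRNy (c : R) : 0 < c -> expR (- (c * x)) @[x --> +oo] --> 0.
Proof.
move=> c0; apply: (@cvg_comp _ _ _ (fun x : R => c * x) (fun y => expR (- y))
  _ (pinfty_nbhs R)); last exact: cvgr_expR.
exact: gt0_cvgMry.
Qed.

Lemma is_derive_expRN (c x : R) :
  is_derive x (1 : R) (fun x => expR (- (c * x))) (- c * expR (- (c * x))).
Proof.
apply: is_derive_eq; rewrite /GRing.scale/=; ring.
Qed.

Lemma integral_expR_ray (c x : R) : 0 < c ->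
  (\int[mu]_(t in `]x, +oo[) (expR (- (c * t)))%:E =
   (c^-1 * expR (- (c * x)))%:E)%E.
Proof.
move=> c0.
have dF t : is_derive t (1 : R) (fun t => - c^-1 * expR (- (c * t))) (expR (- (c * t))).
{ have := is_derive_expRN c t => dE; apply: is_derive_eq.
  rewrite /GRing.scale/=; field; exact: lt0r_neq0. }
rewrite integral_itv_obnd_cbnd; last first.
{ apply: measurable_funTS; apply/measurable_EFinP; apply: measurableT_comp => //.
  by apply: measurable_funN; apply: measurable_funM. }
rewrite (@ge0_continuous_FTC2y _ _ (fun t => - c^-1 * expR (- (c * t))) _ 0).
- by congr EFin; ring.
- by move=> t _; rewrite expR_ge0.
- by apply: continuous_subspaceT => t; exact: is_derive_cvg (is_derive_expRN c t).
- rewrite -[X in _ --> X](mulr0 (- c^-1)); apply: cvgM; first exact: cvg_cst.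
  exact: cvg_expRNy.
- by move=> t _; have := dF t; exact: @ex_derive.
- by apply: cvg_at_right_filter; exact: is_derive_cvg (dF x).
- by move=> t _; rewrite derive1E; have := dF t; exact: @derive_val.
Qed.

(** Rays form a pi-system generating the Borel sets. The whole line is added to the class to compare
    total masses and to cover the space in the uniqueness theorem. *)
Lemma measure_rays_unique (m1 m2 : {measure set R -> \bar R}) :
  (m1 setT < +oo)%E -> m1 setT = m2 setT ->
  (forall x, m1 `]x, +oo[%classic = m2 `]x, +oo[%classic) ->
  forall A, measurable A -> m1 A = m2 A.
Proof.
move=> m1T m12T m12 A mA.
apply: (@measure_unique _ R R [set A | A = setT \/ exists x : R, A = `]x, +oo[%classic] (fun=> setT)) => //.
- rewrite -[LHS]/((@ocitv R).-sigma.-measurable) RGenOInfty.measurableE /measurable/=.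
  rewrite eqEsubset; split.
  + by apply: smallest_sub; [exact: smallest_sigma_algebra|
      move=> B [x ->]; apply: sub_sigma_algebra; right; exists x].
  + apply: smallest_sub; first exact: smallest_sigma_algebra.
    move=> B [->|[x ->]]; last by apply: sub_sigma_algebra; exists x.
    exact: (@measurableT _ (g_sigma_algebraType (@RGenOInfty.G R))).
- move=> B C [->|[x ->]] [->|[y ->]]; rewrite ?setTI ?setIT; [by left|by right; exists y|by right; exists x|].
  right; exists (Num.max x y); apply/seteqP; split=> z /=.
  + by rewrite !in_itv/= !andbT gt_max => -[-> ->].
  + by rewrite !in_itv/= !andbT gt_max => /andP.
- by move=> _; left.
- by rewrite bigcup_const.
- by move=> B [->|[x ->]].
Qed.

Lemma exponential_prob_ray (c x : R) : 0 < c ->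
  exponential_prob c `]x, +oo[%classic = (expR (- (c * Num.max x 0)))%:E.
Proof.
move=> c0; transitivity (\int[mu]_(t in `]x, +oo[)
    ((fun t => (c * expR (- c * t))%:E) \_ `[0%R, +oo[) t)%E.
{ by apply: eq_integral => t _; rewrite /exponential_pdf !patchE; case: ifP. }
rewrite -integral_mkcondr.
have -> : `]x, +oo[ `&` `[0, +oo[ = if x < 0 then `[0, +oo[%classic else `]x, +oo[%classic.
{ case: (ltP x 0) => x0; apply/seteqP; split=> t /=; rewrite !in_itv/= !andbT.
  - by case.
  - by move=> t0; split=> //; exact: lt_le_trans t0.
  - by case.
  - by move=> xt; split=> //; exact/ltW/(le_lt_trans x0). }
transitivity (\int[mu]_(t in `](Num.max x 0)%R, +oo[) (c%:E * (expR (- (c * t)))%:E))%E.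
{ case: ltP => x0.
  - rewrite integral_itv_obnd_cbnd.
    + by apply: eq_integral => t _; rewrite mulNr EFinM.
    + apply: measurable_funTS; apply: emeasurable_funM => //.
      apply/measurable_EFinP; apply: measurableT_comp => //.
      by apply: measurable_funN; apply: measurable_funM.
  - by apply: eq_integral => t _; rewrite mulNr EFinM. }
rewrite ge0_integralZl//.
- by rewrite integral_expR_ray// -EFinM mulrA mulfV ?mul1r// lt0r_neq0.
- apply: measurable_funTS; apply/measurable_EFinP; apply: measurableT_comp => //.
  by apply: measurable_funN; apply: measurable_funM.
- by rewrite lee_fin ltW.
Qed.

Lemma nu_ray (x : R) : nu `]x, +oo[%classic = (expR (- Num.max x 0))%:E.
Proof. by rewrite nuE exponential_prob_ray// mul1r. Qed.

(** The memoryless property, with the overshoot [z - t] over a level [t] tested by an arbitrary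
    Borel set; it suffices to check rays. *)
Lemma nu_shift (t : R) (A : set R) : 0 <= t -> measurable A ->
  nu [set z | t < z /\ A (z - t)] = ((expR (- t))%:E * nu A)%E.
Proof.
move=> t0 mA.
have mray : measurable (`]t, +oo[%classic : set R) by [].
have mph : measurable_fun setT (fun z : R => z - t).
{ by apply: measurable_funB. }
have [m1 m1E] := pushforward_measureP (mrestr nu mray) mph.
pose m2 : {measure set R -> \bar R} := mscale (NngNum (expR_ge0 (- t))) nu.
have m2E B : m2 B = ((expR (- t))%:E * nu B)%E by [].
have m1A B : m1 B = nu [set z | t < z /\ B (z - t)].
{ rewrite m1E /pushforward /mrestr; congr (nu _); apply/seteqP.
  by split=> z /=; rewrite in_itv/= andbT => -[]. }
rewrite -m1A; apply: (@measure_rays_unique m1 m2) => //.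
- rewrite m1A; apply: le_lt_trans (probability_le1 _ _) _; last exact: ltry.
  rewrite (_ : mkset _ = `]t, +oo[%classic)//.
  by apply/seteqP; split=> z /=; rewrite in_itv/= andbT; [case|split].
- rewrite m1A m2E probability_setT mule1 (_ : mkset _ = `]t, +oo[%classic).
  + by rewrite nu_ray (max_idPl t0).
  + by apply/seteqP; split=> z /=; rewrite in_itv/= andbT; [case|split].
- move=> x; rewrite m1A m2E (_ : mkset _ = `]t + Num.max x 0, +oo[%classic).
  + rewrite !nu_ray -EFinM -expRD -opprD; congr (expR (- _))%:E.
    by apply/max_idPl; rewrite addr_ge0// le_max lexx orbT.
  + apply/seteqP; split=> z /=; rewrite !in_itv/= !andbT -ltrBrDl gt_max subr_gt0.
    * by move=> [-> ->].
    * by move=> /andP[-> ->].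
Qed.

(** The factor [expR (- t) ^+ r.-1] is the probability that [r - 1] other exponentials exceed [t].
    So a given one of [r] is the smallest with probability [1 / r], and [r] times the minimum is
    then again Exp(1). *)
Lemma integral_nu_scale (r : nat) (A : set R) : (0 < r)%N -> measurable A ->
  (\int[nu]_t (\1_A (r%:R * t) * expR (- t) ^+ r.-1)%:E = r%:R^-1%:E * nu A)%E.
Proof.
move=> r0 mA.
have c0 : 0 < r%:R :> R by rewrite ltr0n.
have mph : measurable_fun setT (fun z : R => r%:R * z) by apply: measurable_funM.
have mpA : measurable ((fun z : R => r%:R * z) @^-1` A).
{ by rewrite -[X in measurable X]setTI; exact: mph. }
rewrite ge0_integral_nu; last first.
{ by move=> x; rewrite lee_fin mulr_ge0// exprn_ge0 ?expR_ge0. }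
{ apply/measurable_EFinP; apply: measurable_funM.
  - rewrite (_ : (fun x => \1_A (r%:R * x)) = \1_((fun z : R => r%:R * z) @^-1` A)).
    + exact: measurable_indic.
    + by apply/funext => z; rewrite !indicE; congr (nat_of_bool _)%:R.
  - by apply: measurable_funX; apply: measurableT_comp. }
transitivity (r%:R^-1%:E * exponential_prob r%:R ((fun z : R => (r%:R * z)%R) @^-1` A))%E.
{ rewrite /exponential_prob -ge0_integralZl//; last first.
  { by move=> t _; rewrite lee_fin exponential_pdf_ge0// ltW. }
  { apply: measurable_funTS; apply/measurable_EFinP; exact: measurable_exponential_pdf. }
  rewrite [LHS]integral_mkcond [RHS]integral_mkcond.
  apply: (@eq_integral _ (measurableTypeR R)) => t _.
  rewrite !patchE /exponential_pdf patchE indicE.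
  have -> : (t \in (fun z : R => r%:R * z) @^-1` A) = (r%:R * t \in A).
  { by apply/idP/idP; rewrite !inE. }
  case: (t \in _); case: (_ \in A); rewrite ?mul0r ?mul0e ?mule0//.
  rewrite mul1r -!EFinM mulrA mulVf ?mul1r ?gt_eqF// mulNr; congr EFin.
  by rewrite -expRM_natl -expRD -[in RHS](prednK r0) -natr1; congr expR; ring. }
congr (_ * _)%E.
have [m' m'E] : exists m' : {measure set (measurableTypeR R) -> \bar R},
    m' = exponential_prob (r%:R : R) :> (set R -> \bar R).
{ by exists (@exponential_distribution_exponential_prob__canonical__measure_function_Measure R r%:R c0). }
pose phi : measurableTypeR R -> R := fun z => r%:R * z.
have [m1 m1E] := pushforward_measureP m' (mph : measurable_fun setT phi).
rewrite -m'E -[LHS]/(pushforward m' phi A) -m1E.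
have m'T : m' setT = 1%E by rewrite m'E /exponential_prob integral_exponential_pdf.
apply: measure_rays_unique => //.
- by rewrite m1E /pushforward preimage_setT m'T ltry.
- by rewrite m1E /pushforward preimage_setT m'T; exact/esym/(@probability_setT _ _ _ nu).
- move=> x; rewrite m1E /pushforward m'E -[RHS]/(nu _) nu_ray.
  rewrite (_ : _ @^-1` _ = `]x / r%:R, +oo[%classic).
  + rewrite exponential_prob_ray//; congr (expR (- _))%:E.
    by rewrite maxr_pMr ?ltW// mulr0 mulrC divfK// gt_eqF.
  + by apply/seteqP; split=> z /=; rewrite /phi !in_itv/= !andbT ltr_pdivrMr// mulrC.
Qed.

Lemma integral_nu_expR (c : R) : 0 <= c ->
  (\int[nu]_t (expR (- (c * t)))%:E = (1 + c)^-1%:E)%E.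
Proof.
move=> c0; have c1 : 0 < 1 + c by rewrite ltr_wpDr.
have dF x : is_derive x (1 : R) (fun t => - (1 + c)^-1 * expR (- ((1 + c) * t)))
  (expR (- (c * x)) * expR (- x)).
{ have dE := is_derive_expRN (1 + c) x; apply: is_derive_eq.
  rewrite /GRing.scale/= -expRD (_ : - (c * x) - x = - ((1 + c) * x)); last ring.
  by field; exact: lt0r_neq0. }
rewrite (integral_nu_FTC (l := 0) _ _ dF).
- by rewrite mulr0 oppr0 expR0; congr EFin; ring.
- by apply: measurableT_comp => //; apply: measurable_funN; apply: measurable_funM.
- by move=> x; rewrite expR_ge0.
- apply: continuous_subspaceT => t.
  apply: cvgM; first exact: is_derive_cvg (is_derive_expRN c t).
  rewrite (_ : (fun x : R => expR (- x)) = (fun x => expR (- (1 * x)))).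
  + by rewrite -[t in expR (- t)]mul1r; exact: is_derive_cvg (is_derive_expRN 1 t).
  + by apply/funext => x; rewrite mul1r.
- rewrite -[X in _ --> X](mulr0 (- (1 + c)^-1)); apply: cvgM; first exact: cvg_cst.
  exact: cvg_expRNy.
Qed.

(** One step of the exponential martingale in mean square: [a] and [b] stand for quantities of the
    past, [c] for [t] times the coefficient of the new variable. *)
Lemma integral_nu_sqr_expR (a b c : R) : 0 <= c ->
  (\int[nu]_t ((b * expR (- (c * t)) - a) ^+ 2)%:E =
   (b ^+ 2 / (1 + c *+ 2) - a * b *+ 2 / (1 + c) + a ^+ 2)%:E)%E.
Proof.
move=> c0; have c1 : 0 < 1 + c by rewrite ltr_wpDr.
have c2 : 0 < 1 + c *+ 2 by rewrite ltr_wpDr// mulrn_wge0.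
have dF x : is_derive x (1 : R)
  (fun t => - (b ^+ 2 / (1 + c *+ 2)) * expR (- ((1 + c *+ 2) * t))
   + (a * b *+ 2 / (1 + c)) * expR (- ((1 + c) * t)) - a ^+ 2 * expR (- (1 * t)))
  ((b * expR (- (c * x)) - a) ^+ 2 * expR (- x)).
{ have dE1 := is_derive_expRN (1 + c *+ 2) x.
  have dE2 := is_derive_expRN (1 + c) x.
  have dE3 := is_derive_expRN 1 x; apply: is_derive_eq.
  rewrite /GRing.scale/= (_ : - ((1 + c *+ 2) * x) = - (c * x) - (c * x) - x); last ring.
  rewrite (_ : - ((1 + c) * x) = - (c * x) - x); last ring.
  rewrite mul1r !expRD; field.
  by rewrite mulr_natr !gt_eqF. }
rewrite (integral_nu_FTC (l := 0) _ _ dF).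
- by rewrite !mulr0 !oppr0 expR0; congr EFin; ring.
- apply: measurable_funX; apply: measurable_funB => //; apply: measurable_funM => //.
  by apply: measurableT_comp => //; apply: measurable_funN; apply: measurable_funM.
- by move=> x; rewrite sqr_ge0.
- apply: continuous_subspaceT => t.
  apply: cvgM.
  + rewrite expr2; apply: cvgM; (apply: cvgB; last exact: cvg_cst);
      (apply: cvgM; first exact: cvg_cst); exact: is_derive_cvg (is_derive_expRN c t).
  + rewrite (_ : (fun x : R => expR (- x)) = (fun x => expR (- (1 * x)))).
    * by rewrite -[t in expR (- t)]mul1r; exact: is_derive_cvg (is_derive_expRN 1 t).
    * by apply/funext => x; rewrite mul1r.
- rewrite [X in _ --> X](_ : 0 = - (b ^+ 2 / (1 + c *+ 2)) * 0
     + (a * b *+ 2 / (1 + c)) * 0 - a ^+ 2 * 0); last by rewrite !mulr0 addr0 subr0.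
  apply: cvgB; first apply: cvgD; (apply: cvgM; first exact: cvg_cst);
    exact: cvg_expRNy.
Qed.

Lemma cvg_exprn_expRN (n : nat) : x ^+ n * expR (- (1 * x)) @[x --> +oo] --> (0 : R).
Proof.
apply: (@squeeze_cvgr _ _ _ _ (cst 0) (fun x : R => (n.+1)`!%:R * x^-1)).
- near=> x; have x0 : 0 < x by near: x; exact: nbhs_pinfty_gt.
  rewrite mulr_ge0 ?exprn_ge0 ?expR_ge0 ?(ltW x0)//= mul1r expRN.
  rewrite ler_pdivrMr ?expR_gt0// mulrAC ler_pdivlMr// mulrC -exprS.
  rewrite -ler_pdivrMl ?ltr0n ?fact_gt0// mulrC.
  apply: le_trans (expR_ge1Dxn n (ltW x0)); lra.
- exact: cvg_cst.
- rewrite -[X in _ --> X](mulr0 (n.+1)`!%:R); apply: cvgM; first exact: cvg_cst.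
  by apply/gtr0_cvgV0; [near=> x; near: x; exact: nbhs_pinfty_gt|exact: cvg_id].
Unshelve. all: by end_near. Qed.

Lemma is_derive_exprn_expRN (n : nat) (x : R) :
  is_derive x (1 : R) (fun t => t ^+ n * expR (- (1 * t)))
    (n%:R * x ^+ n.-1 * expR (- (1 * x)) - x ^+ n * expR (- (1 * x))).
Proof.
have dE := is_derive_expRN 1 x.
have dX : is_derive x (1 : R) (fun t => t ^+ n) (n%:R * x ^+ n.-1).
{ have := @is_deriveX _ _ (id : R -> R) n x 1 1 (is_derive_id _ _).
  by rewrite /GRing.scale/= mulr1 exprfctE. }
by apply: is_derive_eq; rewrite /GRing.scale/=; ring.
Qed.

Lemma is_derive_comb3 (f0 f1 f2 : R -> R) (a b c d0 d1 d2 x : R) :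
  is_derive x (1 : R) f0 d0 -> is_derive x (1 : R) f1 d1 ->
  is_derive x (1 : R) f2 d2 ->
  is_derive x (1 : R) (fun t => a * f0 t + b * f1 t + c * f2 t)
    (a * d0 + b * d1 + c * d2).
Proof.
by move=> h0 h1 h2; apply: is_derive_eq; rewrite /GRing.scale/=; ring.
Qed.

Lemma integral_nu_sqr (g c : R) :
  (\int[nu]_t ((g + c * (t - 1)) ^+ 2)%:E = (g ^+ 2 + c ^+ 2)%:E)%E.
Proof.
(* The square is [(h + c * x) ^+ 2], and repeated integration by parts of this polynomial against
   the exponential produces the primitive below. *)
pose h := g - c.
have dF x : is_derive x (1 : R)
  (fun t => - (h ^+ 2 + c * h *+ 2 + c ^+ 2 *+ 2) * (t ^+ 0 * expR (- (1 * t)))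
    + - (c * h *+ 2 + c ^+ 2 *+ 2) * (t ^+ 1 * expR (- (1 * t)))
    + - c ^+ 2 * (t ^+ 2 * expR (- (1 * t))))
  ((g + c * (x - 1)) ^+ 2 * expR (- x)).
{ rewrite (_ : _ * expR (- x) = - (h ^+ 2 + c * h *+ 2 + c ^+ 2 *+ 2) *
      (0%:R * x ^+ 0.-1 * expR (- (1 * x)) - x ^+ 0 * expR (- (1 * x)))
    + - (c * h *+ 2 + c ^+ 2 *+ 2) *
      (1%:R * x ^+ 1.-1 * expR (- (1 * x)) - x ^+ 1 * expR (- (1 * x)))
    + - c ^+ 2 * (2%:R * x ^+ 2.-1 * expR (- (1 * x)) - x ^+ 2 * expR (- (1 * x)))).
  - by apply: is_derive_comb3; exact: is_derive_exprn_expRN.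
  - by rewrite /= mul1r /h; ring. }
rewrite (integral_nu_FTC (l := 0) _ _ dF).
- by rewrite !mulr0 !oppr0 expR0 /h; congr EFin; ring.
- apply: measurable_funX; apply: measurable_funD => //; apply: measurable_funM => //.
  exact: measurable_funB.
- by move=> x; rewrite sqr_ge0.
- apply: continuous_subspaceT => t.
  apply: cvgM.
  + rewrite expr2; apply: cvgM; (apply: cvgD; first exact: cvg_cst);
      (apply: cvgM; first exact: cvg_cst); (apply: cvgB; last exact: cvg_cst); exact: cvg_id.
  + rewrite (_ : (fun x : R => expR (- x)) = (fun x => expR (- (1 * x)))).
    * by rewrite -[t in expR (- t)]mul1r; exact: is_derive_cvg (is_derive_expRN 1 t).
    * by apply/funext => x; rewrite mul1r.
- rewrite [X in _ --> X](_ : 0 = - (h ^+ 2 + c * h *+ 2 + c ^+ 2 *+ 2) * 0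
     + - (c * h *+ 2 + c ^+ 2 *+ 2) * 0 + - c ^+ 2 * 0); last by rewrite !mulr0 !addr0.
  by apply: cvgD; first apply: cvgD; (apply: cvgM; first exact: cvg_cst);
    exact: cvg_exprn_expRN.
Qed.

End exponential_integrals.

(** * Integrating out a coordinate independent of the past *)

Section independence.
Context d (T : measurableType d) (R : realType) (P : probability T R).

(** Substitute for conditional expectation. Typing the first argument of [f] by
    [g_sigma_algebraType G] makes its measurability express dependence on the past generated by [G],
    and independence is required only on the pi-system [G]. *)
Lemma ge0_integral_indep (G : set (set T)) (V : T -> R) (m : probability R R)
    (f : g_sigma_algebraType G * R -> \bar R) :
  G `<=` measurable -> setI_closed G -> G setT -> measurable_fun setT V ->
  (forall A B, G A -> measurable B -> P (A `&` V @^-1` B) = (P A * m B)%E) ->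
  measurable_fun setT f -> (forall x, (0 <= f x)%E) ->
  (\int[P]_w f (w, V w) = \int[P]_w \int[m]_t f (w, t))%E /\
  (\int[P]_w f (w, V w) = \int[m]_t \int[P]_w f (w, t))%E.
Proof.
move=> Gm GI GT mV GV mf f0.
have sGm : <<s G >> `<=` measurable.
{ by apply: smallest_sub => //; exact: sigma_algebra_measurable. }
pose TG := g_sigma_algebraType G.
have mid : measurable_fun setT (idfun : T -> TG).
{ by move=> _ A mA; rewrite setTI; exact: sGm. }
pose id' : {RV P >-> TG} :=
  HB.pack (idfun : T -> TG) (isMeasurableFun.Build _ _ _ _ _ mid).
have mg : measurable_fun setT (fun w : T => (id' w, V w)).
{ by apply: measurable_fun_pair. }
pose g : {RV P >-> (TG * R)%type} :=
  HB.pack (fun w : T => (id' w, V w)) (isMeasurableFun.Build _ _ _ _ _ mg).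
(* The product rule passes from [G] to the sigma-algebra it generates, because for fixed [B] both
   sides are finite measures in [A]. *)
have indG A B : <<s G >> A -> measurable B ->
    P (A `&` V @^-1` B) = (P A * m B)%E.
{ move=> sA mB.
  have mVB : measurable (V @^-1` B) by rewrite -[X in measurable X]setTI; exact: mV.
  pose m1 : {measure set T -> \bar R} := mrestr P mVB.
  have mB0 : (0 <= fine (m B))%R by rewrite fine_ge0.
  pose m2 : {measure set T -> \bar R} := mscale (NngNum mB0) P.
  have := @g_sigma_algebra_measure_unique _ _ _ G Gm (fun=> setT) (fun=> GT) _ m1 m2 GI.
  have m1E C : m1 C = P (C `&` V @^-1` B) by [].
  have m2E C : m2 C = (P C * m B)%E.
  { by rewrite muleC -[m B]fineK ?fin_num_measure. }
  rewrite -m1E -m2E => /(_ _ _ _ A sA); apply.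
  - by rewrite bigcup_const.
  - by move=> A' GA'; rewrite m1E m2E GV.
  - by move=> _; rewrite m1E setTI ltey_eq fin_num_measure. }
have -> : (\int[P]_w f (w, V w) = \int[(distribution P id' \x m)%E]_z f z)%E.
{ transitivity (\int[distribution P g]_z f z)%E.
  - by rewrite ge0_integral_distribution.
  - rewrite -(@eq_measure_integral _ _ _ _ (distribution P g) (distribution P id' \x m)%E)//.
    by move=> A mA _; apply: product_measure_unique => // {}A B mA' mB; rewrite -indG. }
split.
- rewrite fubini_tonelli1// ge0_integral_distribution//.
  + exact: measurable_fun_fubini_tonelli_F.
  + by move=> y; apply: integral_ge0.
- rewrite fubini_tonelli2//; apply: eq_integral => t _.
  rewrite /fubini_G ge0_integral_distribution//.
  exact: (measurableT_comp mf (measurable_pair2 t)).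
Qed.

End independence.

(** * Families of independent exponential variables *)

Lemma integral_indicT d (T : measurableType d) (R : realType)
    (m : {measure set T -> \bar R}) (A : set T) :
  measurable A -> m A = (\int[m]_w (\1_A w)%:E)%E.
Proof. by move=> mA; rewrite integral_indic// setIT. Qed.

Lemma eq_integral_nu (R : realType) (f g : R -> \bar R) :
  measurable_fun setT f -> measurable_fun setT g ->
  (forall t, 0 <= f t)%E -> (forall t, 0 <= g t)%E ->
  (forall t, 0 <= t -> f t = g t) ->
  (\int[nu]_t f t = \int[nu]_t g t)%E.
Proof.
move=> mf mg f0 g0 fg; rewrite !ge0_integral_nu//; apply: eq_integral => t.
by rewrite inE/= in_itv/= andbT => /fg ->.
Qed.

Lemma measurable_set_lt d (T : measurableType d) (R : realType) (f g : T -> R) :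
  measurable_fun setT f -> measurable_fun setT g ->
  measurable [set w | f w < g w].
Proof.
move=> mf mg; have := measurable_fun_ltr mf mg => /(_ measurableT [set true]).
by rewrite setTI; apply.
Qed.

Lemma emeasurable_prod d (T : measurableType d) (R : realType) (s : seq nat)
    (f : nat -> T -> \bar R) :
  (forall i, measurable_fun setT (f i)) ->
  measurable_fun setT (fun x => \prod_(i <- s) f i x)%E.
Proof.
move=> mf; elim: s => [|j s IH].
- by rewrite (_ : (fun x => _) = cst 1%E)//; apply/funext => x; rewrite big_nil.
- rewrite (_ : (fun x => _) = (fun x => f j x * \prod_(i <- s) f i x)%E).
  + exact: emeasurable_funM.
  + by apply/funext => x; rewrite big_cons.
Qed.

Section exp_iid.
Context d (T : measurableType d) (R : realType) (P : probability T R).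
Implicit Types (D I : pred nat) (v : nat -> T -> R).

(** Independence and law are restricted to the indices in [D], because the threshold has normalized
    increments only at the steps with delta_k = 1. *)
Definition exp_iid D v : Prop :=
  (forall i, measurable_fun setT (v i)) /\
  forall (J : seq nat) (A : nat -> set R), uniq J -> all D J ->
    (forall i, measurable (A i)) ->
    P (\bigcap_(i in [set` J]) (v i @^-1` A i)) = (\prod_(i <- J) nu (A i))%E.

(** A pi-system that generates the sigma-algebra of the [v i] with [I i]; it represents the past in
    all uses of Tonelli's theorem. *)
Definition cylinders v I : set (set T) :=
  [set C | exists (J : seq nat) (A : nat -> set R), [/\ uniq J, all I J,
    forall i, measurable (A i) & C = \bigcap_(i in [set` J]) (v i @^-1` A i)]].

Lemma measurable_bigcap_preimage v (J : seq nat) (A : nat -> set R) :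
  (forall i, measurable_fun setT (v i)) -> (forall i, measurable (A i)) ->
  measurable (\bigcap_(i in [set` J]) (v i @^-1` A i)).
Proof.
move=> mv mA; apply: bigcap_measurableType => i _.
by rewrite -[X in measurable X]setTI; exact: mv.
Qed.

Lemma cylinders_measurable D v I : exp_iid D v -> cylinders v I `<=` measurable.
Proof. by move=> [mv _] _ [J [A [_ _ mA ->]]]; exact: measurable_bigcap_preimage. Qed.

Lemma cylindersI v I : setI_closed (cylinders v I).
Proof.
move=> _ _ [J1 [A1 [u1 I1 m1 ->]]] [J2 [A2 [u2 I2 m2 ->]]].
exists (undup (J1 ++ J2)), (fun i => (if i \in J1 then A1 i else setT) `&`
  (if i \in J2 then A2 i else setT)); split.
- exact: undup_uniq.
- apply/allP => i; rewrite mem_undup mem_cat => /orP[].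
  + by move/(allP I1).
  + by move/(allP I2).
- by move=> i; apply: measurableI; case: ifP.
- apply/seteqP; split=> w /=.
  + move=> [h1 h2] i /= _; split; case: ifPn => //= iJ; [exact: h1|exact: h2].
  + move=> h; split=> i /= iJ.
    * by have := h i; rewrite /= mem_undup mem_cat iJ => /(_ isT)[].
    * by have := h i; rewrite /= mem_undup mem_cat iJ orbT => /(_ isT)[].
Qed.

Lemma cylindersT v I : cylinders v I setT.
Proof.
exists [::], (fun=> setT); split=> //.
by apply/seteqP; split=> w.
Qed.

Lemma measurable_cylinders v I i : I i ->
  measurable_fun setT (v i : g_sigma_algebraType (cylinders v I) -> R).
Proof.
move=> Ii _ A mA; rewrite setTI; apply: sub_sigma_algebra.
exists [:: i], (fun=> A); split=> //; first by rewrite /= Ii.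
apply/seteqP; split=> w /=.
- by move=> Aw j /=; rewrite inE => /eqP ->.
- by move=> /(_ i); apply; rewrite /= inE.
Qed.

Lemma measurable_cylinders_id D v I : exp_iid D v ->
  measurable_fun setT (idfun : T -> g_sigma_algebraType (cylinders v I)).
Proof.
move=> vD _ A mA; rewrite setTI.
have : <<s cylinders v I >> `<=` measurable.
{ apply: smallest_sub; first exact: sigma_algebra_measurable.
  exact: cylinders_measurable vD. }
exact.
Qed.

Lemma exp_iid_cylinder D v I a : exp_iid D v -> D a ->
  (forall i, I i -> D i && (i != a)) ->
  forall C B, cylinders v I C -> measurable B ->
  P (C `&` v a @^-1` B) = (P C * nu B)%E.
Proof.
move=> [mv vD] Da ID _ B [J [A [uJ IJ mA ->]]] mB.
have aJ : a \notin J.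
{ by apply/negP => /(allP IJ)/ID; rewrite eqxx andbF. }
have DJ : all D J by apply/allP => i /(allP IJ)/ID/andP[].
pose A' i := if i == a then B else A i.
have mA' i : measurable (A' i) by rewrite /A'; case: ifP.
have -> : \bigcap_(i in [set` J]) (v i @^-1` A i) `&` v a @^-1` B =
    \bigcap_(i in [set` a :: J]) (v i @^-1` A' i).
{ apply/seteqP; split=> w /=.
  - move=> [h hB] i /=; rewrite inE /A'; case: eqVneq => [->//|ia]/= iJ.
    exact: h.
  - move=> h; split=> [i /= iJ|].
    + have := h i; rewrite /= inE iJ orbT /A' => /(_ isT).
      by case: eqVneq => // ia; rewrite -ia iJ in aJ.
    + by have := h a; rewrite /= inE eqxx /A' eqxx => /(_ isT). }
rewrite vD//=; [|by rewrite aJ|by rewrite Da].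
rewrite big_cons /A' eqxx muleC vD//; congr (_ * _)%E.
apply: eq_big_seq => i iJ; case: eqVneq => // ia.
by rewrite -ia iJ in aJ.
Qed.

Lemma exp_iid_tonelli D v I a
    (f : g_sigma_algebraType (cylinders v I) * R -> \bar R) :
  exp_iid D v -> D a -> (forall i, I i -> D i && (i != a)) ->
  measurable_fun setT f -> (forall x, 0 <= f x)%E ->
  (\int[P]_w f (w, v a w) = \int[P]_w \int[nu]_t f (w, t))%E /\
  (\int[P]_w f (w, v a w) = \int[nu]_t \int[P]_w f (w, t))%E.
Proof.
move=> vD Da ID mf f0; apply: ge0_integral_indep => //.
- exact: cylinders_measurable vD.
- exact: cylindersI.
- exact: cylindersT.
- by case: vD.
- by move=> A B; exact: exp_iid_cylinder vD Da ID A B.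
Qed.

(** Once coordinate [a] is fixed at [t], the others remain independent and each joint constraint
    becomes a section. This serves both for the smallest entry of a block and for the absence of
    ties. *)
Lemma exp_iid_pinned D v a (J : seq nat) (C : set R) (B : nat -> set (R * R)) :
  exp_iid D v -> D a -> uniq J -> all D J -> a \notin J ->
  measurable C -> (forall i, measurable (B i)) ->
  P (v a @^-1` C `&` \bigcap_(i in [set` J]) [set w | B i (v a w, v i w)]) =
  (\int[nu]_t ((\1_C t)%:E * \prod_(i <- J) nu (xsection (B i) t)))%E.
Proof.
move=> vD Da uJ DJ aJ mC mB; have mv := vD.1.
pose I := [pred i | i \in J].
have ID i : I i -> D i && (i != a).
{ move=> /= iJ; rewrite (allP DJ _ iJ)/=; apply/eqP => ia.
  by rewrite -ia iJ in aJ. }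
pose S := [set z : g_sigma_algebraType (cylinders v I) * R |
  C z.2 /\ forall i, i \in J -> B i (z.2, v i z.1)].
have mS : measurable S.
{ have -> : S = snd @^-1` C `&` \bigcap_(i in [set` J]) ((fun z => (z.2, v i z.1)) @^-1` B i).
  { by apply/seteqP; split=> z /= [h1 h2]; split=> // i; exact: h2. }
  apply: measurableI; first by rewrite -[X in measurable X]setTI; exact: measurable_snd.
  apply: bigcap_measurableType => i iJ; rewrite -[X in measurable X]setTI.
  have : measurable_fun setT (fun z : g_sigma_algebraType (cylinders v I) * R =>
    (z.2, v i z.1)).
  { apply: measurable_fun_pair => //.
    exact: (measurableT_comp (measurable_cylinders iJ) measurable_fst). }
  by apply. }
have [_] := @exp_iid_tonelli D v I a (fun z => (\1_S z)%:E) vD Da ID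
  ltac:(by apply/measurable_EFinP; exact: measurable_indic)
  ltac:(by move=> z; rewrite lee_fin).
have mPS : measurable (v a @^-1` C `&` \bigcap_(i in [set` J]) [set w | B i (v a w, v i w)]).
{ apply: measurableI; first by rewrite -[X in measurable X]setTI; exact: mv.
  apply: bigcap_measurableType => i iJ; rewrite -[X in measurable X]setTI.
  have : measurable_fun setT (fun w => (v a w, v i w)) by exact: measurable_fun_pair.
  by apply. }
have -> : (\int[P]_w (\1_S (w, v a w))%:E =
    P (v a @^-1` C `&` \bigcap_(i in [set` J]) [set w | B i (v a w, v i w)]))%E.
{ rewrite (integral_indicT P mPS).
  by apply: eq_integral => w _; rewrite !indicE; congr (nat_of_bool _)%:R%:E. }
move=> ->; apply: eq_integral => t _.
pose A i := xsection (B i) t.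
have mA i : measurable (A i) by exact: measurable_xsection.
rewrite -(vD.2 J A uJ DJ mA).
have mJ : measurable (\bigcap_(i in [set` J]) v i @^-1` A i).
{ exact: measurable_bigcap_preimage. }
have [Ct|Ct] := boolP (t \in C).
- rewrite [\1_C t]indicE Ct mul1e (integral_indicT P mJ).
  apply: eq_integral => w _; rewrite !indicE; congr (nat_of_bool _)%:R%:E.
  apply/idP/idP; rewrite !inE /S/=.
  + by move=> [_ h] i /= iJ; rewrite /A xsectionE/=; exact: h.
  + move=> h; split; first by rewrite inE in Ct.
    by move=> i iJ; have := h i iJ; rewrite /A xsectionE.
- rewrite [\1_C t]indicE (negbTE Ct) mul0e; apply: integral0_eq => w _.
  rewrite indicE (_ : _ \in S = false)//; apply/negP; rewrite inE /S/= => -[].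
  by rewrite notin_setE in Ct.
Qed.

(** Any finite [J] lies in an initial segment; the missing indices receive the full set, whose mass
    1 does not change the product. *)
Lemma exp_iid_iota D v :
  (forall i, measurable_fun setT (v i)) ->
  (forall (N : nat) (A : nat -> set R), (forall i, measurable (A i)) ->
    (forall i, ~~ D i -> A i = setT) ->
    P (\bigcap_(i in [set` iota 0 N]) (v i @^-1` A i)) =
    (\prod_(i <- iota 0 N) nu (A i))%E) ->
  exp_iid D v.
Proof.
move=> mv h; split=> // J A uJ DJ mA.
have [N JN] : exists N, forall i, i \in J -> i \in iota 0 N.
{ exists (\max_(i <- J) i).+1 => i iJ; rewrite mem_iota/= add0n ltnS; exact: (@leq_bigmax_seq _ _ xpredT id). }
pose A' i := if i \in J then A i else setT.
have mA' i : measurable (A' i) by rewrite /A'; case: ifP.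
have := h N A' mA'; rewrite (_ : \bigcap_(i in _) _ = \bigcap_(i in [set` J]) v i @^-1` A i).
- move=> ->; first rewrite (bigID (mem J))/= [X in (_ * X)%E]big1 ?mule1.
  + rewrite -big_filter; transitivity (\prod_(i <- J) nu (A' i))%E.
    * apply: perm_big; apply: uniq_perm => //; first by rewrite filter_uniq// iota_uniq.
      by move=> i; rewrite mem_filter; case: (boolP (i \in J)) => //= /JN ->.
    * by apply: eq_big_seq => i iJ; rewrite /A' iJ.
  + by move=> i iJ; rewrite /A' (negbTE iJ); exact: (@probability_setT _ _ _ nu).
  + move=> i Di; rewrite /A' ifF//; apply/negP => /(allP DJ) Di'.
    by rewrite Di' in Di.
- apply/seteqP; split=> w /= hw i /=.
  + by move=> iJ; have := hw i (JN _ iJ); rewrite /A' iJ.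
  + by rewrite /A'; case: ifPn => // iJ _; exact: hw.
Qed.

End exp_iid.

(** * Renyi's representation as a rearrangement of a block *)

Section Theta.
Context {R : realType}.
Implicit Types (v : nat -> R).

(** The initial value [v a] is itself in the block as soon as [0 < n]. *)
Definition block_min v (a n : nat) : R :=
  \big[Num.min/v a]_(i <- iota a n) v i.

(* The block [a, a + n) of v holds iid overshoots over a threshold: n * min is
   the normalized distance to the smallest one, which becomes the new
   threshold; it is swapped with entry a. *)
Definition Theta (a n : nat) v : nat -> R := fun i =>
  if i == a then n%:R * block_min v a n
  else if (a < i < a + n)%N then
    (if v i <= block_min v a n then v a else v i) - block_min v a n
  else v i.

Lemma block_min_le v a n i : (a <= i < a + n)%N -> block_min v a n <= v i.
Proof.
move=> ain; have : i \in iota a n by rewrite mem_iota.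
rewrite /block_min; elim: (iota a n) => //= j s IH; rewrite inE big_cons ge_min.
by move=> /orP[/eqP ->|/IH ->]; rewrite ?lexx ?orbT.
Qed.

Lemma block_min_ge v a n (x : R) : (0 < n)%N ->
  (forall i, (a <= i < a + n)%N -> x <= v i) -> x <= block_min v a n.
Proof.
move=> n0 xv; rewrite /block_min big_seq.
elim/big_ind : _ => [|y z xy xz|i]; last by rewrite mem_iota; exact: xv.
- by apply: xv; rewrite leqnn/= -addn1 leq_add2l.
- by rewrite le_min xy.
Qed.

Lemma block_minE v a n i : (a <= i < a + n)%N ->
  (forall j, (a <= j < a + n)%N -> v i <= v j) -> block_min v a n = v i.
Proof.
move=> ain vi; apply/eqP; rewrite eq_le block_min_le//= block_min_ge//.
by move: ain; case: n {vi} => // /andP[]; rewrite addn0 => /leq_ltn_trans/[apply]; rewrite ltnn.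
Qed.

Lemma Theta_ge0 a n v : (forall i, 0 <= v i) -> forall i, 0 <= Theta a n v i.
Proof.
move=> v0 i; rewrite /Theta; case: eqVneq => [_|ia].
- case: n => [|n]; first by rewrite mul0r.
  by rewrite mulr_ge0// block_min_ge.
- case: ifPn => // /andP[ai ian]; rewrite subr_ge0; case: ifPn => _.
  + by apply: block_min_le; rewrite leqnn/= (ltn_trans ai).
  + by apply: block_min_le; rewrite (ltnW ai).
Qed.

Lemma eq_Theta a n v v' i : (0 < n)%N -> (i < a + n)%N ->
  (forall j, (j < a + n)%N -> v j = v' j) -> Theta a n v i = Theta a n v' i.
Proof.
move=> n0 ian vv'.
have bm : block_min v a n = block_min v' a n.
{ rewrite /block_min vv'; last by rewrite -addn1 leq_add2l.
  by apply: eq_big_seq => j; rewrite mem_iota => /andP[_ /vv']. }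
by rewrite /Theta bm !vv'//; rewrite -addn1 leq_add2l.
Qed.

Lemma Theta_out a n v i : ~~ (a <= i < a + n)%N -> (0 < n)%N -> Theta a n v i = v i.
Proof.
move=> ain n0; rewrite /Theta; case: eqVneq => [ia|ia].
- by move: ain; rewrite ia leqnn -addn1 leq_add2l n0.
- case: ifPn => // /andP[ai ian]; by rewrite (ltnW ai) ian in ain.
Qed.

Lemma measurable_Theta d (T : measurableType d) (v : nat -> T -> R) a n i :
  (forall j, measurable_fun setT (v j)) ->
  measurable_fun setT (fun w => Theta a n (v^~ w) i).
Proof.
move=> mv.
have mb : measurable_fun setT (fun w => block_min (v^~ w) a n).
{ rewrite /block_min; elim: (iota a n) => [|j s IH].
  - by rewrite (_ : (fun w => _) = v a)//; apply/funext => w; rewrite big_nil.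
  - rewrite (_ : (fun w => _) = (fun w => Num.min (v j w) (\big[Num.min/v a w]_(i <- s) v i w))).
    + exact: measurable_minr.
    + by apply/funext => w; rewrite big_cons. }
rewrite /Theta; case: (i == a); first exact: measurable_funM.
case: (a < i < a + n)%N => //; apply: measurable_funB => //.
by apply: measurable_fun_ifT => //; exact: measurable_fun_ler.
Qed.

End Theta.

Section Theta_iid.
Context d (T : measurableType d) (R : realType) (P : probability T R).

(** Split by the position [c] of the strict minimum. Given [v c = t], the other entries of the block
    must exceed [t], and by the memoryless property their excesses are again Exp(1); [n * t] is
    treated by [integral_nu_scale]. Each position contributes [1 / n] of the product, and the [n]
    contributions add up. *)
Lemma Theta_exp_iid (v : nat -> T -> R) (a n : nat) : (0 < n)%N ->
  exp_iid P predT v -> exp_iid P predT (fun i w => Theta a n (v^~ w) i).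
Proof.
move=> n0 vD; have mv := vD.1.
have mTh i : measurable_fun setT (fun w => Theta a n (v^~ w) i).
{ exact: measurable_Theta. }
apply: exp_iid_iota => // N A mA _.
(* Padding with full sets puts the block inside the initial segment. *)
wlog anN : N A mA / (a + n <= N)%N.
{ move=> h; have := h (N + (a + n))%N (fun i => if (i < N)%N then A i else setT).
  rewrite leq_addl => /(_ _ isT); rewrite (_ : (\prod_(_ <- _) _)%E = (\prod_(i <- iota 0 N) nu (A i))%E).
  - move=> <-.
    + congr (P _); apply/seteqP; split=> w /= hw i /=; rewrite mem_iota/= add0n => iN.
      * case: ifPn => // iN'; apply: hw; by rewrite /= mem_iota.
      * have := hw i; rewrite /= mem_iota/= add0n iN; apply.
        by rewrite (leq_trans iN)// leq_addr.
    + by move=> i; case: ifP.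
  - rewrite iotaD big_cat/= [X in (_ * X)%E]big1_seq ?mule1.
    + by apply: eq_big_seq => i; rewrite mem_iota/= add0n => ->.
    + move=> i /andP[_]; rewrite mem_iota add0n => /andP[Ni _].
      by rewrite ltnNge Ni/=; exact: (@probability_setT _ _ _ nu). }
pose Bk i := (a <= i < a + n)%N.
(* If the minimum sits at [c], the rearranged array stores the excess of [v a] at [c], so entry [a]
   is tested against [A c]. *)
pose sg c l := if l == a then c else l.
pose S c := [set w | forall l, Bk l -> l != c -> v c w < v l w].
pose B (A : nat -> set R) c l : set (R * R) :=
  if Bk l then [set tz | tz.1 < tz.2 /\ A (sg c l) (tz.2 - tz.1)]
  else [set tz | A l tz.2].
pose Q (A : nat -> set R) :=
  \bigcap_(i in [set` iota 0 N]) ((fun w => Theta a n (v^~ w) i) @^-1` A i).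
have aN : (a < N)%N by apply: leq_trans anN; rewrite -addn1 leq_add2l.
have Bka : Bk a by rewrite /Bk leqnn -addn1 leq_add2l.
have BkN l : Bk l -> (l < N)%N by move=> /andP[_ /leq_trans]; exact.
have QSE A' c : Bk c -> Q A' `&` S c =
    v c @^-1` [set t | A' a (n%:R * t)] `&`
    \bigcap_(l in [set` [seq l <- iota 0 N | l != c]])
      [set w | B A' c l (v c w, v l w)].
{ move=> Bkc.
  have minE w : S c w -> block_min (v^~ w) a n = v c w.
  { move=> Sw; apply: block_minE => // j Bkj.
    by have [->//|jc] := eqVneq j c; exact/ltW/Sw. }
  apply/seteqP; split=> w /=.
  - move=> [Qw Sw]; have bE := minE w Sw; split.
    + have := Qw a; rewrite /= mem_iota/= add0n aN => /(_ isT).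
      by rewrite /Theta eqxx bE.
    + move=> l /=; rewrite mem_filter mem_iota/= add0n => /andP[lc lN].
      rewrite /B; case: ifPn => Bkl /=.
      * split; first exact: Sw.
        rewrite /sg; case: eqVneq => [la|la].
        -- have := Qw c; rewrite /= mem_iota/= add0n BkN// => /(_ isT).
           rewrite /Theta ifF; last by apply/eqP => ca; rewrite la ca eqxx in lc.
           rewrite ifT; last first.
           { by move: Bkc => /andP[ac ->]; rewrite andbT ltn_neqAle ac andbT -la. }
           by rewrite bE lexx la.
        -- have := Qw l; rewrite /= mem_iota/= add0n lN => /(_ isT).
           rewrite /Theta (negbTE la) ifT; last first.
           { by move: Bkl => /andP[al ->]; rewrite andbT ltn_neqAle al andbT eq_sym. }
           by rewrite bE leNgt Sw.
      * have := Qw l; rewrite /= mem_iota/= add0n lN => /(_ isT).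
        by rewrite Theta_out.
  - move=> [Ac Bw].
    have Sw : S c w.
    { move=> l Bkl lc; have := Bw l; rewrite /= mem_filter mem_iota/= add0n lc BkN// => /(_ isT).
      by rewrite /B Bkl => -[]. }
    have bE := minE w Sw; split=> // l /=; rewrite mem_iota/= add0n => lN.
    have [la|la] := eqVneq l a; first by rewrite la /Theta eqxx bE.
    have [Bkl|Bkl] := boolP (Bk l); last first.
    { rewrite Theta_out//; have := Bw l; rewrite /= mem_filter mem_iota/= add0n lN andbT.
      rewrite /B (negbTE Bkl)/=; apply.
      by apply/eqP => lc; rewrite lc Bkc in Bkl. }
    rewrite /Theta (negbTE la) ifT; last first.
    { by move: Bkl => /andP[al ->]; rewrite andbT ltn_neqAle al andbT eq_sym. }
    rewrite bE; have [lc|lc] := eqVneq l c.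
    + rewrite lc lexx; have := Bw a; rewrite /= mem_filter mem_iota/= add0n aN andbT.
      rewrite /B Bka /sg eqxx/=; rewrite eq_sym -lc => /(_ la)[_].
      by rewrite lc.
    + rewrite leNgt Sw//=; have := Bw l; rewrite /= mem_filter mem_iota/= add0n lN lc => /(_ isT).
      by rewrite /B Bkl /sg (negbTE la)/= => -[]. }
pose s c := [seq l <- iota 0 N | l != c].
have cntBk c : Bk c -> count Bk (s c) = n.-1.
{ move=> Bkc; rewrite /s count_filter.
  rewrite -(@size_filter _ (predI Bk _)).
  have -> : size [seq l <- iota 0 N | predI Bk (predC1 c) l] = size (rem c (iota a n)).
  { apply: perm_size; apply: uniq_perm.
    - by rewrite filter_uniq// iota_uniq.
    - by rewrite rem_uniq// iota_uniq.
    - move=> l; rewrite mem_filter/= mem_rem_uniq ?iota_uniq// inE/= !mem_iota/= add0n.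
      rewrite andbC -/(Bk l); have [/BkN ->|] := boolP (Bk l); rewrite ?andbT ?andbF//. }
  by rewrite size_rem ?size_iota// mem_iota. }
(* While [l] avoids [c], the index [sg c l] runs through everything but [a]. *)
have prod_sg (q : nat -> R) c : Bk c ->
    \prod_(l <- s c) q (sg c l) = \prod_(l <- iota 0 N | l != a) q l.
{ move=> Bkc; rewrite /s big_filter; have [->|ca] := eqVneq c a.
  - by apply: eq_bigr => l la; rewrite /sg (negbTE la).
  - rewrite -big_filter (bigD1_seq a); [|by rewrite mem_filter eq_sym ca mem_iota|by rewrite filter_uniq// iota_uniq].
    rewrite -[RHS]big_filter [RHS](bigD1_seq c); [|by rewrite mem_filter ca mem_iota BkN|by rewrite filter_uniq// iota_uniq].
    rewrite /= {1}/sg eqxx; congr (_ * _); rewrite !big_filter_cond.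
    apply: eq_big => l; first by rewrite andbC.
    by rewrite /sg => /andP[_ /negbTE ->]. }
have mB A' c l : (forall i, measurable (A' i)) -> measurable (B A' c l).
{ move=> mA'; rewrite /B; case: (Bk l).
  - have -> : [set tz : R * R | tz.1 < tz.2 /\ A' (sg c l) (tz.2 - tz.1)] =
      [set tz : R * R | tz.1 < tz.2] `&` ((fun tz => tz.2 - tz.1) @^-1` A' (sg c l)) by [].
    apply: measurableI.
    + exact: measurable_set_lt.
    + rewrite -[X in measurable X]setTI.
      have : measurable_fun setT (fun tz : R * R => tz.2 - tz.1) by exact: measurable_funB.
      by apply.
  - by rewrite -[X in measurable X]setTI; exact: measurable_snd. }
have PQS A' c : (forall i, measurable (A' i)) -> Bk c ->
    P (Q A' `&` S c) = (n%:R^-1%:E * \prod_(i <- iota 0 N) nu (A' i))%E.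
{ move=> mA' Bkc.
  have mC : measurable [set t : R | A' a (n%:R * t)].
  { rewrite -[X in measurable X]setTI.
    have : measurable_fun setT (fun t : R => n%:R * t) by exact: measurable_funM.
    by apply. }
  rewrite QSE// (exp_iid_pinned vD)//; last first.
  { by move=> l; exact: mB. }
  { by rewrite mem_filter eqxx. }
  { exact/allP. }
  { by rewrite filter_uniq// iota_uniq. }
  pose q l := fine (nu (A' l)).
  have qE l : nu (A' l) = (q l)%:E by rewrite fineK// fin_num_measure.
  pose K := \prod_(l <- iota 0 N | l != a) q l.
  have K0 : 0 <= K by apply: prodr_ge0 => l _; rewrite fine_ge0.
  (* Under [nu] only [0 <= t] matters; there each of the [n.-1] other entries of the block yields a
     factor [expR (- t)]. *)
  transitivity (\int[nu]_t ((K * (\1_(A' a) (n%:R * t) * expR (- t) ^+ n.-1))%:E))%E.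
  - apply: eq_integral_nu.
    + apply: emeasurable_funM; first by apply/measurable_EFinP; exact: measurable_indic.
      apply: emeasurable_prod => l; exact: (measurable_fun_xsection nu (mB A' c l mA')).
    + apply/measurable_EFinP; apply: measurable_funM => //; apply: measurable_funM.
      * exact: (@measurable_indic _ _ _ setT _ mC).
      * by apply: measurable_funX; apply: measurableT_comp.
    + move=> t; rewrite mule_ge0 ?lee_fin//; elim/big_ind : _ => //.
      by move=> x y; exact: mule_ge0.
    + by move=> t; rewrite lee_fin !mulr_ge0 ?exprn_ge0 ?expR_ge0.
    + move=> t t0.
      rewrite (eq_big_seq (fun l => ((if Bk l then expR (- t) else 1) * q (sg c l))%:E)); last first.
      { move=> l; rewrite mem_filter => /andP[lc _]; rewrite /B; case: ifPn => Bkl.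
        - rewrite EFinM -qE -nu_shift//; congr (nu _).
          by apply/seteqP; split=> z /=; rewrite /xsection/= inE.
        - rewrite mul1r /sg ifF -?qE; last first.
          { by apply/eqP => la; rewrite la Bka in Bkl. }
          by congr (nu _); apply/seteqP; split=> z /=; rewrite /xsection/= inE. }
      rewrite -(big_morph EFin (@EFinM _) erefl) big_split/= prod_sg// -/K.
      rewrite -big_mkcond big_const_seq/= iter_mulr_1 cntBk// -EFinM.
      have -> : \1_[set t1 | A' a (n%:R * t1)] t = \1_(A' a) (n%:R * t) :> R by rewrite !indicE.
      by congr EFin; ring.
  - under eq_integral do rewrite EFinM.
    rewrite ge0_integralZl//.
    + rewrite integral_nu_scale// muleCA; congr (_ * _)%E.
      rewrite (bigD1_seq a) ?iota_uniq ?mem_iota//= muleC; congr (_ * _)%E.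
      rewrite /K (big_morph EFin (@EFinM _) erefl).
      by apply: eq_bigr => l _.
    + apply/measurable_EFinP; apply: measurable_funM.
      * exact: (@measurable_indic _ _ _ setT _ mC).
      * by apply: measurable_funX; apply: measurableT_comp. }
have mS c : measurable (S c).
{ rewrite (_ : S c = \bigcap_(l in [set l | Bk l && (l != c)]) [set w | v c w < v l w]).
  - by apply: bigcap_measurableType => l _; exact: measurable_set_lt.
  - apply/seteqP; split=> w Sw l /=; first by move=> /andP[]; exact: Sw.
    by move=> Bkl lc; apply: Sw; rewrite /= Bkl. }
have tS : trivIset [set` iota a n] S.
{ move=> c c' /=; rewrite !mem_iota => Bc Bc' [w [Sw Sw']].
  apply/eqP; apply: contraT => cc'.
  have := Sw c' Bc'; rewrite eq_sym cc' => /(_ isT) h1.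
  have := Sw' c Bc cc' => h2.
  by have := lt_trans h1 h2; rewrite ltxx. }
have mQ A' : (forall i, measurable (A' i)) -> measurable (Q A').
{ by move=> mA'; exact: measurable_bigcap_preimage. }
have PQU A' : (forall i, measurable (A' i)) ->
  P (Q A' `&` \bigcup_(c in [set` iota a n]) S c) = (\prod_(i <- iota 0 N) nu (A' i))%E.
{ move=> mA'; rewrite setI_bigcupr measure_fin_bigcup; [|exact: finite_seq|exact: trivIset_setIl|]; last first.
  { by move=> c _; apply: measurableI => //; exact: mQ. }
  rewrite -fsbig_seq ?iota_uniq//.
  rewrite (eq_big_seq (fun=> (n%:R^-1%:E * \prod_(i <- iota 0 N) nu (A' i))%E)); last first.
  { by move=> c; rewrite mem_iota => Bkc; exact: PQS. }
  rewrite -ge0_sume_distrl; last by move=> *; rewrite lee_fin invr_ge0.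
  rewrite sumEFin big_const_seq count_predT size_iota iter_addr addr0.
  by rewrite -[_ *+ n]mulr_natr mulVf ?mul1e// pnatr_eq0 -lt0n. }
have mU : measurable (\bigcup_(c in [set` iota a n]) S c).
{ by apply: bigcup_measurable. }
(* With full sets the contributions sum to 1, so a tie for the minimum is negligible and needs no
   separate argument. *)
have PU : P (\bigcup_(c in [set` iota a n]) S c) = 1%E.
{ have := PQU (fun=> setT) (fun=> measurableT).
  rewrite (_ : Q (fun=> setT) = setT) ?setTI.
  - by move=> ->; rewrite big1// => i _; exact: (@probability_setT _ _ _ nu).
  - by apply/seteqP; split=> w. }
rewrite -(PQU A mA) -/(Q A); apply/eqP; rewrite eq_le; apply/andP; split.
- rewrite -[leRHS]adde0.
  rewrite [X in (_ <= _ + X)%E](_ : 0%E = P (~` \bigcup_(c in [set` iota a n]) S c)); last first.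
  { by rewrite probability_setC// PU subee. }
  apply: le_trans (measureU2 _ _ _) => //.
  + apply: le_measure; rewrite ?inE.
    * exact: mQ.
    * by apply: measurableU; [apply: measurableI => //; exact: mQ|exact: measurableC].
    * move=> w Qw; have [Uw|Uw] := pselect ((\bigcup_(c in [set` iota a n]) S c) w).
      -- by left.
      -- by right.
  + by apply: measurableI => //; exact: mQ.
  + exact: measurableC.
- by apply: le_measure; rewrite ?inE; [apply: measurableI => //; exact: mQ|exact: mQ|].
Qed.

End Theta_iid.

(** * The hiring process for exponential values *)

Section chain.
Context {R : realType} (r : nat -> nat) (r_rank : rank_sequence r).
Implicit Types (x e : nat -> R).

Definition stays (k : nat) : bool := r k == r k.-1.

(** The number of k in 1..j with delta_k = 1. The block at stage [j] starts here and has [r j]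
    entries, so it ends at index [j], the slot of the next overshoot. *)
Definition off (j : nat) : nat := (j.+1 - r j)%N.

Lemma rank_gt0 j : (0 < r j)%N.
Proof. by case: r_rank => r0 h; elim: j => [|j IH]; rewrite ?r0//; have := h j; lia. Qed.

Lemma rank_le j : (r j <= j.+1)%N.
Proof. by case: r_rank => r0 h; elim: j => [|j IH]; rewrite ?r0//; have := h j; lia. Qed.

Lemma stays_rank j : stays j.+1 -> r j.+1 = r j.
Proof. by move/eqP. Qed.

Lemma nstays_rank j : ~~ stays j.+1 -> r j.+1 = (r j).+1.
Proof. by case: r_rank => _ /(_ j); rewrite /stays/= => h /eqP h'; lia. Qed.

Lemma off_rank j : (off j + r j = j.+1)%N.
Proof. by rewrite /off subnK// rank_le. Qed.

Lemma stays_off j : stays j.+1 -> off j.+1 = (off j).+1.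
Proof. by move=> h; have := rank_le j; rewrite /off stays_rank//; lia. Qed.

Lemma nstays_off j : ~~ stays j.+1 -> off j.+1 = off j.
Proof. by move=> h; rewrite /off nstays_rank. Qed.

Lemma off_homo j k : (j <= k)%N -> (off j <= off k)%N.
Proof.
elim: k => [|k IH]; first by rewrite leqn0 => /eqP ->.
rewrite leq_eqVlt => /orP[/eqP ->//|]; rewrite ltnS => /IH jk.
have [h|h] := boolP (stays k.+1); first by rewrite stays_off// (leq_trans jk).
by rewrite nstays_off.
Qed.

Lemma off_le j : (off j <= j)%N.
Proof. by have := rank_gt0 j; rewrite /off; lia. Qed.

(* Entries i < off j are the normalized increments of the threshold, the
   entries off j <= i < j the overshoots of the accepted values above it. *)
Fixpoint chain (j : nat) x : nat -> R :=
  if j is j'.+1 then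
    if stays j then Theta (off j') (r j') (chain j' x) else chain j' x
  else x.

(** This is E_(k+1) when delta_(k+1) = 1. Otherwise the entry is an overshoot still in play, and the
    factor [delta] removes it from [level]. *)
Definition increment (k : nat) x : R := chain k.+1 x (off k).

Definition level (j : nat) x : R :=
  \sum_(0 <= k < j) delta r k.+1 / (r k.+1)%:R * increment k x.

Lemma levelS j x :
  level j.+1 x = level j x + delta r j.+1 / (r j.+1)%:R * increment j x.
Proof. by rewrite /level big_nat_recr. Qed.

Lemma chain_ge0 j x : (forall i, 0 <= x i) -> forall i, 0 <= chain j x i.
Proof.
move=> x0; elim: j => //= j IH i; case: ifP => // _; exact: Theta_ge0.
Qed.

Lemma chain_out j x i : (j <= i)%N -> chain j x i = x i.
Proof.
elim: j => //= j IH ji; case: ifP => _; last by rewrite IH// ltnW.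
rewrite Theta_out ?rank_gt0//; first by rewrite IH// ltnW.
by rewrite off_rank ltnS negb_and -!ltnNge ji orbT.
Qed.

Lemma eq_chain j x x' i : (i < j)%N -> (forall l, (l < j)%N -> x l = x' l) ->
  chain j x i = chain j x' i.
Proof.
elim: j i => //= j IH i ij xx'.
have E l : (l < j.+1)%N -> chain j x l = chain j x' l.
{ rewrite ltnS leq_eqVlt => /orP[/eqP ->|lj].
  - by rewrite !chain_out// xx'.
  - by apply: IH => // k kj; rewrite xx'// ltnW. }
case: ifP => _; last exact: E.
apply: eq_Theta; rewrite ?off_rank//; exact: rank_gt0.
Qed.

(** Every later rearrangement acts on a block that starts at [off j] or beyond. *)
Lemma chain_frozen j k x i : (i < off j)%N -> (j <= k)%N ->
  chain k x i = chain j x i.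
Proof.
move=> ij; elim: k => [|k IH]; first by rewrite leqn0 => /eqP ->.
rewrite leq_eqVlt => /orP[/eqP ->//|]; rewrite ltnS => jk /=.
case: ifP => _; last exact: IH.
rewrite Theta_out ?rank_gt0 ?IH// negb_and -ltnNge.
by rewrite (leq_trans ij)// off_homo.
Qed.

(** All increments before [K] can be read off one and the same array, whose joint law is known. *)
Lemma increment_chain k K x : stays k.+1 -> (k < K)%N ->
  increment k x = chain K x (off k).
Proof. by move=> sk kK; rewrite /increment -(@chain_frozen k.+1 K)// stays_off. Qed.

Lemma increment_ge0 k x : (forall i, 0 <= x i) -> 0 <= increment k x.
Proof. by move=> x0; exact: chain_ge0. Qed.

Lemma delta_ge0 k : 0 <= delta r k :> R.
Proof. by rewrite /delta; case: ifP. Qed.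

Lemma level_ge0 j x : (forall i, 0 <= x i) -> 0 <= level j x.
Proof.
move=> x0; apply: sumr_ge0 => k _; rewrite mulr_ge0 ?increment_ge0//.
by rewrite mulr_ge0 ?delta_ge0.
Qed.

Lemma eq_increment k x x' : (forall l, (l <= k)%N -> x l = x' l) ->
  increment k x = increment k x'.
Proof. by move=> xx'; apply: eq_chain => //; rewrite ltnS off_le. Qed.

Lemma eq_level j x x' : (forall l, (l < j)%N -> x l = x' l) ->
  level j x = level j x'.
Proof.
move=> xx'; apply: eq_big_nat => k /andP[_ kj]; congr (_ * _).
by apply: eq_increment => l lk; rewrite xx'// (leq_ltn_trans lk).
Qed.

Section measurability.
Context d (T : measurableType d) (x : nat -> T -> R).
Hypothesis mx : forall i, measurable_fun setT (x i).

Lemma measurable_chain j i : measurable_fun setT (fun w => chain j (x^~ w) i).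
Proof.
elim: j i => //= j IH i; case: (stays j.+1) => //.
exact: (@measurable_Theta _ _ _ (fun i w => chain j (x^~ w) i)).
Qed.

Lemma measurable_increment k : measurable_fun setT (fun w => increment k (x^~ w)).
Proof. exact: measurable_chain. Qed.

Lemma measurable_level j : measurable_fun setT (fun w => level j (x^~ w)).
Proof.
by apply: measurable_sum => k; apply: measurable_funM => //; exact: measurable_increment.
Qed.

End measurability.

Section law.
Context d (T : measurableType d) (P : probability T R) (x : nat -> T -> R).
Hypothesis xD : exp_iid P predT x.

Lemma chain_exp_iid j : exp_iid P predT (fun i w => chain j (x^~ w) i).
Proof.
elim: j => //= j IH; case: (stays j.+1) => //.
exact: (@Theta_exp_iid _ _ _ P (fun i w => chain j (x^~ w) i) _ _ (rank_gt0 j) IH).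
Qed.

(** Along the steps with delta = 1 the index [off k] strictly increases, so these increments are
    distinct entries of the single array [chain N]. *)
Lemma increment_exp_iid :
  exp_iid P (fun k => stays k.+1) (fun k w => increment k (x^~ w)).
Proof.
apply: exp_iid_iota; first by move=> i; exact: measurable_increment xD.1 i.
move=> N A mA AT; pose ks := [seq k <- iota 0 N | stays k.+1].
have inj_off : {in ks &, injective off}.
{ move=> k k'; rewrite !mem_filter => /andP[sk _] /andP[sk' _] kk'.
  apply/eqP; rewrite eqn_leq; apply/andP; split; rewrite leqNgt; apply/negP => lt.
  - by have := off_homo lt; rewrite (stays_off sk') kk' ltnn.
  - by have := off_homo lt; rewrite (stays_off sk) kk' ltnn. }
pose A' i := A (nth 0%N ks (index i (map off ks))).
have A'E k : k \in ks -> A' (off k) = A k.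
{ by move=> kks; rewrite /A' nth_index_map. }
have := (chain_exp_iid N).2 (map off ks) A'.
rewrite map_inj_in_uniq// filter_uniq ?iota_uniq// => /(_ isT).
rewrite (introT allP)// => /(_ isT (fun i => mA _)) h.
transitivity (\prod_(i <- map off ks) nu (A' i))%E.
- rewrite -h; congr (P _); apply/seteqP; split=> w /= hw.
  + move=> i /= /mapP[k kks ->]; rewrite A'E//.
    move: (kks); rewrite mem_filter mem_iota/= add0n => /andP[sk kN].
    by rewrite -increment_chain//; apply: hw; rewrite /= mem_iota.
  + move=> k /=; rewrite mem_iota/= add0n => kN.
    have [sk|/AT ->//] := boolP (stays k.+1).
    have kks : k \in ks by rewrite mem_filter sk mem_iota.
    by rewrite (increment_chain _ sk kN) -A'E//; apply: hw; exact: map_f.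
- rewrite big_map (eq_big_seq (fun k => nu (A k))); last by move=> k /A'E ->.
  rewrite big_filter [RHS](bigID (fun k => stays k.+1))/= [X in (_ * X)%E]big1 ?mule1//.
  by move=> k /AT ->; exact: (@probability_setT _ _ _ nu).
Qed.

End law.

(* The number of accepted candidates together with the overshoot of each of them
   over the threshold in force when it was accepted. *)
Fixpoint hire e (n : nat) : nat * (nat -> R) :=
  if n is n'.+1 then
    let: (m, o) := hire e n' in
    if level m o < e n' then
      (m.+1, fun i => if i == m then e n' - level m o else o i)
    else (m, o)
  else (0%N, fun=> 0).

Definition cnt e n := (hire e n).1.
Definition ovs e n := (hire e n).2.
Definition thr e n := level (cnt e n) (ovs e n).

Lemma hireS e n : (cnt e n.+1 = if thr e n < e n then (cnt e n).+1 else cnt e n) *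
  (ovs e n.+1 = if thr e n < e n then
    (fun i => if i == cnt e n then e n - thr e n else ovs e n i) else ovs e n).
Proof.
rewrite /cnt /ovs /thr /=; case E: (hire e n) => [m o]/=.
by rewrite /cnt /ovs E/=; case: ifP.
Qed.

Lemma cntS e n : cnt e n.+1 = if thr e n < e n then (cnt e n).+1 else cnt e n.
Proof. by rewrite hireS. Qed.

Lemma ovsS e n : ovs e n.+1 = if thr e n < e n then
    (fun i => if i == cnt e n then e n - thr e n else ovs e n i) else ovs e n.
Proof. by rewrite hireS. Qed.

Lemma cnt_homo e n n' : (n <= n')%N -> (cnt e n <= cnt e n')%N.
Proof.
elim: n' => [|n' IH]; first by rewrite leqn0 => /eqP ->.
rewrite leq_eqVlt => /orP[/eqP ->//|]; rewrite ltnS => /IH h.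
by rewrite cntS; case: ifP => // _; exact: leqW.
Qed.

Lemma cnt_le e n : (cnt e n <= n)%N.
Proof. by elim: n => // n IH; rewrite cntS; case: ifP => // _; exact: leqW. Qed.

Lemma ovs_ge0 e n i : 0 <= ovs e n i.
Proof.
elim: n => // n IH; rewrite ovsS; case: ifPn => // h; case: ifP => // _.
by rewrite subr_ge0 ltW.
Qed.

Lemma thr_ge0 e n : 0 <= thr e n.
Proof. by apply: level_ge0 => i; exact: ovs_ge0. Qed.

Lemma ovs_stable e n n' i : (i < cnt e n)%N -> (n <= n')%N ->
  ovs e n' i = ovs e n i.
Proof.
move=> ic; elim: n' => [|n' IH]; first by rewrite leqn0 => /eqP ->.
rewrite leq_eqVlt => /orP[/eqP ->//|]; rewrite ltnS => nn'.
rewrite ovsS; case: ifP => _; last exact: IH.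
rewrite ifF ?IH//; apply/negP => /eqP ie.
by have := cnt_homo e nn'; rewrite -ie leqNgt ic.
Qed.

Lemma ovs_eq0 e n i : (cnt e n <= i)%N -> ovs e n i = 0.
Proof.
elim: n => // n IH; rewrite cntS ovsS; case: ifP => _; last exact: IH.
by move=> ci; rewrite gtn_eqF//; apply: IH; exact: ltnW.
Qed.

Section hire_measurability.
Context d (T : measurableType d) (e : nat -> T -> R) (n : nat).
Hypothesis me : forall i, (i < n)%N -> measurable_fun setT (e i).

(** Measurability is asked only of the first [n] values, so that the lemma also applies over the
    sigma-algebra they generate. *)
Lemma measurable_hire :
  (forall m, measurable [set w | cnt (e^~ w) n = m]) /\
  (forall i, measurable_fun setT (fun w => ovs (e^~ w) n i)).
Proof.
elim: n me => [|k IH] mek.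
- split=> [m|i]; last exact: measurable_cst.
  rewrite /cnt/=; case: m => [|m].
  + by rewrite (_ : [set w | _] = setT)//; apply/seteqP; split.
  + by rewrite (_ : [set w | _] = set0)//; apply/seteqP; split.
- have [mc mo] := IH (fun i ik => mek i (ltnW ik)).
  have mS m : measurable [set w | cnt (e^~ w) k = m /\ thr (e^~ w) k < e k w].
  { rewrite (_ : [set w | _] = [set w | cnt (e^~ w) k = m] `&`
      [set w | level m (ovs (e^~ w) k) < e k w]).
    - apply: measurableI => //; apply: measurable_set_lt; last exact: mek.
      exact: (@measurable_level _ _ (fun i w => ovs (e^~ w) k i)).
    - by apply/seteqP; split=> w /= [<-]. }
  split=> [m|i].
  + rewrite (_ : [set w | _] =
      [set w | cnt (e^~ w) k = m.-1 /\ thr (e^~ w) k < e k w] `&` (if (0 < m)%N then setT else set0) `|`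
      ([set w | cnt (e^~ w) k = m] `\` [set w | cnt (e^~ w) k = m /\ thr (e^~ w) k < e k w])).
    * apply: measurableU; last exact: measurableD.
      by apply: measurableI => //; case: ifP.
    * apply/seteqP; split=> w /=; rewrite cntS;
        case: (boolP (thr (e^~ w) k < e k w)) => h.
      -- by move=> <-; left.
      -- by move=> <-; right; split=> // -[].
      -- case=> [[[-> _]]|[cm /(_ (conj cm isT))//]]; by case: m.
      -- by case=> [[[_ //]]|[]].
  + rewrite (_ : (fun w => _) = (fun w => if w \in
        [set w | cnt (e^~ w) k = i /\ thr (e^~ w) k < e k w]
        then e k w - level i (ovs (e^~ w) k) else ovs (e^~ w) k i)).
    * apply: measurable_fun_ifT => //.
      -- apply: (measurable_fun_bool true); rewrite setTI (_ : _ @^-1` _ =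
           [set w | cnt (e^~ w) k = i /\ thr (e^~ w) k < e k w])//.
         by apply/seteqP; split=> w /=; [move=> /set_mem|move=> h; exact: mem_set].
      -- apply: measurable_funB; first exact: mek.
         exact: (@measurable_level _ _ (fun i w => ovs (e^~ w) k i)).
    * apply/funext => w; rewrite ovsS; case: ifPn => h.
      -- case: eqVneq => [->|ic].
         ++ by rewrite mem_set.
         ++ by rewrite memNset// => -[]/= ci _; rewrite ci eqxx in ic.
      -- by rewrite memNset// => -[] _ /=; exact/negP.
Qed.

Lemma measurable_thr : measurable_fun setT (fun w => thr (e^~ w) n).
Proof.
have [mc mo] := measurable_hire.
rewrite (_ : (fun w => _) = (fun w => \sum_(0 <= m < n.+1)
   (\1_[set w | cnt (e^~ w) n = m] w * level m (ovs (e^~ w) n)))).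
- apply: measurable_sum => m; apply: measurable_funM; first exact: measurable_indic.
  exact: (@measurable_level _ _ (fun i w => ovs (e^~ w) n i)).
- apply/funext => w; rewrite (bigD1_seq (cnt (e^~ w) n)) ?iota_uniq//=; last first.
  { by rewrite mem_index_iota/= ltnS cnt_le. }
  rewrite indicE mem_set// mul1r big1 ?addr0// => m mc'.
  by rewrite indicE memNset ?mul0r// => /= /esym; apply/eqP.
Qed.

End hire_measurability.

End chain.

(** * The recursion [hire] reproduces the hiring rule *)

Section kth_largest.
Context {R : realType}.
Implicit Types (s : seq R) (x y : R).

Lemma kth_largestP k s y : uniq s -> y \in s -> count (fun z => y < z) s = k.-1 ->
  kth_largest k s = y.
Proof.
move=> us ys kE; rewrite /kth_largest -kE.
have ss : sorted >=%R (sort >=%R s) by apply: sort_sorted => a b; exact: le_total.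
rewrite -(count_sort >=%R _ s); move: ss.
have : y \in sort >=%R s by rewrite mem_sort.
have : uniq (sort >=%R s) by rewrite sort_uniq.
move=> ut yt; case/splitPr: yt ut => t1 t2; rewrite sorted_pairwise; last first.
{ by move=> a b c; rewrite /= => h1 h2; exact: le_trans h2 h1. }
rewrite cat_uniq pairwise_cat /= => /and3P[_ yt1 /andP[yt2 _]] /and3P[/allrelP h1 _ /andP[/allP h2 _]].
rewrite count_cat /= ltxx add0n.
have -> : count (fun z => y < z) t1 = size t1.
{ apply/eqP; rewrite -all_count; apply/allP => z zt1.
  have /= yz' := h1 z y zt1 (mem_head y t2).
  rewrite lt_neqAle yz' andbT; apply/eqP => yz.
  by move: yt1; rewrite negb_or yz zt1. }
have -> : count (fun z => y < z) t2 = 0%N.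
{ apply/eqP; rewrite -leqn0 leqNgt -has_count; apply/hasP => -[z zt2].
  by have /= zy := h2 z zt2; rewrite ltNge zy. }
by rewrite addn0 nth_cat ltnn subnn.
Qed.

(** Both runs keep the same list [I] of accepted positions, since sorting and comparing see only the
    order of the values. *)
Lemma num_accepted_order (r : nat -> nat) (x e : nat -> R) (n : nat) :
  rank_sequence r ->
  (forall i j, (i < n)%N -> (j < n)%N -> (x i < x j) = (e i < e j)) ->
  num_accepted r x n = num_accepted r e n.
Proof.
move=> rr xe.
suff : forall k, (k <= n)%N -> exists I : seq nat, [/\ all (fun i => i < k)%N I,
  accepted_values r x k = map x I & accepted_values r e k = map e I].
{ move=> /(_ n (leqnn n))[I [_]]; rewrite /num_accepted => -> ->.
  by rewrite !size_map. }
elim=> [|k IH] kn; first by exists [::].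
have [I [Ik Ix Ie]] := IH (ltnW kn).
have In i : i \in I -> (i < n)%N by move=> /(allP Ik) ik; exact: ltn_trans kn.
have acc : accepts r (map x I) (x k) = accepts r (map e I) (e k).
{ rewrite /accepts !size_map; case: ifP => // rI.
  (* The hypothesis compares positions below [n] only; clamping makes the two comparison relations
     equal as functions. *)
  pose f i := minn i n.-1.
  have fn i : (f i < n)%N by rewrite /f; lia.
  have fE (y : nat -> R) : map y I = map (y \o f) I.
  { by apply/eq_in_map => i /In iI /=; congr y; rewrite /f; lia. }
  rewrite /kth_largest (fE x) (fE e) !sort_map.
  have -> : (relpre (x \o f) >=%R : rel nat) = relpre (e \o f) >=%R.
  { by apply/funext => i; apply/funext => j /=; rewrite !leNgt xe ?fn. }
  have sz : ((r (size I)).-1 < size (sort (relpre (e \o f) >=%R) I))%N.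
  { by rewrite size_sort prednK// rank_gt0. }
  by rewrite !(nth_map 0%N)//; apply: xe. }
rewrite /= Ix Ie acc; case: ifP => _.
- exists (rcons I k); rewrite !map_rcons all_rcons ltnSn; split=> //.
  by apply: sub_all Ik => i; exact: ltnW.
- by exists I; split=> //; apply: sub_all Ik => i; exact: ltnW.
Qed.

End kth_largest.

Lemma block_min_in (R : realType) (v : nat -> R) (a n : nat) : (0 < n)%N ->
  exists2 c, c \in iota a n & block_min v a n = v c.
Proof.
move=> n0; have aB : a \in iota a n by rewrite mem_iota; lia.
rewrite /block_min big_seq; elim/big_ind : _ => [|x y [c cB ->] [c' cB' ->]|i iB].
- by exists a.
- by rewrite minEle; case: ifP => _; [exists c|exists c'].
- by exists i.
Qed.

Lemma uniq_map_inj (T U : eqType) (f : T -> U) (s : seq T) :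
  uniq (map f s) -> {in s &, injective f}.
Proof.
elim: s => //= a s IH /andP[fa us] x y; rewrite !inE.
move=> /orP[/eqP ->|xs] /orP[/eqP ->|ys] // fxy.
- by rewrite fxy map_f in fa.
- by rewrite -fxy map_f in fa.
- exact: IH.
Qed.

(** In absolute terms [Theta] drops the smallest value, lets [v a] take its slot, and moves the
    reference level from [L] to [L + block_min v a n]; the values above the new level stay the
    same. *)
Lemma perm_Theta (R : realType) (v : nat -> R) (a n : nat) (L : R) : (0 < n)%N ->
  {in iota a n &, injective v} ->
  perm_eq [seq L + v i | i <- iota a n & block_min v a n < v i]
    [seq L + block_min v a n + Theta a n v i | i <- iota a.+1 n.-1].
Proof.
move=> n0 inj_v; set mu := block_min v a n.
have mu_le i : i \in iota a n -> mu <= v i.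
{ by rewrite mem_iota; exact: block_min_le. }
have [c cB vc] := block_min_in v a n0.
have aB : a \in iota a n by rewrite mem_iota; lia.
have BB i : (i \in iota a.+1 n.-1) = (i \in iota a n) && (i != a).
{ by rewrite !mem_iota; lia. }
have ThE i : i \in iota a.+1 n.-1 ->
    L + mu + Theta a n v i = L + (if v i <= mu then v a else v i).
{ rewrite mem_iota => iB; rewrite /Theta ifF; last by lia.
  rewrite ifT -/mu; first ring.
  by lia. }
apply: uniq_perm.
- rewrite map_inj_in_uniq ?filter_uniq ?iota_uniq// => i j.
  by rewrite !mem_filter => /andP[_ iB] /andP[_ jB] /addrI; exact: inj_v.
- rewrite map_inj_in_uniq ?iota_uniq// => i j iB0 jB0.
  rewrite (ThE i iB0) (ThE j jB0) => /addrI.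
  move: iB0 jB0; rewrite !BB => /andP[iB ia] /andP[jB ja].
  case: (leP (v i) mu) => hi; case: (leP (v j) mu) => hj.
  + move=> _; apply: inj_v => //; apply/eqP; rewrite eq_le.
    by rewrite (le_trans hi)/= ?(le_trans hj)// mu_le.
  + by move/(inj_v _ _ aB jB) => aj; rewrite aj eqxx in ja.
  + by move/(inj_v _ _ iB aB) => aj; rewrite aj eqxx in ia.
  + exact: inj_v.
- move=> z; apply/mapP/mapP.
  + move=> [i]; rewrite mem_filter => /andP[mui iB] ->.
    have [ia|ia] := eqVneq i a.
    * have ca : c != a by apply: contraTneq mui => ca; rewrite ia /mu vc ca ltxx.
      exists c; first by rewrite BB cB.
      by rewrite ThE ?BB ?cB// /mu vc lexx ia.
    * exists i; first by rewrite BB iB.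
      by rewrite ThE ?BB ?iB// leNgt mui.
  + move=> [i iB0 ->]; rewrite ThE//; move: iB0; rewrite BB => /andP[iB ia].
    case: (leP (v i) mu) => hi.
    * exists a => //; rewrite mem_filter aB andbT lt_neqAle mu_le// andbT.
      apply: contra_neq ia => mua; apply: inj_v => //.
      by apply/eqP; rewrite eq_le -mua hi mu_le.
    * by exists i => //; rewrite mem_filter hi.
Qed.

Section num_accepted_cnt.
Context {R : realType} (r : nat -> nat) (r_rank : rank_sequence r).
Variable e : nat -> R.
Hypotheses (e0 : forall i, 0 < e i) (inj_e : injective e).

Let block n := iota (off r (cnt r e n)) (r (cnt r e n)).-1.

(** With m acceptances so far, the pool of [(r m).-1] overshoots describes the accepted values
    strictly above the threshold, so the threshold is itself the accepted value of rank [r m]. As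
    long as [r m = m + 1] it is 0, which every candidate exceeds. *)
Let invariant n := [/\ size (accepted_values r e n) = cnt r e n,
  uniq (accepted_values r e n),
  {subset accepted_values r e n <= map e (iota 0 n)},
  perm_eq [seq z <- accepted_values r e n | thr r e n < z]
    [seq thr r e n + chain r (cnt r e n) (ovs r e n) i | i <- block n] &
  if (r (cnt r e n) <= cnt r e n)%N then thr r e n \in accepted_values r e n
  else thr r e n == 0].

Let accepts_thr n : invariant n ->
  accepts r (accepted_values r e n) (e n) = (thr r e n < e n).
Proof.
move=> [sz us _ pool top]; rewrite /accepts sz; case: ifPn => rm.
- rewrite rm in top; rewrite (kth_largestP us top)//.
  by rewrite -size_filter (perm_size pool) size_map size_iota.
- by rewrite (negbTE rm) in top; rewrite (eqP top) e0.
Qed.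

Let invariantS n : invariant n -> invariant n.+1.
Proof.
move=> inv; have acc := accepts_thr inv; case: inv => sz us sub pool top.
have subS : {subset map e (iota 0 n) <= map e (iota 0 n.+1)}.
{ by move=> z /mapP[i ii ->]; apply: map_f; move: ii; rewrite !mem_iota; lia. }
have accS : accepted_values r e n.+1 = if accepts r (accepted_values r e n) (e n)
  then rcons (accepted_values r e n) (e n) else accepted_values r e n by [].
rewrite /invariant /block /thr accS cntS ovsS acc; case: ifPn => lt; last first.
{ by split=> //; move=> z /sub /subS. }
set m := cnt r e n; set o := ovs r e n; set L := thr r e n.
set o' := (fun i => if i == m then _ else _); set s := accepted_values r e n.
set v := chain r m o'.
have vm : v m = e n - L by rewrite /v chain_out// /o' eqxx.
have vo i : (i < m)%N -> v i = chain r m o i.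
{ by move=> im; apply: eq_chain => // l lm; rewrite /o' ltn_eqF. }
have o'0 i : 0 <= o' i.
{ by rewrite /o'; case: ifP => _; [rewrite subr_ge0 ltW|exact: ovs_ge0]. }
have v0 i : 0 <= v i by exact: chain_ge0.
have ens : e n \notin s.
{ apply/negP => /sub/mapP[i]; rewrite mem_iota/= add0n => ini /inj_e.
  by move=> ne; rewrite ne ltnn in ini. }
have us' : uniq (rcons s (e n)) by rewrite rcons_uniq ens.
have om : (off r m + (r m).-1 = m)%N.
{ by have := off_rank r_rank m; have := rank_gt0 r_rank m; lia. }
(* The pool enlarged by the new overshoot, still measured from the old threshold; it fills the block
   of [r m] entries on which [Theta] may act. *)
have pool' : perm_eq [seq z <- rcons s (e n) | L < z]
    [seq L + v i | i <- iota (off r m) (r m)].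
{ rewrite filter_rcons lt -(prednK (rank_gt0 r_rank m)) -(addn1 (_.-1)) iotaD map_cat/=.
  have -> : [seq L + v i | i <- iota (off r m) (r m).-1] =
      [seq L + chain r m o i | i <- block n].
  { apply/eq_in_map => i; rewrite mem_iota om => /andP[_ im].
    by rewrite vo. }
  rewrite om vm addrC subrK cats1 perm_rcons perm_sym perm_rcons perm_cons.
  by rewrite perm_sym. }
have LE : level r m o' = L.
{ by apply: eq_level => // l lm; rewrite /o' ltn_eqF. }
set mu := block_min v (off r m) (r m).
have mu0 : 0 <= mu by apply: block_min_ge => //; exact: rank_gt0.
have mu_le i : i \in iota (off r m) (r m) -> mu <= v i.
{ by rewrite mem_iota; exact: block_min_le. }
have [c cB vc] : exists2 c, c \in iota (off r m) (r m) & mu = v c.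
{ by apply: block_min_in; exact: rank_gt0. }
have inj_v : {in iota (off r m) (r m) &, injective v}.
{ have : uniq [seq L + v i | i <- iota (off r m) (r m)].
  { by rewrite -(perm_uniq pool') filter_uniq. }
  by move=> /uniq_map_inj h i j iB jB vij; apply: h => //; rewrite vij. }
have L'n : ~~ stays r m.+1 -> level r m.+1 o' = L.
{ by move=> st; rewrite levelS LE /delta -/(stays r _) (negbTE st) !mul0r addr0. }
have L's : stays r m.+1 -> level r m.+1 o' = L + mu.
{ move=> st; rewrite levelS LE /delta -/(stays r _) st /increment/= st /Theta eqxx -/v -/mu.
  rewrite (stays_rank st) mul1r mulrA mulVf ?mul1r//.
  by rewrite pnatr_eq0 -lt0n rank_gt0. }
split=> //.
- by rewrite size_rcons sz.
- move=> z; rewrite mem_rcons inE => /orP[/eqP ->|/sub/subS//].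
  by apply: map_f; rewrite mem_iota leq0n add0n ltnSn.
- have [st|st] := boolP (stays r m.+1); last first.
  { by rewrite L'n// (nstays_off r_rank st) (nstays_rank r_rank st)/= (negbTE st). }
  rewrite L's// (stays_off r_rank st) (stays_rank st)/= st -/v.
  have -> : [seq z <- rcons s (e n) | L + mu < z] =
      [seq z <- [seq z <- rcons s (e n) | L < z] | L + mu < z].
  { rewrite -filter_predI; apply: eq_filter => z /=.
    by case: ltP => // h; rewrite (le_lt_trans _ h)// lerDl. }
  apply: (perm_trans (perm_filter _ pool')).
  rewrite filter_map (eq_filter (a2 := fun i => mu < v i)); last first.
  { by move=> i /=; rewrite ltrD2l. }
  exact: (perm_Theta _ (rank_gt0 r_rank m)).
- have [st|st] := boolP (stays r m.+1); last first.
  { rewrite L'n// (nstays_rank r_rank st) ltnS; case: ifP top => // _ top.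
    by rewrite mem_rcons inE top orbT. }
  rewrite (stays_rank st) rank_le// L's//.
  have : L + mu \in [seq L + v i | i <- iota (off r m) (r m)].
  { by apply/mapP; exists c; rewrite ?vc. }
  by rewrite -(perm_mem pool') mem_filter => /andP[].
Qed.

Lemma num_accepted_cnt n : num_accepted r e n = cnt r e n.
Proof.
suff [] : invariant n by [].
elim: n => [|n IH]; last exact: invariantS.
split=> //=; rewrite /block /cnt /thr /level/=; case: r_rank => -> _ //=.
by rewrite /level big_geq.
Qed.

End num_accepted_cnt.

Lemma ae_eq_measure d (T : measurableType d) (R : realType)
    (m : {measure set T -> \bar R}) (A B : set T) :
  measurable A -> measurable B -> {ae m, forall w, A w <-> B w} -> m A = m B.
Proof.
move=> mA mB [N [mN N0 AB]]; rewrite (integral_indicT m mA) (integral_indicT m mB).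
apply: ge0_ae_eq_integral => //.
- by apply/measurable_EFinP; exact: measurable_indic.
- by apply/measurable_EFinP; exact: measurable_indic.
- exists N; split=> // w /= h; apply: AB => /= ABw; apply: h => _.
  by rewrite !indicE; congr (nat_of_bool _)%:R%:E; apply/idP/idP; rewrite !inE => /ABw.
Qed.

Lemma eq0_le_expr (R : realType) (x q : R) : 0 <= x -> 0 <= q < 1 ->
  (forall n, x <= q ^+ n) -> x = 0.
Proof.
move=> x0 /andP[q0 q1] xq; apply/eqP; rewrite eq_le x0 andbT.
rewrite -(cvg_lim (@Rhausdorff R) (cvg_expr (_ : `|q| < 1))) ?ger0_norm//.
apply: limr_ge; last exact: nearW.
by apply/cvg_ex; exists 0; apply: cvg_expr; rewrite ger0_norm.
Qed.

Section exp_iid_facts.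
Context d (T : measurableType d) (R : realType) (P : probability T R).
Variable e : nat -> T -> R.
Hypothesis eD : exp_iid P predT e.

Lemma nu_le (K : R) : 0 <= K -> nu `]-oo, K]%classic = (1 - expR (- K))%:E.
Proof.
move=> K0; have -> : `]-oo, K]%classic = ~` `]K, +oo[%classic by rewrite setCitvr.
rewrite [LHS](@probability_setC _ _ _ nu)//.
by rewrite -[X in (1 - X)%E]/(nu _) nu_ray (max_idPl K0).
Qed.

(** All values from [n0] on staying at most [K] has probability at most [(1 - expR (- K)) ^+ N] for
    every [N]. This guarantees infinitely many acceptances. *)
Lemma exp_iid_unbounded :
  {ae P, forall w, forall (K n0 : nat), exists2 n, (n0 <= n)%N & K%:R < e n w}.
Proof.
apply: ae_foralln => K; apply: ae_foralln => n0.
pose A := \bigcap_(n in [set n | (n0 <= n)%N]) (e n @^-1` `]-oo, K%:R]%classic).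
have mA : measurable A.
{ apply: bigcap_measurableType => n _; rewrite -[X in measurable X]setTI.
  by apply: (eD.1 n) => //; exact: measurable_itv. }
exists A; split=> //; last first.
{ move=> w /= h n /= n0n; rewrite in_itv/= leNgt; apply/negP => lt.
  by apply: h; exists n. }
pose q := 1 - expR (- K%:R) : R.
have PA N : (P A <= (q ^+ N)%:E)%E.
{ have -> : (q ^+ N)%:E = (\prod_(i <- iota n0 N) nu (`]-oo, K%:R]%classic : set R))%E.
  { rewrite (eq_bigr (fun=> q%:E)); last by move=> i _; rewrite nu_le.
    rewrite -(big_morph EFin (@EFinM _) erefl) big_const_seq count_predT size_iota.
    by rewrite iter_mulr_1. }
  rewrite -(eD.2 (iota n0 N) (fun=> `]-oo, K%:R]%classic)) ?iota_uniq//; last exact/allP.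
  apply: le_measure; rewrite ?inE//.
  - by apply: measurable_bigcap_preimage => [|i]; [exact: eD.1|exact: measurable_itv].
  - by move=> w Aw i /=; rewrite mem_iota => /andP[n0i _]; exact: Aw. }
have : fine (P A) = 0.
{ apply: (@eq0_le_expr _ _ q); first exact: fine_ge0.
  - rewrite /q subr_ge0 -[in leRHS](@expR0 R) ler_expR oppr_le0 ler0n/=.
    by rewrite ltrBlDr ltrDl expR_gt0.
  - by move=> N; rewrite -lee_fin fineK ?PA// fin_num_measure. }
by move=> PA0; rewrite -[LHS]fineK ?PA0// fin_num_measure.
Qed.

Lemma exp_iid_gt0 : {ae P, forall w, forall i, 0 < e i w}.
Proof.
apply: ae_foralln => i; exists (e i @^-1` `]-oo, 0]%classic); split.
- by rewrite -[X in measurable X]setTI; apply: (eD.1 i) => //; exact: measurable_itv.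
- have := eD.2 [:: i] (fun=> `]-oo, 0]%classic) erefl erefl (fun=> measurable_itv _).
  rewrite big_seq1 nu_le// oppr0 expR0 subrr => E; apply: (eq_trans _ E); congr (P _).
  apply/seteqP; split=> w /=.
  + by move=> h j /=; rewrite inE => /eqP ->.
  + by move=> /(_ i); apply; rewrite /= inE.
- by move=> w /=; rewrite in_itv/= => /negP; rewrite -leNgt.
Qed.

Lemma nu_set1 (t : R) : nu [set t] = 0%E.
Proof.
rewrite nuE /exponential_prob; apply: null_set_integral => //.
- by apply: measurable_funTS; apply/measurable_EFinP; exact: measurable_exponential_pdf.
- exact: lebesgue_measure_set1.
Qed.

Lemma exp_iid_injective : {ae P, forall w, injective (e^~ w)}.
Proof.
suff : {ae P, forall w, forall i j, i != j -> e i w <> e j w}.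
{ apply: filterS => w h i j /= eij; apply/eqP; apply: contraT => ij.
  by have := h i j ij. }
apply: ae_foralln => i; apply: ae_foralln => j.
have [->|ij] := eqVneq i j; first exact: aeW.
have mdiag : measurable [set z : R * R | z.1 = z.2].
{ rewrite (_ : [set z | _] = (fun z : R * R => z.1 - z.2) @^-1` [set 0]).
  - rewrite -[X in measurable X]setTI.
    have : measurable_fun setT (fun z : R * R => z.1 - z.2) by exact: measurable_funB.
    by apply.
  - by apply/seteqP; split=> z /=; [move=> ->; rewrite subrr|move/eqP; rewrite subr_eq0 => /eqP]. }
have := exp_iid_pinned (a := i) (J := [:: j]) (C := setT)
  (B := fun=> [set z : R * R | z.1 = z.2]) eD erefl erefl erefl.
rewrite inE ij => /(_ isT measurableT (fun=> mdiag)).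
rewrite setTI (_ : \bigcap_(_ in _) _ = [set w | e i w = e j w]); last first.
{ apply/seteqP; split=> w /=.
  - by move=> /(_ j); rewrite /= inE; apply.
  - by move=> h l /=; rewrite inE => /eqP ->. }
move=> PE; exists [set w | e i w = e j w]; split.
- rewrite (_ : [set w | _] = (fun w => (e i w, e j w)) @^-1` [set z | z.1 = z.2])//.
  rewrite -[X in measurable X]setTI.
  have : measurable_fun setT (fun w => (e i w, e j w)).
  { by apply: measurable_fun_pair; exact: eD.1. }
  by apply.
- apply: (eq_trans PE); apply: integral0_eq => t _; rewrite big_seq1.
  rewrite (_ : xsection _ t = [set t]) ?nu_set1 ?mule0//.
  by apply/seteqP; split=> z; rewrite xsectionE/= => ->.
- by move=> w /= h; apply: contrapT => h'; apply: h => _.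
Qed.

End exp_iid_facts.

(** * The overshoots at the successive acceptances are i.i.d *)

Section hiring_law.
Context {R : realType} (r : nat -> nat) (r_rank : rank_sequence r).

(** The entry is 0 until acceptance number [i + 1] and constant in [n] afterwards, so the limit
    exists on every path, even one with finitely many acceptances. *)
Definition ov (e : nat -> R) (i : nat) : R := limn (fun n => ovs r e n i).

Lemma ovE (e : nat -> R) n i : (i < cnt r e n)%N -> ov e i = ovs r e n i.
Proof.
move=> ic; apply: lim_near_cst => //.
by exists n => // n' /= nn'; exact: ovs_stable.
Qed.

Lemma cvg_ovs (e : nat -> R) i : (fun n => ovs r e n i) @ \oo --> ov e i.
Proof.
have [[n ic]|h] := pselect (exists n, (i < cnt r e n)%N).
- rewrite (ovE ic); apply: cvg_near_cst.
  by exists n => // n' /= nn'; exact: ovs_stable.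
- have h0 n : ovs r e n i = 0.
  { by apply: ovs_eq0; rewrite leqNgt; apply/negP => ic; apply: h; exists n. }
  have -> : ov e i = 0 by apply: lim_near_cst => //; exact: nearW.
  by apply: cvg_near_cst; exact: nearW.
Qed.

Lemma ov_ge0 (e : nat -> R) i : 0 <= ov e i.
Proof.
apply: limr_ge; first by apply/cvg_ex; exists (ov e i); exact: cvg_ovs.
by apply: nearW => n; exact: ovs_ge0.
Qed.

Lemma thrE (e : nat -> R) n : thr r e n = level r (cnt r e n) (ov e).
Proof. by apply: eq_level => // i ic; rewrite (ovE ic). Qed.

(** Between two acceptances the threshold is frozen, and an unbounded sequence must exceed it
    again. *)
Lemma cnt_surj (e : nat -> R) :
  (forall (K n0 : nat), exists2 n, (n0 <= n)%N & K%:R < e n) ->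
  forall m, exists n, cnt r e n = m /\ thr r e n < e n.
Proof.
move=> unb.
have next n0 : exists n, [/\ (n0 <= n)%N, cnt r e n = cnt r e n0 & thr r e n < e n].
{ have [K hK] : exists K : nat, thr r e n0 <= K%:R.
  { by exists (Num.bound (thr r e n0)); apply/ltW/archi_boundP; exact: thr_ge0. }
  have [n1 n01 Kn1] := unb K n0.
  apply: contrapT => hn.
  have const n : (n0 <= n)%N -> hire r e n = hire r e n0.
  { elim: n => [|n IH]; first by rewrite leqn0 => /eqP ->.
    rewrite leq_eqVlt => /orP[/eqP ->//|]; rewrite ltnS => n0n.
    have E := IH n0n; have := hireS r e n; rewrite /thr /cnt /ovs E => -[h1 h2].
    have nlt : ~~ (thr r e n < e n).
    { by apply/negP => lt; apply: hn; exists n; rewrite /cnt E. }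
    rewrite /thr /cnt /ovs E in nlt; rewrite (negbTE nlt) in h1 h2.
    by rewrite [LHS]surjective_pairing [RHS]surjective_pairing h1 h2. }
  apply: hn; exists n1; split=> //; first by rewrite /cnt const.
  by rewrite /thr /cnt /ovs const//; exact: le_lt_trans hK Kn1. }
elim=> [|m [n [cn ltn]]]; first by have [n [_ cn ?]] := next 0%N; exists n.
have [n' [_ cn' ?]] := next n.+1; exists n'; split=> //.
by rewrite cn' cntS ltn cn.
Qed.

Context d (T : measurableType d) (P : probability T R) (e : nat -> T -> R).
Hypothesis eD : exp_iid P predT e.
Local Notation F n := (g_sigma_algebraType (cylinders e (fun i => (i < n)%N))).

Let lt_ne n : forall i, (i < n)%N -> predT i && (i != n).
Proof. by move=> i; rewrite ltn_neqAle => /andP[]. Qed.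

Let measurable_F n i : (i < n)%N -> measurable_fun setT (e i : F n -> R).
Proof. by move=> i_n; exact: (@measurable_cylinders _ _ _ e (fun i => (i < n)%N) i). Qed.

Lemma measurable_F_thr n : measurable_fun setT ((fun w => thr r (e^~ w) n) : F n -> R).
Proof. by apply: (@measurable_thr _ r _ (F n) e n) => i; exact: measurable_F. Qed.

Lemma measurable_F_cnt n m : measurable ([set w | cnt r (e^~ w) n = m] : set (F n)).
Proof. by have [] := @measurable_hire _ r _ (F n) e n (@measurable_F n). Qed.

Lemma measurable_F_ovs n i : measurable_fun setT ((fun w => ovs r (e^~ w) n i) : F n -> R).
Proof. by have [] := @measurable_hire _ r _ (F n) e n (@measurable_F n). Qed.

Lemma measurable_F_id n d' (T' : measurableType d') (f : T -> T') :
  measurable_fun setT (f : F n -> T') -> measurable_fun setT f.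
Proof.
move=> mf; have := @measurable_cylinders_id _ _ _ P predT e (fun i => (i < n)%N) eD.
exact: (measurableT_comp mf).
Qed.

(** The acceptance decision given the past: [e n] is independent of the first [n] values and exceeds
    the current threshold y with probability e^(-y). *)
Lemma one_step n (f1 f0 : F n -> \bar R) :
  measurable_fun setT f1 -> measurable_fun setT f0 ->
  (forall w, 0 <= f1 w)%E -> (forall w, 0 <= f0 w)%E ->
  (\int[P]_w (if (thr r (e^~ w) n < e n w)%R then f1 w else f0 w) =
   \int[P]_w ((expR (- thr r (e^~ w) n))%:E * f1 w +
              (1 - expR (- thr r (e^~ w) n))%:E * f0 w))%E.
Proof.
move=> mf1 mf0 f1_ge0 f0_ge0.
have mthr := @measurable_F_thr n.
pose f (z : F n * R) := if thr r (e^~ z.1) n < z.2 then f1 z.1 else f0 z.1.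
have mf : measurable_fun setT f.
{ apply: measurable_fun_ifT.
  + apply: measurable_fun_ltr => //.
    exact: (measurableT_comp mthr measurable_fst).
  + exact: (measurableT_comp mf1 measurable_fst).
  + exact: (measurableT_comp mf0 measurable_fst). }
have f_ge0 z : (0 <= f z)%E by rewrite /f; case: ifP.
have [-> _] := exp_iid_tonelli eD erefl (@lt_ne n) mf f_ge0.
rewrite /f.
- apply: eq_integral => w _ /=.
  set y := thr r (e^~ w) n.
  have y0 : 0 <= y by exact: thr_ge0.
  rewrite (eq_integral (fun t => f1 w * (\1_`]y, +oo[%classic t)%:E +
     f0 w * (\1_`]-oo, y]%classic t)%:E)%E); last first.
  { move=> t _; rewrite !indicE; case: (ltP y t) => yt.
    - rewrite mem_set ?memNset ?mule1 ?mule0 ?adde0//= in_itv/= ?andbT//.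
      by rewrite leNgt yt.
    - rewrite memNset ?mem_set ?mule1 ?mule0 ?add0e//= in_itv/= ?andbT//.
      by rewrite ltNge yt. }
  have mi (A : set R) : measurable A -> measurable_fun setT (fun t : R => (\1_A t)%:E : \bar R).
  { by move=> mA; apply/measurable_EFinP; exact: measurable_indic. }
  rewrite ge0_integralD//.
  + rewrite !ge0_integralZl//; try exact: mi.
    have i1 : (\int[nu]_t (\1_`]y, +oo[%classic t)%:E = (expR (- y))%:E)%E.
    { rewrite -(integral_indicT nu)//; apply: (eq_trans (nu_ray _)).
      by rewrite (max_idPl y0). }
    have i0 : (\int[nu]_t (\1_`]-oo, y]%classic t)%:E = (1 - expR (- y))%:E)%E.
    { by rewrite -(integral_indicT nu)//; exact: (eq_trans (nu_le y0)). }
    by rewrite i1 i0 muleC [X in (_ + X)%E]muleC.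
  + by move=> t _; rewrite mule_ge0// lee_fin.
  + by apply: emeasurable_funM => //; exact: mi.
  + by move=> t _; rewrite mule_ge0// lee_fin.
  + by apply: emeasurable_funM => //; exact: mi.
Qed.

Lemma overshoot_step n (D : set (F n)) (B : set R) : measurable D -> measurable B ->
  P (D `&` [set w | thr r (e^~ w) n < e n w /\ B (e n w - thr r (e^~ w) n)]) =
  ((\int[P]_w (\1_D w * expR (- thr r (e^~ w) n))%:E) * nu B)%E.
Proof.
move=> mD mB.
have mthr := @measurable_F_thr n.
pose S := [set z : F n * R | D z.1 /\ (thr r (e^~ z.1) n < z.2 /\ B (z.2 - thr r (e^~ z.1) n))].
have mt1 : measurable_fun setT (fun z : F n * R => thr r (e^~ z.1) n).
{ exact: (measurableT_comp mthr measurable_fst). }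
have mS : measurable S.
{ rewrite (_ : S = (fst @^-1` D) `&` ([set z | thr r (e^~ z.1) n < z.2] `&`
     ((fun z => z.2 - thr r (e^~ z.1) n) @^-1` B)))//.
  apply: measurableI; first by rewrite -[X in measurable X]setTI; exact: measurable_fst.
  apply: measurableI; first exact: measurable_set_lt.
  rewrite -[X in measurable X]setTI.
  have : measurable_fun setT (fun z : F n * R => z.2 - thr r (e^~ z.1) n).
  { exact: measurable_funB. }
  by apply. }
have mf : measurable_fun setT (fun z => (\1_S z)%:E : \bar R).
{ by apply/measurable_EFinP; exact: measurable_indic. }
have f_ge0 z : (0 <= (\1_S z)%:E :> \bar R)%E by rewrite lee_fin.
have [E _] := exp_iid_tonelli eD erefl (@lt_ne n) mf f_ge0.
have mP : measurable (D `&` [set w | thr r (e^~ w) n < e n w /\ B (e n w - thr r (e^~ w) n)] : set T).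
{ rewrite -[X in measurable X]setTI.
  have : measurable_fun setT (fun w : T => ((w : F n), e n w)).
  { by apply: measurable_fun_pair; [exact: measurable_cylinders_id eD|exact: eD.1]. }
  by move=> /(_ measurableT _ mS). }
rewrite (integral_indicT P mP).
transitivity (\int[P]_w (\1_S (w, e n w))%:E)%E.
{ by apply: eq_integral => w _; rewrite !indicE. }
rewrite E -(ge0_integralZr P measurableT); first last.
{ exact: measure_ge0. }
{ by move=> w _; rewrite lee_fin mulr_ge0 ?expR_ge0. }
{ have : measurable_fun setT ((fun w => (\1_D w * expR (- thr r (e^~ w) n))%:E) : F n -> \bar R).
  { apply/measurable_EFinP; apply: measurable_funM; first exact: measurable_indic.
    by apply: measurableT_comp => //; apply: measurableT_comp. }
  exact: measurable_F_id. }
apply: eq_integral => w _.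
have mSw : measurable [set z : R | thr r (e^~ w) n < z /\ B (z - thr r (e^~ w) n)].
{ rewrite (_ : [set z | _] = `]thr r (e^~ w) n, +oo[%classic `&`
     ((fun z => z - thr r (e^~ w) n) @^-1` B)).
  - apply: measurableI => //; rewrite -[X in measurable X]setTI.
    have : measurable_fun setT (fun z : R => z - thr r (e^~ w) n) by exact: measurable_funB.
    by apply.
  - by apply/seteqP; split=> z /=; rewrite in_itv/= andbT. }
have [Dw|Dw] := boolP (w \in D).
- rewrite [in RHS]indicE Dw mul1r -nu_shift ?thr_ge0// (integral_indicT nu mSw).
  apply: eq_integral => t _; rewrite !indicE; congr (nat_of_bool _)%:R%:E.
  apply/idP/idP; rewrite !inE /S/=; first by case.
  by move=> h; split=> //; rewrite inE in Dw.
- rewrite [in RHS]indicE (negbTE Dw) mul0r mul0e; apply: integral0_eq => t _.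
  rewrite indicE memNset//= => -[Dw' _]; rewrite notin_setE in Dw.
  exact: Dw.
Qed.

Lemma measurable_ov i : measurable_fun setT (fun w => ov (e^~ w) i).
Proof.
apply: (@measurable_fun_cvg _ _ _ _ (fun n w => ovs r (e^~ w) n i)).
- by move=> n; apply: (@measurable_F_id n); exact: measurable_F_ovs.
- by move=> w _; exact: cvg_ovs.
Qed.

(** Induction on [m], decomposing by the time [n] at which acceptance number [m + 1] occurs.
    [overshoot_step] factors [nu B] out of every term, and the remaining sum is identified by taking
    [B] to be the whole line. *)
Lemma ov_exp_iid : exp_iid P predT (fun i w => ov (e^~ w) i).
Proof.
apply: exp_iid_iota; first exact: measurable_ov.
move=> m A mA _.
elim: m => [|m IH].
{ rewrite big_nil (_ : \bigcap_(_ in _) _ = setT) ?probability_setT//.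
  by apply/seteqP; split. }
pose D n : set (F n) := [set w | cnt r (e^~ w) n = m] `&`
  \bigcap_(j in [set` iota 0 m]) ((fun w => ovs r (e^~ w) n j) @^-1` A j).
have mD n : measurable (D n).
{ apply: measurableI; first exact: measurable_F_cnt.
  apply: bigcap_measurableType => j _; rewrite -[X in measurable X]setTI.
  exact: measurable_F_ovs. }
pose S (B : set R) n : set T := (D n : set T) `&`
  [set w | thr r (e^~ w) n < e n w /\ B (e n w - thr r (e^~ w) n)].
pose Q := \bigcap_(j in [set` iota 0 m]) ((fun w => ov (e^~ w) j) @^-1` A j).
have main B : measurable B -> P (Q `&` (fun w => ov (e^~ w) m) @^-1` B) =
    ((\sum_(n <oo) \int[P]_w (\1_(D n) w * expR (- thr r (e^~ w) n))%:E) * nu B)%E.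
{ move=> mB.
  have mS n : measurable (S B n : set T).
  { have mthrT : measurable_fun setT (fun w => thr r (e^~ w) n).
    { by apply: (@measurable_F_id n); exact: measurable_F_thr. }
    apply: measurableI.
    - have := @measurable_cylinders_id _ _ _ P predT e (fun i => (i < n)%N) eD measurableT _ (mD n).
      by rewrite setTI.
    - rewrite (_ : [set w | _] = [set w | thr r (e^~ w) n < e n w] `&`
        ((fun w => e n w - thr r (e^~ w) n) @^-1` B))//.
      apply: measurableI; first by apply: measurable_set_lt => //; exact: eD.1.
      rewrite -[X in measurable X]setTI.
      have : measurable_fun setT (fun w => e n w - thr r (e^~ w) n).
      { by apply: measurable_funB => //; exact: eD.1. }
      by apply. }
  transitivity (P (\bigcup_n S B n)).
  - apply: ae_eq_measure.
    + apply: measurableI; first exact: measurable_bigcap_preimage measurable_ov mA.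
      by rewrite -[X in measurable X]setTI; exact: measurable_ov.
    + by apply: bigcup_measurable => k _; exact: mS.
    (* Almost surely the acceptance does take place, so the events indexed by its time exhaust the
       left-hand side. *)
    + have := exp_iid_unbounded eD; apply: filterS => w unb.
      have ovm n : cnt r (e^~ w) n = m -> thr r (e^~ w) n < e n w ->
        ov (e^~ w) m = e n w - thr r (e^~ w) n.
      { move=> cn lt; have : (m < cnt r (e^~ w) n.+1)%N by rewrite cntS lt cn.
        by move/ovE => ->; rewrite ovsS lt cn eqxx. }
      split.
      * move=> [Qw Bw]; have [n [cn lt]] := cnt_surj unb m.
        exists n => //; split; last by rewrite /= -ovm.
        split=> // j jm; have := Qw j jm; rewrite /= (@ovE _ n)//.
        by move: jm; rewrite /= mem_iota cn.
      * move=> [n _ [[/= cn Dw] [lt Bw]]]; split; last by rewrite /= (ovm n).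
        move=> j jm /=; rewrite (@ovE _ n); first exact: Dw.
        by move: jm; rewrite /= mem_iota cn.
  - rewrite measure_bigcup//; last first.
    { move=> n1 n2 _ _ [w [[[/= c1 _] [lt1 _]] [[/= c2 _] [lt2 _]]]].
      have key a b : cnt r (e^~ w) a = m -> thr r (e^~ w) a < e a w ->
        cnt r (e^~ w) b = m -> (a < b)%N -> False.
      { move=> ca lta cb ab; have := cnt_homo r (e^~ w) ab.
        by rewrite cntS lta ca cb ltnn. }
      case: (ltngtP n1 n2) => // h; exfalso; first exact: (key n1 n2).
      exact: (key n2 n1). }
    have nuB : nu B \is a fin_num by exact: (@fin_num_measure _ _ _ nu).
    rewrite -(fineK nuB) muleC -nneseriesZl; last first.
    { by move=> n _; apply: integral_ge0 => w _; rewrite lee_fin mulr_ge0 ?expR_ge0. }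
    rewrite fineK// .
    transitivity (\sum_(n <oo) P (S B n))%E; first by apply: eq_eseriesl => n; rewrite in_setT.
    apply: eq_eseriesr => n _; rewrite muleC; exact: overshoot_step. }
have QE : P Q = (\sum_(n <oo) \int[P]_w (\1_(D n) w * expR (- thr r (e^~ w) n))%:E)%E.
{ have := main _ measurableT; rewrite preimage_setT setIT => ->.
  by rewrite (@probability_setT _ _ _ nu) mule1. }
transitivity (P Q * nu (A m))%E; last first.
{ by rewrite -addn1 iotaD big_cat big_seq1 add0n; congr (_ * _)%E; exact: IH. }
rewrite -addn1 iotaD add0n QE -(main _ (mA m)); congr (P _).
apply/seteqP; split=> w.
- move=> h; split; last by apply: h; rewrite /= mem_cat inE eqxx orbT.
  by move=> j jm; apply: h; rewrite /= mem_cat (_ : j \in iota 0 m).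
- move=> [Qw mw] j /=; rewrite mem_cat inE => /orP[jm|/eqP ->//]; exact: Qw.
Qed.

End hiring_law.

(** * Weighted sums of exponential variables *)

Section mean.
Context d (T : measurableType d) (R : realType) (P : probability T R).
Implicit Types f g : T -> R.

Definition mean f : \bar R := (\int[P]_w (f w)%:E)%E.

Lemma mean_ge0 f : (forall w, 0 <= f w) -> (0 <= mean f)%E.
Proof. by move=> f0; apply: integral_ge0 => w _; rewrite lee_fin. Qed.

Lemma mean_cst (k : R) : mean (fun=> k) = k%:E.
Proof. 
rewrite /mean integral_cst// -[RHS]mule1; congr (_ * _)%E.
exact: (@probability_setT _ _ _ P). Qed.

Lemma meanD f g : measurable_fun setT f -> measurable_fun setT g ->
  (forall w, 0 <= f w) -> (forall w, 0 <= g w) ->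
  mean (fun w => f w + g w) = (mean f + mean g)%E.
Proof.
move=> mf mg f0 g0; rewrite /mean -ge0_integralD//;
  by [move=> w _; rewrite lee_fin|exact/measurable_EFinP].
Qed.

Lemma meanZ (k : R) f : measurable_fun setT f -> (forall w, 0 <= f w) -> 0 <= k ->
  mean (fun w => k * f w) = (k%:E * mean f)%E.
Proof.
move=> mf f0 k0; rewrite /mean -ge0_integralZl_EFin//;
  by [move=> w _; rewrite lee_fin|exact/measurable_EFinP].
Qed.

Lemma mean_le f g : measurable_fun setT f -> measurable_fun setT g ->
  (forall w, 0 <= f w <= g w) -> (mean f <= mean g)%E.
Proof.
move=> mf mg fg; apply: ge0_le_integral => //.
- by move=> w _; rewrite lee_fin; have /andP[] := fg w.
- exact/measurable_EFinP.
- exact/measurable_EFinP.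
- by move=> w _; rewrite lee_fin; have /andP[] := fg w.
Qed.

Lemma eq_mean f g : (forall w, f w = g w) -> mean f = mean g.
Proof. by move=> fg; apply: eq_integral => w _; rewrite fg. Qed.

(** The total sum [B] is integrable, hence finite almost everywhere. It is returned as well because
    it dominates all partial sums. *)
Lemma ae_summable (f : nat -> T -> R) (a : nat -> R) :
  (forall k, measurable_fun setT (f k)) -> (forall k w, 0 <= f k w) ->
  (forall k, (mean (f k) <= (a k)%:E)%E) -> cvgn (series a) ->
  exists B : T -> \bar R, [/\ measurable_fun setT B,
    (forall w n, ((series (f^~ w) n)%:E <= B w)%E),
    (\int[P]_w B w < +oo)%E &
    {ae P, forall w, cvgn (series (f^~ w))}].
Proof.
move=> mf f0 fa ca.
pose B w := (\sum_(k <oo) (f k w)%:E)%E.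
have B_ge w n : ((series (f^~ w) n)%:E <= B w)%E.
{ rewrite /series/= -sumEFin; apply: nneseries_lim_ge => k _ _.
  by rewrite lee_fin. }
have B0 w : (0 <= B w)%E by apply: nneseries_ge0 => k _ _; rewrite lee_fin.
have mB : measurable_fun setT B.
{ apply: ge0_emeasurable_sum => [k w _ _|k _]; first by rewrite lee_fin.
  exact/measurable_EFinP. }
have intB : (\int[P]_w B w < +oo)%E.
{ rewrite integral_nneseries//; last first.
  { by move=> k w _; rewrite lee_fin. }
  { by move=> k; exact/measurable_EFinP. }
  apply: (@le_lt_trans _ _ (\sum_(k <oo) (a k)%:E)%E).
  - apply: lee_nneseries => [k _ _|k _]; last exact: fa.
    by apply: integral_ge0 => w _; rewrite lee_fin.
  - have -> : (\sum_(k <oo) (a k)%:E)%E = (limn (series a))%:E.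
    { rewrite -EFin_lim//; congr (limn _); apply/funext => n /=.
      by rewrite /series/= -sumEFin. }
    exact: ltry. }
exists B; split=> //.
have iB : P.-integrable setT B.
{ apply/integrableP; split=> //.
  by under eq_integral do rewrite gee0_abs//. }
have := integrable_ae measurableT iB; apply: filterS => w /(_ I) Bw.
apply: nondecreasing_is_cvgn.
- apply/nondecreasing_seqP => n; rewrite /series/= big_nat_recr//=.
  by rewrite lerDl.
- exists (fine (B w)) => _ [n _ <-].
  by rewrite -lee_fin fineK.
Qed.

End mean.

(** * From polynomial subsequences to full sequences *)

Section blocks.
Context {R : realType}.

Lemma sum_inv_sqr_le n : \sum_(0 <= k < n) (k.+1%:R ^+ 2)^-1 <= 2 :> R.
Proof.
case: n => [|n]; first by rewrite big_geq.
suff : \sum_(0 <= k < n.+1) (k.+1%:R ^+ 2)^-1 <= 2 - n.+1%:R^-1 :> R.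
{ by move/le_trans; apply; rewrite gerBl. }
elim: n => [|n IH]; first by rewrite big_nat1 expr1n invr1; lra.
rewrite big_nat_recr//=; have : (n.+2%:R ^+ 2)^-1 <= n.+1%:R^-1 - n.+2%:R^-1 :> R.
{ rewrite -[n.+2]addn1 natrD; set x : R := n.+1%:R; have x0 : 0 < x by rewrite ltr0n.
  have -> : x^-1 - (x + 1)^-1 = (x * (x + 1))^-1.
  { by field; rewrite ?gt_eqF// ltr_wpDr. }
  rewrite lef_pV2 ?posrE ?mulr_gt0 ?exprn_gt0 ?addr_gt0//; nra. }
by move=> h; apply: (le_trans (lerD IH h)); rewrite addrA subrK.
Qed.

Lemma is_cvg_series_inv_sqr : cvgn (series (fun k => (k.+1%:R ^+ 2)^-1 : R)).
Proof.
apply: nondecreasing_is_cvgn.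
- apply/nondecreasing_seqP => n; rewrite /series/= big_nat_recr//=.
  by rewrite lerDl invr_ge0 exprn_ge0.
- by exists 2 => _ [n _ <-]; exact: sum_inv_sqr_le.
Qed.

Lemma pow_bracket c m : (0 < c)%N -> (0 < m)%N ->
  exists k, (k.+1 ^ c <= m < k.+2 ^ c)%N.
Proof.
move=> c0 m0; have ex : exists k, (m < k.+2 ^ c)%N.
{ exists m; apply: (@leq_trans (m.+2 ^ 1)%N); first by rewrite expn1.
  by rewrite leq_pexp2l. }
case: (ex_minnP ex) => k mk hmin; exists k; rewrite mk andbT.
case: k mk hmin => [|k] mk hmin; first by rewrite exp1n.
by rewrite leqNgt; apply/negP => /hmin; rewrite ltnn.
Qed.

Lemma cvg_blocks c (x e : nat -> R) (l : R) : (0 < c)%N ->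
  (forall k m, (k.+1 ^ c <= m <= k.+2 ^ c)%N -> `|x m - l| <= e k) ->
  e @ \oo --> (0 : R) -> x @ \oo --> l.
Proof.
move=> c0 xe e0; apply/cvgrPdist_le => /= eps eps0.
move/cvgr0Pnorm_le : e0 => /(_ _ eps0)[K _ HK].
exists (K.+1 ^ c)%N => // m /= Km.
have m0 : (0 < m)%N by rewrite (leq_trans _ Km)// expn_gt0.
have [k /andP[km mk]] := pow_bracket c0 m0.
have Kk : (K <= k)%N.
{ rewrite -ltnS -ltnS -(@ltn_exp2r _ _ c)//; exact: leq_ltn_trans mk. }
rewrite distrC (le_trans (xe k m _)) ?km ?(ltnW mk)//.
by rewrite (le_trans (ler_norm _))// HK.
Qed.

(** For two increasing processes, the difference inside a block is controlled by its values at both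
    ends and the growth [q] of the second process across the block. *)
Lemma sandwich_dist (s s1 s2 m m1 m2 l q : R) :
  s1 <= s -> s <= s2 -> m1 <= m -> m <= m2 -> m2 - m1 <= q ->
  `|s - m - l| <= `|s1 - m1 - l| + `|s2 - m2 - l| + q.
Proof.
move=> s1s ss2 m1m mm2 m12.
have := ler_norm (s2 - m2 - l); have := ler_norm (- (s1 - m1 - l)).
have := normr_ge0 (s2 - m2 - l); have := normr_ge0 (s1 - m1 - l).
rewrite normrN ler_norml => *; apply/andP; split; lra.
Qed.

(** Turns a second moment into a first-order bound: with [y = k + 1] the first term is summable and
    the second is paid for by the variance. *)
Lemma le_inv_sqrD (x y : R) : 0 < y -> x <= (y ^+ 2)^-1 + y ^+ 2 * x ^+ 2.
Proof.
move=> y0; rewrite -subr_ge0.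
have -> : (y ^+ 2)^-1 + y ^+ 2 * x ^+ 2 - x =
  2^-1 * ((y^-1 - y * x) ^+ 2 + (y^-1) ^+ 2 + (y * x) ^+ 2).
{ by field; rewrite gt_eqF. }
by rewrite mulr_ge0// !addr_ge0// sqr_ge0.
Qed.

(** With y = k + 1 the gap is 3y^2 + 3y + 1, and y >= 1. *)
Lemma cube_gap k : (k.+2 ^ 3 - k.+1 ^ 3 <= 7 * k.+1 ^ 2)%N.
Proof. by rewrite !expnS !expn0 !muln1; nia. Qed.

Lemma sum_cube_block (f : nat -> R) (C : R) (p k : nat) : 0 <= C ->
  (forall j, 0 <= f j <= C / j.+1%:R ^+ p.+1) ->
  \sum_(k.+1 ^ 3 <= j < k.+2 ^ 3) f j <= 7 * C * k.+1%:R ^+ 2 / k.+1%:R ^+ (3 * p.+1).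
Proof.
move=> C0 fC; set y : R := k.+1%:R; have y0 : 0 < y by rewrite ltr0n.
apply: (@le_trans _ _ (\sum_(k.+1 ^ 3 <= j < k.+2 ^ 3) (C / y ^+ (3 * p.+1)))).
- rewrite big_nat [leRHS]big_nat; apply: ler_sum => j /andP[kj _].
  have /andP[_ /le_trans] := fC j; apply; rewrite ler_wpM2l//.
  rewrite lef_pV2 ?posrE ?exprn_gt0// exprM lerXn2r ?nnegrE ?exprn_ge0//.
  by rewrite -natrX ler_nat (leq_trans kj).
- rewrite big_const_nat iter_addr_0 -[leLHS]mulr_natr.
  rewrite [leRHS](_ : _ = (C / y ^+ (3 * p.+1)) * (7 * y ^+ 2)); last by ring.
  rewrite ler_wpM2l ?divr_ge0 ?exprn_ge0 ?(ltW y0)//.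
  by rewrite -natrX -natrM ler_nat cube_gap.
Qed.

End blocks.

(** * The centered walk and its exponential martingale *)

Section walk.
Context d (T : measurableType d) (R : realType) (P : probability T R).
Variables (D : pred nat) (E : nat -> T -> R) (c : nat -> R) (C : R).
Hypothesis eD : exp_iid P D E.
Hypothesis E_ge0 : forall k w, 0 <= E k w.
Hypothesis c_ge0 : forall k, 0 <= c k.
Hypothesis c_out : forall k, ~~ D k -> c k = 0.

Definition walk m (w : T) : R := \sum_(0 <= k < m) c k * E k w.
Definition drift m : R := \sum_(0 <= k < m) c k.
Local Notation past m := (cylinders E (fun i => D i && (i < m)%N)).
Local Notation F m := (g_sigma_algebraType (past m)).

(** The past is generated by the indices in [D] alone; the others enter the walk with coefficient
    0. *)
Lemma measurable_past_walk n m : (n <= m)%N -> measurable_fun setT (walk n : F m -> R).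
Proof.
move=> nm.
have -> : (walk n : F m -> R) = (fun w : F m => \sum_(k < n) c k * E k w).
{ by apply/funext => w; rewrite /walk big_mkord. }
apply: measurable_sum => i; have [Di|Di] := boolP (D i).
- apply: measurable_funM => //; apply: measurable_cylinders.
  by rewrite Di (leq_trans _ nm).
- have -> : (fun w : F m => c i * E i w) = cst 0.
  { by apply/funext => w; rewrite c_out// mul0r. }
  exact: measurable_cst.
Qed.

Lemma measurable_past_id m d' (T' : measurableType d') (f : T -> T') :
  measurable_fun setT (f : F m -> T') -> measurable_fun setT f.
Proof.
by move=> mf; exact: (measurableT_comp mf (measurable_cylinders_id eD)).
Qed.

Lemma measurable_walk m : measurable_fun setT (walk m).
Proof. by apply: (@measurable_past_id m); exact: measurable_past_walk. Qed.

(** Treats the indices inside and outside [D] alike: outside, [c m = 0] and the inner integral is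
    over a constant. *)
Lemma walk_step m (g : F m * R -> \bar R) :
  measurable_fun setT g -> (forall z, 0 <= g z)%E ->
  (\int[P]_w g (w, (c m * E m w)%R) = \int[P]_w \int[nu]_t g (w, (c m * t)%R))%E.
Proof.
move=> mg g0; have [Dm|Dm] := boolP (D m).
- have lt i : D i && (i < m)%N -> D i && (i != m).
  { by move=> /andP[-> im]; rewrite ltn_eqF. }
  have mf : measurable_fun setT (fun z : F m * R => g (z.1, c m * z.2)).
  { apply: (measurableT_comp mg); apply: measurable_fun_pair => //.
    by apply: measurable_funM. }
  by have [-> _] := exp_iid_tonelli eD Dm lt mf (fun z => g0 _).
- rewrite c_out//; apply: eq_integral => w _.
  under eq_integral do rewrite mul0r.
  rewrite integral_cst// mul0r -[LHS]mule1; congr (_ * _)%E.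
  exact/esym/(@probability_setT _ _ _ nu).
Qed.

Lemma mean_walk_sqr m (A : F m -> R) : measurable_fun setT A ->
  mean P (fun w => (A w + (c m * E m w - c m)) ^+ 2) =
  mean P (fun w => A w ^+ 2 + c m ^+ 2).
Proof.
move=> mA; rewrite /mean.
rewrite (@walk_step m (fun z => ((A z.1 + (z.2 - c m)) ^+ 2)%:E)).
- apply: eq_integral => w _; rewrite -integral_nu_sqr.
  by apply: eq_integral => t _; rewrite mulrBr mulr1.
- apply/measurable_EFinP; apply: measurable_funX; apply: measurable_funD.
  + exact: (measurableT_comp mA measurable_fst).
  + by apply: measurable_funB.
- by move=> z; rewrite lee_fin sqr_ge0.
Qed.

Lemma mean_walk_expR m (A : F m -> R) (t : R) : measurable_fun setT A ->
  (forall w, 0 <= A w) -> 0 <= t ->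
  mean P (fun w => A w * expR (- (t * (c m * E m w)))) =
  mean P (fun w => A w * (1 + t * c m)^-1).
Proof.
move=> mA A0 t0; rewrite /mean.
have mx : measurable_fun setT (fun z : F m * R => expR (- (t * z.2))).
{ by apply: measurableT_comp => //; apply: measurableT_comp => //; apply: measurable_funM. }
rewrite (@walk_step m (fun z => (A z.1 * expR (- (t * z.2)))%:E)).
- apply: eq_integral => w _; rewrite EFinM -(integral_nu_expR (mulr_ge0 t0 (c_ge0 m))).
  have mE : measurable_fun setT (fun x : R => (expR (- (t * c m * x)))%:E).
  { apply/measurable_EFinP; apply: measurableT_comp => //.
    by apply: measurableT_comp => //; apply: measurable_funM. }
  rewrite -(ge0_integralZl_EFin nu measurableT _ mE (A0 w)).
  + by apply: eq_integral => x _; rewrite mulrA.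
  + by move=> x _; rewrite lee_fin expR_ge0.
- apply/measurable_EFinP; apply: measurable_funM => //.
  exact: (measurableT_comp mA measurable_fst).
- by move=> z; rewrite lee_fin mulr_ge0 ?expR_ge0.
Qed.

Lemma mean_walk_sqr_expR m (b a : F m -> R) (t : R) :
  measurable_fun setT b -> measurable_fun setT a -> 0 <= t ->
  mean P (fun w => (b w * expR (- (t * (c m * E m w))) - a w) ^+ 2) =
  mean P (fun w => b w ^+ 2 / (1 + (t * c m) *+ 2)
    - a w * b w *+ 2 / (1 + t * c m) + a w ^+ 2).
Proof.
move=> mb ma t0; rewrite /mean.
have mx : measurable_fun setT (fun z : F m * R => expR (- (t * z.2))).
{ by apply: measurableT_comp => //; apply: measurableT_comp => //; apply: measurable_funM. }
rewrite (@walk_step m (fun z => ((b z.1 * expR (- (t * z.2)) - a z.1) ^+ 2)%:E)).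
- apply: eq_integral => w _; rewrite -(integral_nu_sqr_expR _ _ (mulr_ge0 t0 (c_ge0 m))).
  by apply: eq_integral => x _; rewrite mulrA.
- apply/measurable_EFinP; apply: measurable_funX; apply: measurable_funB.
  + apply: measurable_funM => //; exact: (measurableT_comp mb measurable_fst).
  + exact: (measurableT_comp ma measurable_fst).
- by move=> z; rewrite lee_fin sqr_ge0.
Qed.

Lemma walkS m w : walk m.+1 w = walk m w + c m * E m w.
Proof. by rewrite /walk big_nat_recr. Qed.

Lemma driftS m : drift m.+1 = drift m + c m.
Proof. by rewrite /drift big_nat_recr. Qed.

Lemma walk_homo w m n : (m <= n)%N -> walk m w <= walk n w.
Proof.
move=> mn; rewrite /walk (big_cat_nat (leq0n m) mn)//= lerDl sumr_ge0// => k _.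
exact: mulr_ge0.
Qed.

Lemma drift_homo m n : (m <= n)%N -> drift m <= drift n.
Proof. by move=> mn; rewrite /drift (big_cat_nat (leq0n m) mn)//= lerDl sumr_ge0. Qed.

Lemma mean_centered_walk m n : (m <= n)%N ->
  mean P (fun w => (walk n w - drift n - (walk m w - drift m)) ^+ 2) =
  (\sum_(m <= k < n) c k ^+ 2)%:E.
Proof.
have case0 k : mean P (fun w => (walk k w - drift k - (walk k w - drift k)) ^+ 2) = 0%E.
{ by under eq_mean do rewrite subrr expr0n/=; rewrite mean_cst. }
elim: n => [|n IH]; first by rewrite leqn0 => /eqP ->; rewrite case0 big_geq.
rewrite leq_eqVlt => /orP[/eqP ->|]; first by rewrite case0 big_geq.
rewrite ltnS => mn; rewrite big_nat_recr//= EFinD -IH//.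
pose A w : R := walk n w - drift n - (walk m w - drift m).
have mA : measurable_fun setT (A : F n -> R).
{ by do 2! apply: measurable_funB => //; exact: measurable_past_walk. }
transitivity (mean P (fun w => (A w + (c n * E n w - c n)) ^+ 2)).
{ apply: eq_mean => w; rewrite walkS driftS /A; congr (_ ^+ 2); ring. }
rewrite mean_walk_sqr// meanD ?mean_cst//; last by move=> w; exact: sqr_ge0.
{ by apply: (@measurable_past_id n); exact: measurable_funX. }
{ by move=> w; exact: sqr_ge0. }
Qed.

Definition compensator (t : R) m : R := \prod_(0 <= k < m) (1 + t * c k).
Definition expwalk (t : R) m (w : T) : R := expR (- (t * walk m w)) * compensator t m.

Section expwalk.
Variable t : R.
Hypothesis t0 : 0 <= t.

Lemma tc_gt0 k : 0 < 1 + t * c k.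
Proof. by rewrite ltr_wpDr// mulr_ge0. Qed.

Lemma compensator_gt0 m : 0 < compensator t m.
Proof. by apply: prodr_gt0 => k _; exact: tc_gt0. Qed.

Lemma compensatorS m : compensator t m.+1 = compensator t m * (1 + t * c m).
Proof. by rewrite /compensator big_nat_recr. Qed.

Lemma expwalkS m w : expwalk t m.+1 w =
  expwalk t m w * (1 + t * c m) * expR (- (t * (c m * E m w))).
Proof. by rewrite /expwalk compensatorS walkS mulrDr opprD expRD; ring. Qed.

Lemma expwalk_ge0 m w : 0 <= expwalk t m w.
Proof. by rewrite mulr_ge0 ?expR_ge0// ltW// compensator_gt0. Qed.

Lemma measurable_past_expwalk n m : (n <= m)%N ->
  measurable_fun setT (expwalk t n : F m -> R).
Proof.
move=> nm; apply: measurable_funM => //; apply: measurableT_comp => //.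
apply: measurableT_comp => //; apply: measurable_funM => //.
exact: measurable_past_walk.
Qed.

Lemma measurable_expwalk n : measurable_fun setT (expwalk t n).
Proof. by apply: (@measurable_past_id n); exact: measurable_past_expwalk. Qed.

Lemma mean_expwalk m : mean P (expwalk t m) = 1%E.
Proof.
elim: m => [|m IH].
- transitivity (mean P (fun=> 1)); last by rewrite mean_cst.
  apply: eq_mean => w.
  by rewrite /expwalk /walk /compensator !big_geq// mulr0 oppr0 expR0 mulr1.
- under eq_mean do rewrite expwalkS.
  rewrite mean_walk_expR//.
  + rewrite -IH; apply: eq_mean => w; rewrite mulfK// gt_eqF//; exact: tc_gt0.
  + by apply: measurable_funM => //; exact: measurable_past_expwalk.
  + by move=> w; rewrite mulr_ge0 ?expwalk_ge0// ltW// tc_gt0.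
Qed.

(** Integrating out [E m] turns the left side into the mean of [(L - a) ^+ 2 + x ^+ 2 / (1 + x *+ 2)
    * L ^+ 2], with [L = expwalk t m] and [x = t * c m]. The choice [a = 0] bounds second moments;
    an earlier value of the martingale bounds increments. *)
Lemma expwalk_sqr_step m (a : F m -> R) : measurable_fun setT a ->
  (mean P (fun w => (expwalk t m.+1 w - a w) ^+ 2)%R <=
  mean P (fun w => (expwalk t m w - a w) ^+ 2 + (t * c m) ^+ 2 * expwalk t m w ^+ 2)%R)%E.
Proof.
move=> ma; under eq_mean do rewrite expwalkS.
have mL := @measurable_past_expwalk m m (leqnn m).
have mb : measurable_fun setT ((fun w => expwalk t m w * (1 + t * c m)) : F m -> R).
{ exact: measurable_funM. }
rewrite mean_walk_sqr_expR//.
set x := t * c m; have x0 : 0 <= x by rewrite mulr_ge0.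
have key w : (expwalk t m w * (1 + x)) ^+ 2 / (1 + x *+ 2)
    - a w * (expwalk t m w * (1 + x)) *+ 2 / (1 + x) + a w ^+ 2 =
    (expwalk t m w - a w) ^+ 2 + x ^+ 2 / (1 + x *+ 2) * expwalk t m w ^+ 2.
{ set L := expwalk t m w; field; rewrite ?gt_eqF//; lra. }
under eq_mean do rewrite key.
apply: mean_le.
- apply: (@measurable_past_id m); apply: measurable_funD.
  + by apply: measurable_funX; exact: measurable_funB.
  + by apply: measurable_funM => //; exact: measurable_funX.
- apply: (@measurable_past_id m); apply: measurable_funD.
  + by apply: measurable_funX; exact: measurable_funB.
  + by apply: measurable_funM => //; exact: measurable_funX.
- move=> w; have q0 : 0 < 1 + x *+ 2 by rewrite ltr_wpDr// mulrn_wge0.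
  apply/andP; split.
  + by apply: addr_ge0; rewrite ?sqr_ge0// mulr_ge0 ?sqr_ge0// divr_ge0 ?sqr_ge0// ltW.
  + rewrite lerD2l ler_wpM2r ?sqr_ge0// ler_pdivrMr// ler_peMr ?sqr_ge0//.
    by rewrite lerDl mulrn_wge0.
Qed.

Lemma mean_expwalk_sqr m : (mean P (fun w => (expwalk t m w) ^+ 2)%R <=
  (expR (t ^+ 2 * \sum_(0 <= k < m) c k ^+ 2))%:E)%E.
Proof.
have sq0 n w : 0 <= expwalk t n w ^+ 2 by exact: sqr_ge0.
have msq n : measurable_fun setT (fun w => expwalk t n w ^+ 2).
{ by apply: measurable_funX; exact: measurable_expwalk. }
elim: m => [|m IH].
- have -> : mean P (fun w => expwalk t 0 w ^+ 2) = mean P (fun=> 1).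
  { apply: eq_mean => w; rewrite /expwalk /walk /compensator !big_geq// mulr0 oppr0 expR0.
    by rewrite mulr1 expr1n. }
  by rewrite mean_cst big_geq// mulr0 expR0.
- have := @expwalk_sqr_step m (fun=> 0) (measurable_cst _).
  under eq_mean do rewrite subr0.
  under [X in (_ <= X)%E]eq_mean do rewrite subr0 -[X in X + _]mul1r -mulrDl.
  rewrite meanZ//; last by rewrite addr_ge0 ?sqr_ge0.
  move/le_trans; apply; rewrite big_nat_recr//= mulrDr expRD [X in (_ <= X%:E)%E]mulrC EFinM.
  rewrite exprMn; apply: lee_pmul => //.
  + by rewrite lee_fin addr_ge0// mulr_ge0 ?sqr_ge0.
  + exact: mean_ge0.
  + by rewrite lee_fin expR_ge1Dx.
Qed.

Lemma mean_expwalk_increment m n : (m <= n)%N ->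
  (mean P (fun w => (expwalk t n w - expwalk t m w) ^+ 2)%R <=
   (t ^+ 2 * expR (t ^+ 2 * \sum_(0 <= k < n) c k ^+ 2) *
     \sum_(m <= k < n) c k ^+ 2)%:E)%E.
Proof.
have case0 k : mean P (fun w => (expwalk t k w - expwalk t k w) ^+ 2) = 0%E.
{ by under eq_mean do rewrite subrr expr0n/=; rewrite mean_cst. }
elim: n => [|n IH]; first by rewrite leqn0 => /eqP ->; rewrite case0 big_geq// mulr0.
rewrite leq_eqVlt => /orP[/eqP ->|].
{ by rewrite case0 [X in _ * X]big_geq// mulr0. }
rewrite ltnS => mn.
have mL := measurable_past_expwalk mn.
apply: (le_trans (expwalk_sqr_step mL)).
rewrite meanD; last first.
{ by move=> w; rewrite mulr_ge0 ?sqr_ge0. }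
{ by move=> w; exact: sqr_ge0. }
{ by apply: measurable_funM => //; apply: measurable_funX; exact: measurable_expwalk. }
{ by apply: measurable_funX; apply: measurable_funB; exact: measurable_expwalk. }
rewrite meanZ ?sqr_ge0//; last first.
{ by move=> w; exact: sqr_ge0. }
{ by apply: measurable_funX; exact: measurable_expwalk. }
set K := expR (t ^+ 2 * \sum_(0 <= k < n.+1) c k ^+ 2).
have Kn : expR (t ^+ 2 * \sum_(0 <= k < n) c k ^+ 2) <= K.
{ by rewrite ler_expR ler_wpM2l ?sqr_ge0// big_nat_recr//= lerDl sqr_ge0. }
have -> : \sum_(m <= k < n.+1) c k ^+ 2 = \sum_(m <= k < n) c k ^+ 2 + c n ^+ 2.
{ by rewrite big_nat_recr. }
rewrite mulrDr EFinD; apply: leeD.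
- apply: (le_trans (IH mn)); rewrite lee_fin ler_wpM2r//.
  + by apply: sumr_ge0 => k _; exact: sqr_ge0.
  + by rewrite ler_wpM2l ?sqr_ge0.
- rewrite mulrAC -exprMn [X in (_ <= X)%E]EFinM; apply: lee_pmul => //.
  + by rewrite lee_fin sqr_ge0.
  + by apply: mean_ge0 => w; exact: sqr_ge0.
  + by apply: (le_trans (mean_expwalk_sqr n)); rewrite lee_fin.
Qed.

End expwalk.

Hypothesis C_ge0 : 0 <= C.
Hypothesis cC : forall k, c k <= C / k.+1%:R.

Let c_sqr k : c k ^+ 2 <= C ^+ 2 / k.+1%:R ^+ 2.
Proof. by rewrite -expr_div_n lerXn2r ?nnegrE// divr_ge0. Qed.

Lemma drift_cube_gap k : drift (k.+2 ^ 3) - drift (k.+1 ^ 3) <= 7 * C / k.+1%:R.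
Proof.
rewrite /drift (big_cat_nat (leq0n (k.+1 ^ 3)))/= ?leq_exp2r//.
rewrite addrAC subrr add0r.
apply: (le_trans (@sum_cube_block _ c C 0 k C_ge0 _)); first by move=> j; rewrite c_ge0 expr1 cC.
set y : R := k.+1%:R; have y0 : 0 < y by rewrite ltr0n.
by rewrite le_eqVlt; apply/orP; left; apply/eqP; field; rewrite gt_eqF.
Qed.

Lemma sum_sqr_cube_block k : \sum_(k.+1 ^ 3 <= j < k.+2 ^ 3) c j ^+ 2 <=
  7 * C ^+ 2 / k.+1%:R ^+ 4.
Proof.
apply: (le_trans (@sum_cube_block _ (fun j => c j ^+ 2) (C ^+ 2) 1 k (sqr_ge0 _) _)).
- by move=> j; rewrite sqr_ge0 c_sqr.
- set y : R := k.+1%:R; have y0 : 0 < y by rewrite ltr0n.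
  by rewrite le_eqVlt; apply/orP; left; apply/eqP; field; rewrite gt_eqF.
Qed.

Lemma sum_sqr_le n : \sum_(0 <= k < n) c k ^+ 2 <= 2 * C ^+ 2.
Proof.
apply: (@le_trans _ _ (\sum_(0 <= k < n) C ^+ 2 * (k.+1%:R ^+ 2)^-1)).
- by apply: ler_sum => k _; exact: c_sqr.
- by rewrite -mulr_sumr mulrC ler_wpM2r ?sqr_ge0// sum_inv_sqr_le.
Qed.

(* The second moments make the increments of U summable along m = k ^ 3, but not
   along all m. *)
Lemma cube_summable (U : nat -> T -> R) (K : R) : 0 <= K ->
  (forall m, measurable_fun setT (U m)) ->
  (forall m n, (m <= n)%N -> (mean P (fun w => (U n w - U m w) ^+ 2)%R <=
     (K * \sum_(m <= k < n) c k ^+ 2)%:E)%E) ->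
  exists B : T -> \bar R, [/\ measurable_fun setT B,
    (forall w k, (`|U (k.+1 ^ 3)%N w - U 1%N w|%:E <= B w)%E),
    (\int[P]_w B w < +oo)%E &
    {ae P, forall w, cvgn (fun k => U (k.+1 ^ 3)%N w)}].
Proof.
move=> K0 mU UK.
pose V k w := U (k.+1 ^ 3)%N w.
(* The weight [k.+1%:R ^+ 2] is affordable because the variance over the block between consecutive
   cubes is O(k^(-4)). *)
pose f k w := (k.+1%:R ^+ 2)^-1 + k.+1%:R ^+ 2 * (V k.+1 w - V k w) ^+ 2.
have f0 k w : 0 <= f k w.
{ by apply: addr_ge0; [rewrite invr_ge0 sqr_ge0|rewrite mulr_ge0 ?sqr_ge0]. }
have Vf k w : `|V k.+1 w - V k w| <= f k w.
{ rewrite /f -[X in _ + _ * X](real_normK (num_real _)).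
  by apply: le_inv_sqrD; rewrite ltr0n. }
have mf k : measurable_fun setT (f k).
{ apply: measurable_funD => //; apply: measurable_funM => //.
  by apply: measurable_funX; apply: measurable_funB; exact: mU. }
have fa k : (mean P (f k) <= ((1 + K * (7 * C ^+ 2)) * (k.+1%:R ^+ 2)^-1)%:E)%E.
{ rewrite meanD//; last first.
  { by move=> w; rewrite mulr_ge0 ?sqr_ge0. }
  { apply: measurable_funM => //.
    by apply: measurable_funX; apply: measurable_funB; exact: mU. }
  rewrite mean_cst meanZ ?sqr_ge0//; last first.
  { by move=> w; exact: sqr_ge0. }
  { by apply: measurable_funX; apply: measurable_funB; exact: mU. }
  rewrite mulrDl mul1r EFinD leeD2l//.
  have le : (k.+1 ^ 3 <= k.+2 ^ 3)%N by rewrite leq_exp2r.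
  apply: (le_trans (lee_wpmul2l _ (UK _ _ le))); first by rewrite lee_fin sqr_ge0.
  rewrite -EFinM lee_fin.
  have := sum_sqr_cube_block k; set s := \sum_(_ <= _ < _) _; set y : R := k.+1%:R => sle.
  have y0 : 0 < y by rewrite ltr0n.
  apply: (@le_trans _ _ (y ^+ 2 * (K * (7 * C ^+ 2 / y ^+ 4)))).
  - by rewrite ler_wpM2l ?sqr_ge0// ler_wpM2l.
  - by rewrite le_eqVlt; apply/orP; left; apply/eqP; field; rewrite gt_eqF. }
have [|B [mB fB iB cB]] := ae_summable mf f0 fa.
{ exact/is_cvg_seriesZ/is_cvg_series_inv_sqr. }
exists B; split=> //.
- move=> w k; apply: le_trans (fB w k); rewrite lee_fin.
  rewrite -[U 1%N w]/(V 0%N w) -[U _ w]/(V k w) -(telescope_sumr (V^~ w) (leq0n k)).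
  rewrite (le_trans (ler_norm_sum _ _ _))// /series/=.
  by apply: ler_sum => j _; exact: Vf.
- apply: filterS cB => w cf.
  have : cvgn (series (fun k => V k.+1 w - V k w)).
  { apply: normed_cvg.
    by apply: (@series_le_cvg _ (fun n => `|V n.+1 w - V n w|) (f^~ w)). }
  move=> cs; rewrite (_ : (fun k => _) = (fun k => V 0%N w + series (fun k => V k.+1 w - V k w) k)).
  + by apply: is_cvgD => //; exact: is_cvg_cst.
  + apply/funext => k; rewrite /series/= (telescope_sumr (V^~ w) (leq0n k)).
    by rewrite addrC subrK.
Qed.

(** [cube_summable] gives the limit along cubes. In between, [walk] and [drift] both increase and
    the drift over a block is O(1/k). *)
Lemma is_cvg_centered_walk : {ae P, forall w, cvgn (fun m => walk m w - drift m)}.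
Proof.
pose U m w := walk m w - drift m.
have mU m : measurable_fun setT (U m).
{ by apply: measurable_funB => //; exact: measurable_walk. }
have UK m n : (m <= n)%N -> (mean P (fun w => (U n w - U m w) ^+ 2)%R <=
    (1 * \sum_(m <= k < n) c k ^+ 2)%:E)%E.
{ by move=> mn; rewrite mul1r mean_centered_walk. }
have [B [_ _ _]] := cube_summable ler01 mU UK.
apply: filterS => w cU; set l := limn _ in cU.
have gap0 : (fun k => 7 * C / k.+1%:R : R) @ \oo --> (0 : R).
{ rewrite -[X in _ --> X](mulr0 (7 * C)).
  by apply: cvgM; [exact: cvg_cst|exact: cvg_harmonic]. }
apply/cvg_ex; exists l.
apply: (@cvg_blocks _ 3 _ (fun k => `|U (k.+1 ^ 3)%N w - l| +
   `|U (k.+2 ^ 3)%N w - l| + 7 * C / k.+1%:R)) => //.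
- move=> k m /andP[km mk].
  by apply: sandwich_dist (drift_cube_gap k); rewrite ?walk_homo ?drift_homo.
- have n0 (u : nat -> R) : u @ \oo --> l -> (fun k => `|u k - l|) @ \oo --> (0 : R).
  { move=> ul; rewrite -(normr0 R) -(subrr l); apply: cvg_norm.
    by apply: cvgB => //; exact: cvg_cst. }
  rewrite -[X in _ --> X]addr0 -[X in X + _]addr0; apply: cvgD => //; apply: cvgD.
  + exact: n0.
  + by apply: (n0 (fun k => U (k.+2 ^ 3)%N w)); rewrite -(cvg_shiftS (fun k => U (k.+1 ^ 3)%N w)) in cU.
Qed.

(** Takes the place of a maximal inequality. Along cubes the martingale is dominated by its value at
    1 plus its summed absolute increments; inside a block the exponential factor decreases and the
    compensator grows by a bounded factor. *)
Lemma expwalk_dominated (t : R) : 0 <= t ->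
  exists B : T -> \bar R, [/\ measurable_fun setT B,
    (forall w m, ((expwalk t m w)%:E <= B w)%E) & (\int[P]_w B w < +oo)%E].
Proof.
move=> t0; pose K := t ^+ 2 * expR (t ^+ 2 * (2 * C ^+ 2)).
have K0 : 0 <= K by rewrite mulr_ge0 ?sqr_ge0 ?expR_ge0.
have UK m n : (m <= n)%N -> (mean P (fun w => (expwalk t n w - expwalk t m w) ^+ 2)%R <=
    (K * \sum_(m <= k < n) c k ^+ 2)%:E)%E.
{ move=> mn; apply: (le_trans (mean_expwalk_increment t0 mn)); rewrite lee_fin.
  apply: ler_wpM2r; first by apply: sumr_ge0 => k _; exact: sqr_ge0.
  by rewrite ler_wpM2l ?sqr_ge0// ler_expR ler_wpM2l ?sqr_ge0// sum_sqr_le. }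
have [B [mB UB iB _]] := cube_summable K0 (measurable_expwalk t) UK.
have B0 w : (0 <= B w)%E by apply: le_trans (UB w 0%N); rewrite lee_fin.
(* [Q] bounds the growth of the compensator over one block, where the drift is at most [7 * C]. *)
pose Q := expR (t * (7 * C)); pose L1 := 1 + compensator t 1.
have Q1 : 1 <= Q by rewrite -[leLHS]expR0 ler_expR !mulr_ge0.
have L10 : 0 <= L1 by rewrite addr_ge0// ltW// compensator_gt0.
have L1w w : expwalk t 1 w <= compensator t 1.
{ rewrite /expwalk ler_piMl ?(ltW (compensator_gt0 _ _))// -[leRHS]expR0 ler_expR.
  rewrite oppr_le0 mulr_ge0//; apply: sumr_ge0 => k _; exact: mulr_ge0. }
have cube w k : ((expwalk t (k.+1 ^ 3)%N w)%:E <= L1%:E + B w)%E.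
{ rewrite -[expwalk _ _ w](subrK (expwalk t 1 w)) addrC EFinD; apply: leeD.
  - rewrite lee_fin (le_trans (L1w w))// /L1; lra.
  - by apply: le_trans (UB w k); rewrite lee_fin ler_norm. }
have comp_le m n : (m <= n)%N ->
  compensator t n <= compensator t m * expR (t * (drift n - drift m)).
{ elim: n => [|n IH]; first by rewrite leqn0 => /eqP ->; rewrite subrr mulr0 expR0 mulr1.
  rewrite leq_eqVlt => /orP[/eqP ->|]; first by rewrite subrr mulr0 expR0 mulr1.
  rewrite ltnS => mn; rewrite compensatorS driftS.
  have -> : drift n + c n - drift m = drift n - drift m + c n by ring.
  rewrite [X in expR X]mulrDr expRD mulrA ler_pM ?IH ?expR_ge1Dx// ltW//.
  - exact: compensator_gt0.
  - exact: tc_gt0. }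
exists (fun w => Q%:E * (L1%:E + B w))%E; split.
- by apply: emeasurable_funM => //; apply: emeasurable_funD.
(* Index 0 precedes the first cube and is treated apart; there the martingale equals 1. *)
- move=> w [|m].
  + rewrite /expwalk /walk /compensator !big_geq// mulr0 oppr0 expR0 mulr1.
    rewrite -[1%:E]mule1; apply: lee_pmul; rewrite ?lee_fin//.
    by apply: (@le_trans _ _ (L1%:E)); rewrite ?lee_fin ?leeDl// lerDl ltW// compensator_gt0.
  + have [k /andP[km mk]] := @pow_bracket 3 m.+1 isT isT.
    apply: (@le_trans _ _ (Q%:E * (expwalk t (k.+1 ^ 3)%N w)%:E)%E); last first.
    { by apply: lee_wpmul2l (cube w k); rewrite lee_fin ltW// expR_gt0. }
    rewrite -EFinM lee_fin /expwalk mulrCA.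
    apply: ler_pM; rewrite ?expR_ge0 ?(ltW (compensator_gt0 _ _))//.
    * by rewrite ler_expR lerN2 ler_wpM2l// walk_homo.
    * apply: (le_trans (comp_le _ _ km)); rewrite mulrC.
      apply: ler_wpM2r; first by rewrite ltW// compensator_gt0.
      rewrite ler_expR ler_wpM2l//.
      have := drift_cube_gap k; have := drift_homo (ltnW mk) => dk gap.
      apply: (@le_trans _ _ (7 * C / k.+1%:R)).
      { by apply: le_trans gap; rewrite lerD2r. }
      by rewrite ler_pdivrMr// ler_peMr ?mulr_ge0// ler1n.
- rewrite ge0_integralZl//; last 3 first.
  { exact: emeasurable_funD. }
  { by move=> w _; rewrite adde_ge0. }
  { by rewrite lee_fin expR_ge0. }
  rewrite ge0_integralD// integral_cst//.
  apply: lte_mul_pinfty; rewrite ?lee_fin ?expR_ge0//.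
  rewrite lte_add_pinfty//; apply: lte_mul_pinfty; rewrite ?lee_fin//.
  exact: (le_lt_trans (probability_le1 P measurableT) (ltry 1)).
Qed.

Lemma mean_expR_walk (t : R) m : 0 <= t ->
  mean P (fun w => expR (- (t * walk m w))) = ((compensator t m)^-1)%:E.
Proof.
move=> t0; have cm := compensator_gt0 t0 m.
transitivity (mean P (fun w => (compensator t m)^-1 * expwalk t m w)).
{ by apply: eq_mean => w; rewrite /expwalk mulrCA mulVf ?gt_eqF// mulr1. }
rewrite meanZ ?mean_expwalk ?mule1// ?invr_ge0 ?(ltW cm)//.
- exact: measurable_expwalk.
- by move=> w; exact: expwalk_ge0.
Qed.

End walk.

(** * Real sequences, powers and Euler's constant *)

Section real_sequences.
Context {R : realType}.
Implicit Types (u v : nat -> R) (x y s : R).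

Lemma cvg_powR u (l s : R) : 0 < l -> u @ \oo --> l ->
  (fun n => u n `^ s) @ \oo --> l `^ s.
Proof.
move=> l0 ul; apply: (@continuous_cvg _ _ _ _ _ _ (fun x => x `^ s)) => //.
have [dl _] := is_derive1_powR s l0.
by move/derivable1_diffP : dl => /differentiable_continuous.
Qed.

Lemma cvg_ln u (l : R) : 0 < l -> u @ \oo --> l -> (fun n => ln (u n)) @ \oo --> ln l.
Proof. by move=> l0 ul; apply: continuous_cvg => //; exact: continuous_ln. Qed.

Lemma cvg_expR u (l : R) : u @ \oo --> l -> (fun n => expR (u n)) @ \oo --> expR l.
Proof. by move=> ul; apply: continuous_cvg => //; exact: continuous_expR. Qed.

Lemma cvg_natS_div (a b : nat) :
  (fun n => (n + a.+1)%:R / (n + b.+1)%:R : R) @ \oo --> (1 : R).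
Proof.
have c : (fun n => 1 + (a%:R - b%:R) * (n.+1%:R^-1 / (1 + b%:R * n.+1%:R^-1)) : R) @ \oo --> (1 : R).
{ rewrite -[X in _ --> X]addr0 -[X in _ --> _ + X](mulr0 (a%:R - b%:R)).
  apply: cvgD; first exact: cvg_cst.
  apply: cvgM; first exact: cvg_cst.
  rewrite -[X in _ --> X](_ : 0 / (1 + b%:R * 0) = 0); last by rewrite mul0r.
  apply: cvgM; first exact: cvg_harmonic.
  apply: cvgV; first by rewrite mulr0 addr0 oner_eq0.
  apply: cvgD; first exact: cvg_cst.
  by apply: cvgM; [exact: cvg_cst|exact: cvg_harmonic]. }
rewrite (_ : (fun n => _) = (fun n => 1 + (a%:R - b%:R) * (n.+1%:R^-1 / (1 + b%:R * n.+1%:R^-1)) : R))//.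
apply/funext => n; rewrite !addnS -!addSn !natrD; set y : R := n.+1%:R.
have y0 : 0 < y by rewrite ltr0n.
have yb : 0 < y + b%:R by rewrite ltr_wpDr.
by field; rewrite !gt_eqF.
Qed.

(** The weighted inequality between arithmetic and geometric means, from [1 + u <= expR u] at
    [(1 - s) * L] and [- (s * L)] with [L = ln x]. *)
Lemma powR_le_tangent x s : 0 < x -> 0 <= s <= 1 -> x `^ s <= 1 + s * (x - 1).
Proof.
move=> x0 /andP[s0 s1]; rewrite /powR gt_eqF//.
set L := ln x; have -> : x = expR L by rewrite lnK.
have e1 := expR_ge1Dx ((1 - s) * L); have e2 := expR_ge1Dx (- (s * L)).
have -> : 1 + s * (expR L - 1) =
  expR (s * L) * (s * expR ((1 - s) * L) + (1 - s) * expR (- (s * L))).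
{ have -> : expR L = expR (s * L) * expR ((1 - s) * L).
  { by rewrite -expRD; congr expR; ring. }
  by rewrite expRN; field; rewrite gt_eqF// expR_gt0. }
rewrite ler_peMr ?expR_ge0//.
have f1 : s * (1 + (1 - s) * L) <= s * expR ((1 - s) * L) by rewrite ler_wpM2l.
have f2 : (1 - s) * (1 - s * L) <= (1 - s) * expR (- (s * L)).
{ by rewrite ler_wpM2l// subr_ge0. }
apply: le_trans (lerD f1 f2).
by rewrite le_eqVlt; apply/orP; left; apply/eqP; ring.
Qed.

(** The concave case applied to x^b with exponent 1/b. *)
Lemma powR_ge_tangent x (b : R) : 0 < x -> 1 <= b -> 1 + b * (x - 1) <= x `^ b.
Proof.
move=> x0 b1; have b0 : 0 < b by exact: lt_le_trans b1.
have := @powR_le_tangent (x `^ b) b^-1; rewrite powR_gt0// invr_ge0 (ltW b0)/=.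
rewrite invf_le1// b1 -powRrM divff ?gt_eqF// powRr1 ?(ltW x0)// => /(_ isT isT) h.
have : b * x <= b * (1 + b^-1 * (x `^ b - 1)) by rewrite ler_wpM2l// ltW.
by rewrite mulrDr mulrA divff ?gt_eqF// mul1r mulr1 => h'; lra.
Qed.

Lemma powR_le_chord x (b : R) : 0 <= x <= 1 -> 1 <= b ->
  (1 + x) `^ b <= 1 + (2 `^ b - 1) * x.
Proof.
move=> /andP[x0 x1] b1.
have := @convex_powR R b b1 (@Itv01 _ x x0 x1) 2 1.
rewrite !inE /= !in_itv /= !andbT ler0n ler01 => /(_ isT isT).
rewrite !convRE/= powR1 /unstable.onem => h.
have -> : 1 + x = x * 2 + (1 - x) * 1 by ring.
by apply: (le_trans h); rewrite le_eqVlt; apply/orP; left; apply/eqP; ring.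
Qed.

(** The Stolz-Cesaro theorem: beyond [N] the increments of [u - l * v] are at most [e / 2] times
    those of [v], and the divergence of [v] absorbs the initial part. *)
Lemma stolz u v (l : R) : (forall m, v m < v m.+1) -> v @ \oo --> +oo ->
  (fun m => (u m.+1 - u m) / (v m.+1 - v m)) @ \oo --> l ->
  (fun m => u m / v m) @ \oo --> l.
Proof.
move=> vS voo ul; apply/cvgrPdist_le => /= e e0.
have e2 : 0 < e / 2 by rewrite divr_gt0.
move/cvgrPdist_le : ul => /(_ _ e2)[N _ HN].
have step m : (N <= m)%N ->
    `|u m.+1 - u m - l * (v m.+1 - v m)| <= e / 2 * (v m.+1 - v m).
{ move=> /HN /=; have dv : 0 < v m.+1 - v m by rewrite subr_gt0.
  rewrite distrC -(@ler_pM2r _ (v m.+1 - v m))// -{2}(gtr0_norm dv) -normrM mulrBl.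
  by rewrite divfK// gt_eqF. }
have sum m : (N <= m)%N -> `|u m - l * v m| <= `|u N - l * v N| + e / 2 * (v m - v N).
{ elim: m => [|m IH]; first by rewrite leqn0 => /eqP ->; rewrite subrr mulr0 addr0.
  rewrite leq_eqVlt => /orP[/eqP ->|]; first by rewrite subrr mulr0 addr0.
  rewrite ltnS => Nm.
  have -> : u m.+1 - l * v m.+1 = u m - l * v m + (u m.+1 - u m - l * (v m.+1 - v m)) by ring.
  apply: (le_trans (ler_normD _ _)); apply: (le_trans (lerD (IH Nm) (step m Nm))).
  by rewrite le_eqVlt; apply/orP; left; apply/eqP; ring. }
have [N2 _ HN2] := cvgry_ge voo (`|u N - l * v N| * (2 / e) + `|v N| + 1).
exists (maxn N N2) => // m /=; rewrite geq_max => /andP[Nm N2m].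
have vm := HN2 m N2m; have vm0 : 0 < v m.
{ apply: lt_le_trans vm; rewrite ltr_wpDl//.
  by rewrite addr_ge0// mulr_ge0// divr_ge0// ltW. }
rewrite distrC -(@ler_pM2r _ (v m))// -{2}(gtr0_norm vm0) -normrM mulrBl.
rewrite divfK ?gt_eqF//; apply: (le_trans (sum m Nm)).
have h1 : `|u N - l * v N| <= e / 2 * (v m - `|v N| - 1).
{ have -> : `|u N - l * v N| = e / 2 * (`|u N - l * v N| * (2 / e)).
  { by field; rewrite gt_eqF. }
  rewrite ler_wpM2l ?(ltW e2)//; lra. }
have h2 : e / 2 * - v N <= e / 2 * `|v N|.
{ by rewrite ler_wpM2l ?(ltW e2)// -normrN ler_norm. }
lra.
Qed.

Lemma cvg_natS_powR (b : R) : 0 < b -> (fun m => m.+1%:R `^ b : R) @ \oo --> +oo.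
Proof.
move=> b0; apply/cvgryPge => A.
pose B := Num.max A 1.
have B0 : 0 <= B by rewrite le_max ler01 orbT.
exists (Num.bound (B `^ b^-1)) => // m /= Bm.
apply: (@le_trans _ _ B); first by rewrite le_max lexx.
rewrite [leLHS](_ : B = (B `^ b^-1) `^ b); last first.
{ by rewrite -powRrM mulVf ?gt_eqF// powRr1. }
apply: ge0_ler_powR; rewrite ?nnegrE ?powR_ge0 ?(ltW b0)//.
apply: (le_trans (ltW (archi_boundP (powR_ge0 _ _)))).
by rewrite ler_nat leqW.
Qed.

(** With h = 1/(m+1) the ratio is ((1+h)^b - 1)/h. Bernoulli's inequality at 1 + h bounds it below
    by b, and at 1/(1+h) it bounds it above by b/(1 + (1-b)h). *)
Lemma cvg_powR_increment (b : R) : 1 <= b ->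
  (fun m => (m.+2%:R `^ b - m.+1%:R `^ b) / m.+1%:R `^ (b - 1) : R) @ \oo --> b.
Proof.
move=> b1; have b0 : 0 < b by exact: lt_le_trans b1.
have hcv : (fun m => m.+1%:R^-1 : R) @ \oo --> (0 : R) by exact: cvg_harmonic.
apply: (@squeeze_cvgr _ \oo _ R (fun=> b) (fun m => b / (1 + (1 - b) * m.+1%:R^-1))).
- have ib : 0 < b^-1 by rewrite invr_gt0.
  have [N _ HN] := cvgr_lt _ hcv _ ib.
  exists N => // m /= /HN /=; set h : R := m.+1%:R^-1 => hb.
  have m0 : 0 < m.+1%:R :> R by rewrite ltr0n.
  have h0 : 0 < h by rewrite invr_gt0.
  have bh : b * h < 1 by rewrite -[ltRHS](divff (lt0r_neq0 b0)) ltr_pM2l.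
  have -> : (m.+2%:R `^ b - m.+1%:R `^ b) / m.+1%:R `^ (b - 1) = ((1 + h) `^ b - 1) / h.
  { have -> : m.+2%:R = m.+1%:R * (1 + h) :> R.
    { by rewrite mulrDr mulr1 /h divff ?gt_eqF// -natr1. }
    rewrite powRM ?(ltW m0) ?addr_ge0 ?(ltW h0)//.
    rewrite -(mulr_powRB1 (ltW m0) b0) /h; field.
    by rewrite !gt_eqF// powR_gt0. }
  have t1 := @powR_ge_tangent (1 + h) b (addr_gt0 ltr01 h0) b1.
  have i0 : 0 < (1 + h)^-1 by rewrite invr_gt0 addr_gt0.
  have t2 := @powR_ge_tangent (1 + h)^-1 b i0 b1.
  rewrite ler_pdivlMr//; apply/andP; split; first by lra.
  rewrite ler_pdivrMr// lerBlDr.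
  have q0 : 0 < 1 + (1 - b) * h by lra.
  have -> : b / (1 + (1 - b) * h) * h + 1 = (1 + h) / (1 + (1 - b) * h).
  { by field; rewrite gt_eqF. }
  rewrite ler_pdivlMr// -ler_pdivlMl ?powR_gt0 ?addr_gt0//.
  rewrite -powR_inv1 ?powR_ge0// -powRrM mulrN1.
  have -> : (1 + h) `^ (- b) = (1 + h)^-1 `^ b.
  { by rewrite -powR_inv1 ?addr_ge0 ?(ltW h0)// -powRrM mulN1r. }
  rewrite mulrC -ler_pdivrMr ?addr_gt0//; apply: le_trans t2.
  rewrite le_eqVlt; apply/orP; left; apply/eqP; field.
  by rewrite gt_eqF// addr_gt0.
- exact: cvg_cst.
- rewrite -[X in _ --> X](_ : b / (1 + (1 - b) * 0) = b); last by rewrite mulr0 addr0 divr1.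
  apply: cvgM; first exact: cvg_cst.
  apply: cvgV; first by rewrite mulr0 addr0 oner_eq0.
  apply: cvgD; first exact: cvg_cst.
  by apply: cvgM => //; exact: cvg_cst.
Qed.

Lemma cvg_sum_powR (a : nat -> R) (b C : R) : 1 <= b ->
  (fun j => a j / j.+1%:R `^ (b - 1)) @ \oo --> C ->
  (fun m => (\sum_(0 <= j < m) a j) / m.+1%:R `^ b) @ \oo --> C / b.
Proof.
move=> b1 aC; have b0 : 0 < b by exact: lt_le_trans b1.
apply: (@stolz (fun m => \sum_(0 <= j < m) a j) (fun m => m.+1%:R `^ b)).
- by move=> m; rewrite gt0_ltr_powR ?nnegrE// ltr_nat.
- exact: cvg_natS_powR.
- apply: cvg_trans (cvgM aC (cvgV (lt0r_neq0 b0) (cvg_powR_increment b1))).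
  apply: near_eq_cvg; apply: nearW => m /=.
  rewrite big_nat_recr//= addrAC subrr add0r /unstable.inv_fun invf_div.
  have p0 : m.+1%:R `^ (b - 1) != 0 :> R by rewrite gt_eqF// powR_gt0.
  by rewrite mulrA divfK.
Qed.

Lemma is_cvg_euler_gamma : cvgn (fun n => series harmonic n - ln n%:R : R).
Proof.
have lnS (n : nat) : ln n.+2%:R - ln n.+1%:R = ln (1 + n.+1%:R^-1) :> R.
{ have n0 : 0 < n.+1%:R :> R by rewrite ltr0n.
  rewrite -lnV ?posrE// -lnM ?posrE ?invr_gt0//; congr (ln _).
  by rewrite -natr1 mulrDl divff ?gt_eqF// mul1r. }
have c : cvgn (fun n => series harmonic n.+1 - ln n.+1%:R : R).
{ apply: nonincreasing_is_cvgn.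
  - apply/nonincreasing_seqP => n; rewrite [in leLHS]/series/= big_nat_recr//=.
    rewrite -[series harmonic n.+1]/(\sum_(0 <= k < n.+1) harmonic k) -addrA lerD2l.
        have n1 : 0 < n.+1%:R :> R by rewrite ltr0n.
    have n2 : 0 < n.+2%:R :> R by rewrite ltr0n.
    have h : -1 < - n.+2%:R^-1 :> R by rewrite ltrN2 invf_lt1// ltr1n.
    have := le_ln1Dx h.
    have -> : 1 - n.+2%:R^-1 = n.+1%:R / n.+2%:R :> R.
    { rewrite -(natr1 n.+1) in n2 *; set y : R := n.+1%:R in n2 *.
      by field; rewrite gt_eqF. }
    rewrite lnM ?posrE ?invr_gt0// lnV ?posrE//.
    move: (ln n.+2%:R) (ln n.+1%:R) (n.+2%:R^-1) => x y z; lra.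
  - exists 0 => _ [n _ <-]; rewrite subr_ge0.
    apply: (@le_trans _ _ (ln n.+2%:R)); first by rewrite ler_ln ?posrE// ler_nat.
    elim: n => [|n IH].
    { rewrite /series/= big_nat1 invr1 -[2%:R]/(1 + 1) le_ln1Dx//; lra. }
    rewrite /series/= big_nat_recr//= -[ln _](subrK (ln n.+2%:R)) addrC lerD//.
    rewrite lnS; apply: le_ln1Dx.
    by rewrite (lt_le_trans (ltrN10 _))// invr_ge0. }
apply/cvg_ex; move/cvg_ex : c => [l c]; exists l.
by rewrite -cvg_shiftS.
Qed.

End real_sequences.

(** * The Gamma function *)

Section gamma.
Context {R : realType}.
Local Notation mu := (@lebesgue_measure R).
Implicit Types (x s b : R).

(** This is Gamma(s + 1); the shift keeps the integrand bounded near 0 for every s >= 0. *)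
Definition euler_integral s : \bar R :=
  (\int[mu]_(x in `[0%R, +oo[) (x `^ s * expR (- x))%:E)%E.

Let integrand_ge0 s x : 0 <= x `^ s * expR (- x).
Proof. by rewrite mulr_ge0 ?powR_ge0 ?expR_ge0. Qed.

Let measurable_integrand s (D : set R) : measurable_fun D (fun x => x `^ s * expR (- x)).
Proof.
apply: measurable_funTS; apply: measurable_funM; first exact: measurable_powR.
by apply: measurableT_comp => //; exact: measurable_funN.
Qed.

Lemma euler_integral_ge0 s : (0 <= euler_integral s)%E.
Proof. by apply: integral_ge0 => x _; rewrite lee_fin integrand_ge0. Qed.

Lemma euler_integral0 : euler_integral 0 = 1%E.
Proof.
rewrite /euler_integral; under eq_integral do rewrite powRr0 mul1r.
have mE : measurable_fun (`]0, +oo[%classic : set R) (fun x : R => (expR (- x))%:E).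
{ apply/measurable_EFinP; by apply: measurable_funTS; apply: measurableT_comp. }
rewrite -(integral_itv_obnd_cbnd mE).
have := @integral_expR_ray R 1 0 ltr01; rewrite mulr0 oppr0 expR0 invr1 mulr1 => <-.
by apply: eq_integral => x _; rewrite mul1r.
Qed.

Lemma cvg_powR_right0 s : 0 <= s -> x `^ s @[x --> (0 : R)^'+] --> (0 : R) `^ s.
Proof.
rewrite le_eqVlt => /orP[/eqP <-|s0].
- by rewrite powRr0; under eq_fun do rewrite powRr0; exact: cvg_cst.
- by rewrite powR0 ?gt_eqF//; exact: powR_cvg0.
Qed.

Lemma cvg_powR_expRN s : (fun x => x `^ s * expR (- x)) @ +oo --> (0 : R).
Proof.
pose n := Num.bound `|s|.
have sn : s <= n%:R.
{ by rewrite (le_trans (ler_norm _))// ltW// archi_boundP. }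
apply: (@squeeze_cvgr _ +oo%R _ R (fun=> 0) (fun x => x ^+ n * expR (- (1 * x)))).
- exists 1; split=> // x x1; rewrite mul1r integrand_ge0/= ler_wpM2r ?expR_ge0//.
  by rewrite -powR_mulrn ?(le_trans ler01) ?(ltW x1)// ler_powR// ltW.
- exact: cvg_cst.
- exact: cvg_exprn_expRN.
Qed.

(** Integration by parts with a nonnegative integrand: the derivative of -x^(s+1) e^(-x) changes
    sign, so a multiple of e^(-x), whose integral is known, is added and cancelled at the end. *)
Lemma euler_integralS s : 0 <= s ->
  euler_integral (s + 1) = ((s + 1)%:E * euler_integral s)%E.
Proof.
move=> s0; have s1 : 0 < s + 1 by rewrite ltr_wpDl.
(* For x < s + 1 the negative term (s+1) x^s is at most (s+1)^(s+1); for larger x the term x^(s+1)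
   dominates it. *)
pose K := (s + 1) `^ (s + 1).
have K0 : 0 <= K by exact: powR_ge0.
pose f x := (x `^ (s + 1) - (s + 1) * x `^ s + K) * expR (- x).
pose F x := - ((x `^ (s + 1) + K) * expR (- x)).
have f_ge0 x : 0 <= x -> 0 <= f x.
{ move=> x0; rewrite mulr_ge0 ?expR_ge0//.
  have [sx|xs] := leP (s + 1) x.
  - rewrite addr_ge0// subr_ge0 -(mulr_powRB1 x0 s1) addrK.
    by rewrite ler_wpM2r ?powR_ge0.
  - rewrite -addrA addr_ge0 ?powR_ge0// addrC subr_ge0 /K.
    rewrite -(mulr_powRB1 (ltW s1) s1) addrK ler_wpM2l ?(ltW s1)//.
    by apply: ge0_ler_powR; rewrite ?nnegrE ?(ltW s1) ?(ltW xs). }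
have fcv (G : set_system R) (FG : Filter G) (a : R) :
    x `^ s @[x --> G] --> a `^ s -> x `^ (s + 1) @[x --> G] --> a `^ (s + 1) ->
    expR (- x) @[x --> G] --> expR (- a) -> f x @[x --> G] --> f a.
{ move=> h1 h2 h3; apply: cvgM => //; apply: cvgD; last exact: cvg_cst.
  by apply: cvgB => //; apply: cvgM => //; exact: cvg_cst. }
have cexp (a : R) : expR (- x) @[x --> a] --> expR (- a).
{ by apply: (@is_derive_cvg _ (fun x => expR (- x))); have := is_derive_expRN 1 a;
  under eq_fun do rewrite mul1r; exact. }
have cexp0 : expR (- x) @[x --> (0 : R)^'+] --> expR (- 0).
{ by apply: cvg_at_right_filter; exact: cexp. }
have cf : {within `[0, +oo[, continuous f}.
{ apply/continuous_within_itvcyP; split.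
  - move=> x; rewrite in_itv/= andbT => x0.
    by apply: fcv; [| |exact: cexp]; apply: is_derive_cvg (is_derive1_powR _ x0).
  - by apply: fcv => //; apply: cvg_powR_right0 => //; exact: ltW. }
have Fl : F x @[x --> +oo] --> (0 : R).
{ rewrite -oppr0; apply: cvgN; rewrite -[X in _ --> X]addr0 -[X in _ --> _ + X](mulr0 K).
  under eq_fun do rewrite mulrDl.
  apply: cvgD; first exact: cvg_powR_expRN.
  by apply: cvgM; [exact: cvg_cst|exact: cvgr_expR]. }
have dF x : 0 < x -> is_derive x (1 : R) F (f x).
{ move=> x0; have d1 := is_derive1_powR (s + 1) x0.
  have d2 : is_derive x (1 : R) (fun t => expR (- t)) (- expR (- x)).
  { have := is_derive_expRN 1 x; under eq_fun do rewrite mul1r.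
    by rewrite mul1r mulN1r. }
  have d3 := is_deriveN (is_deriveM (is_deriveD d1 (is_derive_cst K x 1)) d2).
  have -> : f x = - ((x `^ (s + 1) + K) *: - expR (- x) + expR (- x) *: ((s + 1) * x `^ (s + 1 - 1) + 0)).
  { by rewrite /f /GRing.scale/= addrK; ring. }
  exact: d3. }
have dFd x : 0 < x -> derivable F x 1 by move=> /dF dx; exact: ex_derive.
have F0 : F x @[x --> (0 : R)^'+] --> F 0.
{ apply: cvgN; apply: cvgM => //; apply: cvgD; last exact: cvg_cst.
  by apply: cvg_powR_right0; exact: ltW. }
have dFE : {in `]0, +oo[, F^`()%classic =1 f}.
{ by move=> x; rewrite in_itv/= andbT => x0; rewrite derive1E; have [] := dF x x0. }
have := ge0_continuous_FTC2y f_ge0 cf Fl dFd F0 dFE.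
rewrite -EFinB /F powR0 ?gt_eqF// add0r oppr0 expR0 mulr1 opprK add0r => If.
have mf : measurable_fun (`[0, +oo[%classic : set R) f.
{ apply: measurable_funM; last by apply: measurable_funTS; apply: measurableT_comp => //; exact: measurable_funN.
  apply: measurable_funD => //; apply: measurable_funB; first by apply: measurable_funTS; exact: measurable_powR.
  by apply: measurable_funM => //; apply: measurable_funTS; exact: measurable_powR. }
have mD : measurable (`[0, +oo[%classic : set R) by [].
have : (euler_integral (s + 1) + K%:E = K%:E + (s + 1)%:E * euler_integral s)%E.
{ transitivity (\int[mu]_(x in `[0%R, +oo[)
    ((x `^ (s + 1) * expR (- x))%:E + K%:E * (x `^ 0 * expR (- x))%:E))%E.
  - rewrite ge0_integralD//; last first.
    { by apply/measurable_EFinP; apply: measurable_funM => //; exact: measurable_integrand. }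
    { by move=> x _; rewrite mule_ge0// lee_fin. }
    { by apply/measurable_EFinP; exact: measurable_integrand. }
    { by move=> x _; rewrite lee_fin. }
    rewrite ge0_integralZl_EFin//; last first.
    { by apply/measurable_EFinP; exact: measurable_integrand. }
    { by move=> x _; rewrite lee_fin. }
    by rewrite -[X in (_ * X)%E]/(euler_integral 0) euler_integral0 mule1.
  - rewrite -{2}If /euler_integral -ge0_integralZl_EFin//; last first.
    { by rewrite ltW. }
    { by apply/measurable_EFinP; exact: measurable_integrand. }
    { by move=> x _; rewrite lee_fin. }
    have m2 : measurable_fun (`[0, +oo[%classic : set R)
      (fun x => ((s + 1)%:E * (x `^ s * expR (- x))%:E)%E).
    { by apply/measurable_EFinP; apply: measurable_funM => //; exact: measurable_integrand. }
    have f2 x : (`[0, +oo[%classic : set R) x -> (0 <= (s + 1)%:E * (x `^ s * expR (- x))%:E)%E.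
    { by move=> _; apply: mule_ge0; rewrite lee_fin ?(ltW s1). }
    have f1 x : (`[0, +oo[%classic : set R) x -> (0 <= (f x)%:E)%E.
    { by rewrite /= in_itv/= andbT lee_fin => /f_ge0. }
    have m1 : measurable_fun (`[0, +oo[%classic : set R) (fun x => (f x)%:E).
    { exact/measurable_EFinP. }
    rewrite -(ge0_integralD mu mD f1 m1 f2 m2).
    apply: eq_integral => x _; rewrite -!EFinM -!EFinD; congr (_%:E).
    by rewrite /f powRr0; ring. }
rewrite [in RHS]addeC => /(congr1 (fun z => z - K%:E)%E).
by rewrite !addeK.
Qed.

Lemma euler_integral_nat n : euler_integral n%:R = (n`!%:R)%:E.
Proof.
elim: n => [|n IH]; first exact: euler_integral0.
by rewrite -natr1 euler_integralS// IH -EFinM natr1 -natrM factS.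
Qed.

Lemma euler_integral_fin_num s : 0 <= s -> euler_integral s \is a fin_num.
Proof.
move=> s0; rewrite ge0_fin_numE ?euler_integral_ge0//.
pose n := Num.bound s.
apply: (@le_lt_trans _ _ (euler_integral 0 + euler_integral n%:R)%E); last first.
{ by rewrite euler_integral0 euler_integral_nat -EFinD ltry. }
rewrite /euler_integral -ge0_integralD//; last first.
{ by apply/measurable_EFinP; exact: measurable_integrand. }
{ by move=> x _; rewrite lee_fin. }
{ by apply/measurable_EFinP; exact: measurable_integrand. }
{ by move=> x _; rewrite lee_fin. }
apply: ge0_le_integral => //.
- by move=> x _; rewrite lee_fin.
- by apply/measurable_EFinP; exact: measurable_integrand.
- apply: emeasurable_funD; apply/measurable_EFinP; exact: measurable_integrand.
- move=> x; rewrite /= in_itv/= andbT => x0; rewrite -EFinD lee_fin -mulrDl.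
  rewrite ler_wpM2r ?expR_ge0// powRr0.
  have [x1|x1] := leP 1 x.
  + by rewrite ler_wpDl// ler_powR// ltW// archi_boundP.
  + rewrite ler_wpDr ?powR_ge0//.
    apply: (@le_trans _ _ (1 `^ s)); last by rewrite powR1.
    by apply: ge0_ler_powR; rewrite ?nnegrE//; exact: ltW.
Qed.

Definition gam s : R := fine (euler_integral s).

Lemma gamE s : 0 <= s -> (gam s)%:E = euler_integral s.
Proof. by move=> s0; rewrite fineK// euler_integral_fin_num. Qed.

Lemma Gamma_gam s : Gamma (s + 1) = gam s.
Proof.
rewrite /Gamma /Rintegral addrK /gam /euler_integral integral_itv_obnd_cbnd//.
by apply/measurable_EFinP; exact: measurable_integrand.
Qed.

Lemma gamS s : 0 <= s -> gam (s + 1) = (s + 1) * gam s.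
Proof.
move=> s0; apply: EFin_inj; rewrite EFinM !gamE//; first exact: euler_integralS.
exact: addr_ge0.
Qed.

Lemma gam_nat n : gam n%:R = n`!%:R.
Proof. by rewrite /gam euler_integral_nat. Qed.

(** Wendel's inequality: the tangent bound for (x/(b+1))^s is integrated against x^b e^(-x), and the
    functional equation cancels the first-order term. *)
Lemma gamD_le b s : 0 <= b -> 0 <= s <= 1 -> gam (b + s) <= (b + 1) `^ s * gam b.
Proof.
move=> b0 /andP[s0 s1]; have b1 : 0 < b + 1 by rewrite ltr_wpDl.
pose B := (b + 1) `^ s; have B0 : 0 <= B by exact: powR_ge0.
have q0 : 0 <= B * s / (b + 1) by rewrite divr_ge0 ?mulr_ge0// ltW.
have p0 : 0 <= B * (1 - s) by rewrite mulr_ge0// subr_ge0.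
rewrite -lee_fin EFinM !gamE//; last exact: addr_ge0.
apply: (@le_trans _ _ ((B * (1 - s))%:E * euler_integral b +
  (B * s / (b + 1))%:E * euler_integral (b + 1))%E); last first.
{ rewrite euler_integralS// -gamE// -!EFinM -EFinD lee_fin.
  by rewrite le_eqVlt; apply/orP; left; apply/eqP; rewrite /B; field; rewrite gt_eqF. }
rewrite /euler_integral -!ge0_integralZl_EFin//; last first.
{ by apply/measurable_EFinP; exact: measurable_integrand. }
{ by move=> x _; rewrite lee_fin. }
{ by apply/measurable_EFinP; exact: measurable_integrand. }
{ by move=> x _; rewrite lee_fin. }
rewrite -ge0_integralD//; last first.
{ by apply/measurable_EFinP; apply: measurable_funM => //; exact: measurable_integrand. }
{ by move=> x _; rewrite mule_ge0// lee_fin. }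
{ by apply/measurable_EFinP; apply: measurable_funM => //; exact: measurable_integrand. }
{ by move=> x _; rewrite mule_ge0// lee_fin. }
apply: ge0_le_integral => //.
- by move=> x _; rewrite lee_fin.
- by apply/measurable_EFinP; exact: measurable_integrand.
- by apply: emeasurable_funD; apply/measurable_EFinP; apply: measurable_funM => //; exact: measurable_integrand.
- move=> x; rewrite /= in_itv/= andbT => x0; rewrite -!EFinM -EFinD lee_fin !mulrA -mulrDl.
  rewrite ler_wpM2r ?expR_ge0//.
  move: x0; rewrite le_eqVlt => /orP[/eqP <-|x0].
  + have [bs0|bs0] := eqVneq (b + s) 0.
    * have [bb ss] : b = 0 /\ s = 0 by split; lra.
      by rewrite /B bb ss !addr0 !powRr0 subr0 !mulr1 mulr0 mul0r mul0r addr0.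
    * by rewrite powR0// addr_ge0// mulr_ge0 ?powR_ge0.
  + have xb : 0 < x / (b + 1) by rewrite divr_gt0.
    have -> : x `^ (b + s) = x `^ b * (B * (x / (b + 1)) `^ s).
    { rewrite powRD ?(gt_eqF x0) ?implybT// /B -powRM ?(ltW b1) ?(ltW xb)//.
      by rewrite [(b + 1) * _]mulrC divfK// gt_eqF. }
    have -> : x `^ (b + 1) = x `^ b * x.
    { by rewrite powRD ?(gt_eqF x0) ?implybT// powRr1// ltW. }
    have t := powR_le_tangent xb (_ : 0 <= s <= 1).
    have -> : B * (1 - s) * x `^ b + B * s / (b + 1) * (x `^ b * x) =
      x `^ b * (B * (1 + s * (x / (b + 1) - 1))).
    { by field; rewrite gt_eqF. }
    by rewrite !ler_wpM2l ?powR_ge0// t// s0.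
Qed.

(** For t in [0, 1] the inequality [gamD_le] bounds 1 = [gam 1] by (t+1)^(1-t) times [gam t]; the
    functional equation then climbs by units. *)
Lemma gam_gt0 s : 0 <= s -> 0 < gam s.
Proof.
move=> s0; have key t : 0 <= t <= 1 -> 0 < gam t.
{ move=> /andP[t0 t1]; have h : 0 <= 1 - t <= 1 by apply/andP; split; lra.
  have := gamD_le t0 h; rewrite addrC subrK -[1]/(1%:R) gam_nat => g.
  have p : 0 < (t + 1) `^ (1 - t) by rewrite powR_gt0// ltr_wpDl.
  by rewrite -(pmulr_rgt0 _ p); apply: lt_le_trans g; rewrite ltr0n. }
have [n] : exists n : nat, s <= n%:R.
{ by exists (Num.bound s); rewrite ltW// archi_boundP. }
elim: n s s0 => [|n IH] s s0 sn; first by rewrite key// s0 (le_trans sn).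
have [s1|s1] := leP s 1; first by rewrite key// s0.
rewrite -(subrK 1 s) gamS ?subr_ge0 ?(ltW s1)// subrK mulr_gt0//.
- by rewrite (lt_trans ltr01).
- by apply: IH; rewrite ?subr_ge0 ?(ltW s1)// lerBlDr natr1.
Qed.

Lemma gam_prod s m : 0 <= s ->
  gam (s + m%:R) = gam s * m`!%:R * \prod_(0 <= k < m) (1 + s / k.+1%:R).
Proof.
move=> s0; elim: m => [|m IH]; first by rewrite big_geq// addr0 fact0 !mulr1.
rewrite -natr1 addrA gamS ?addr_ge0// IH big_nat_recr//= factS natrM.
have -> : m.+1%:R = m%:R + 1 :> R by rewrite natr1.
by field; rewrite gt_eqF// ltr_wpDl.
Qed.

(** Gauss' product. For exponents t in [0, 1], [gamD_le] used at t + m and at m squeezes the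
    quotient. Passing from t to t + 1 multiplies the product by (t + m + 1)/(t + 1). *)
Lemma cvg_prod_gauss s : 0 <= s ->
  (fun m => (\prod_(0 <= k < m) (1 + s / k.+1%:R)) / m.+1%:R `^ s) @ \oo --> (gam s)^-1.
Proof.
move=> s0; have key t : 0 <= t <= 1 ->
  (fun m => (\prod_(0 <= k < m) (1 + t / k.+1%:R)) / m.+1%:R `^ t) @ \oo --> (gam t)^-1.
{ move=> t01; have /andP[t0 t1] := t01.
  have g0 := gam_gt0 t0.
  apply: (@squeeze_cvgr _ \oo _ R (fun m => (gam t)^-1 * ((m + 1)%:R / (m + 2)%:R)) (fun=> (gam t)^-1)); last exact: cvg_cst.
  - apply: nearW => m; set p := \prod_(_ <= _ < _) _.
    have m0 : 0 < m.+1%:R `^ t :> R by rewrite powR_gt0.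
    have f0 : 0 < m`!%:R :> R by rewrite ltr0n fact_gt0.
    have pE : p = gam (t + m%:R) / (gam t * m`!%:R).
    { by rewrite gam_prod// -/p; field; rewrite !gt_eqF. }
    apply/andP; split.
    + have h : 0 <= 1 - t <= 1 by rewrite subr_ge0 t1 gerBl t0.
      have := gamD_le (addr_ge0 t0 (ler0n R m)) h.
      have -> : t + m%:R + (1 - t) = m.+1%:R by rewrite -natr1; ring.
      rewrite gam_nat; set q := _ `^ (1 - t) => g.
      have qm : q * m.+1%:R `^ t <= m.+2%:R.
      { apply: (@le_trans _ _ (m.+2%:R `^ (1 - t) * m.+2%:R `^ t)).
        - apply: ler_pM; rewrite ?powR_ge0//; apply: ge0_ler_powR; rewrite ?nnegrE ?subr_ge0//.
          + by rewrite addr_ge0// addr_ge0.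
          + rewrite -[m.+2]addn2 natrD; lra.
          + by rewrite ler_nat.
        - by rewrite -powRD ?subrK ?powRr1// oner_eq0. }
      have m2 : 0 < m.+2%:R :> R by rewrite ltr0n.
      have gm : 0 < gam (t + m%:R) by rewrite gam_gt0// addr_ge0.
      rewrite (ler_pdivlMr _ _ m0) pE !addnS !addn0 (ler_pdivlMr _ _ (mulr_gt0 g0 f0)).
      have -> : (gam t)^-1 * (m.+1%:R / m.+2%:R) * m.+1%:R `^ t * (gam t * m`!%:R) =
        (m.+1`!%:R * m.+1%:R `^ t) / m.+2%:R :> R.
      { by rewrite factS natrM; field; rewrite !gt_eqF. }
      rewrite ler_pdivrMr//; apply: (@le_trans _ _ (q * gam (t + m%:R) * m.+1%:R `^ t)).
      { by rewrite ler_wpM2r// ltW. }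
      rewrite mulrAC mulrC; exact: (ler_wpM2l (ltW gm) qm).
    + have := gamD_le (ler0n R m) t01; rewrite gam_nat natr1 addrC => g.
      rewrite ler_pdivrMr// pE ler_pdivrMr ?mulr_gt0//.
      apply: (le_trans g); rewrite le_eqVlt; apply/orP; left; apply/eqP.
      by field; rewrite gt_eqF.
  - rewrite -[X in _ --> X]mulr1; apply: cvgM; first exact: cvg_cst.
    exact: cvg_natS_div. }
have [n] : exists n : nat, s <= n%:R.
{ by exists (Num.bound s); rewrite ltW// archi_boundP. }
elim: n s s0 => [|n IH] s s0 sn.
{ by apply: key; rewrite s0 (le_trans sn). }
have [s1|s1] := leP s 1; first by apply: key; rewrite s0.
pose t := s - 1; have t0 : 0 <= t by rewrite subr_ge0 ltW.
have t1 : 0 < t + 1 by rewrite ltr_wpDl.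
have := IH t t0; rewrite lerBlDr natr1 => /(_ sn) tl.
have -> : s = t + 1 by rewrite subrK.
rewrite gamS// invfM.
have PE m : \prod_(0 <= k < m) (1 + (t + 1) / k.+1%:R) =
    \prod_(0 <= k < m) (1 + t / k.+1%:R) * (t + m.+1%:R) / (t + 1).
{ elim: m => [|m IHm]; first by rewrite !big_geq// mul1r divff ?gt_eqF.
  rewrite !big_nat_recr//= IHm.
  have -> : m.+2%:R = m.+1%:R + 1 :> R by rewrite natr1.
  by field; rewrite !gt_eqF. }
rewrite mulrC; have tm : (fun m => 1 + t * m.+1%:R^-1) @ \oo --> (1 : R).
{ rewrite -[X in _ --> X]addr0 -[X in _ --> _ + X](mulr0 t).
  apply: cvgD; first exact: cvg_cst.
  by apply: cvgM; [exact: cvg_cst|exact: cvg_harmonic]. }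
rewrite -[X in _ --> X]mul1r -[X in _ --> X]mulr1 -mulrA mulrAC mul1r.
have := cvgM (cvgM tl tm) (@cvg_cst _ (t + 1)^-1 _ \oo _).
move=> h; apply: cvg_trans (h _ _ _); apply: near_eq_cvg; apply: nearW => m /=.
rewrite PE [_ `^ (t + 1)]powRD ?pnatr_eq0 ?implybT// powRr1//.
by field; rewrite !gt_eqF ?powR_gt0.
Qed.

End gamma.

(** * Asymptotics of the rank sequence *)

(** a(y + 1) <= x + C + 1 because a <= 1, and C + 1 <= (C + 1)x because 1 <= x; hence the constant C
    + 2. *)
Lemma linear_lower_bound (R : realType) (a C x y : R) : a <= 1 -> 0 <= C ->
  a * y - C <= x -> 1 <= x -> a * (y + 1) <= (C + 2) * x.
Proof. by move=> a1 C0 xy x1; nra. Qed.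

Section rank_asymptotics.
Context {R : realType} (r : nat -> nat) (r_rank : rank_sequence r).
Variables (alpha C : R).
Hypothesis alpha_gt0 : 0 < alpha.
Hypothesis alpha_le1 : alpha <= 1.
Hypothesis rC : forall m, `|(r m)%:R - alpha * m%:R| <= C.
Local Notation beta := (alpha^-1).

Definition rate (k : nat) : R := delta r k.+1 / (r k.+1)%:R.

Lemma cvg_dist_le (x e : nat -> R) (l : R) :
  (forall m, `|x m - l| <= e m) -> e @ \oo --> (0 : R) -> x @ \oo --> l.
Proof.
move=> xe e0; apply/cvgrPdist_le => /= eps eps0.
move/cvgr0Pnorm_le : e0 => /(_ _ eps0)[K _ HK].
exists K => // m /= /HK /= h; rewrite distrC (le_trans (xe m))//.
exact: le_trans (ler_norm _) h.
Qed.

Lemma rank_bound_ge0 : 0 <= C.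
Proof. exact: le_trans (normr_ge0 _) (rC 0). Qed.

Lemma rank_ge m : alpha * m.+1%:R <= (C + 2) * (r m)%:R.
Proof.
have r1 : 1 <= (r m)%:R :> R by rewrite ler1n rank_gt0.
have := rC m; rewrite ler_distl => /andP[h _].
have C0 := rank_bound_ge0; rewrite -natr1.
exact: linear_lower_bound alpha_le1 C0 h r1.
Qed.

Definition rank_const : R := (C + 2) / alpha.

Lemma rank_const_gt0 : 0 < rank_const.
Proof. by rewrite divr_gt0// ltr_wpDl// rank_bound_ge0. Qed.

Lemma inv_rank_le k : (r k.+1)%:R^-1 <= rank_const / k.+1%:R.
Proof.
have r0 : 0 < (r k.+1)%:R :> R by rewrite ltr0n rank_gt0.
have k0 : 0 < k.+1%:R :> R by rewrite ltr0n.
rewrite ler_pdivlMr// mulrC ler_pdivrMr// /rank_const mulrAC ler_pdivlMr// mulrC.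
apply: le_trans (rank_ge k.+1).
by rewrite ler_wpM2l ?(ltW alpha_gt0)// ler_nat.
Qed.

Lemma rate_ge0 k : 0 <= rate k.
Proof. by rewrite divr_ge0// delta_ge0. Qed.

Lemma rate_le k : rate k <= rank_const / k.+1%:R.
Proof.
apply: le_trans (inv_rank_le k); rewrite /rate ler_piMl ?invr_ge0//.
by rewrite /delta; case: ifP.
Qed.

Lemma rate_out k : ~~ stays r k.+1 -> rate k = 0.
Proof. by rewrite /rate /delta /stays => /negbTE ->; rewrite mul0r. Qed.

Lemma cvg_rank : (fun m => (r m)%:R / m.+1%:R) @ \oo --> alpha.
Proof.
apply: (@cvg_dist_le _ (fun m => (C + alpha) * m.+1%:R^-1)).
- move=> m; have m0 : 0 < m.+1%:R :> R by rewrite ltr0n.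
  rewrite -ler_pdivrMr ?invr_gt0// invrK -{2}(gtr0_norm m0) -normrM mulrBl.
  rewrite divfK ?gt_eqF// -natr1 mulrDr mulr1 opprD addrA.
  by rewrite (le_trans (ler_normB _ _))// lerD// gtr0_norm.
- rewrite -[X in _ --> X](mulr0 (C + alpha)).
  by apply: cvgM; [exact: cvg_cst|exact: cvg_harmonic].
Qed.

Lemma cvg_rank_infty : r @ \oo --> \oo.
Proof.
apply/(@cvgrnyP R); apply/cvgryPge => A.
have C2 : 0 < C + 2 by rewrite ltr_wpDl// rank_bound_ge0.
have [N _ HN] := cvgry_ge (cvg_natS_powR ltr01) (A * (C + 2) / alpha).
exists N => // m /= /HN /=; rewrite powRr1// ler_pdivrMr// => h.
rewrite -(ler_pM2r C2); apply: (le_trans h).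
by rewrite mulrC [leRHS]mulrC rank_ge.
Qed.

Lemma is_cvg_rho : cvgn (rho_series r alpha).
Proof.
apply: normed_cvg.
apply: (@series_le_cvg _ _ (fun k => (C * rank_const / alpha) * (k.+1%:R ^+ 2)^-1)).
- by move=> k; exact: normr_ge0.
- move=> k; rewrite mulr_ge0 ?invr_ge0 ?sqr_ge0//.
  rewrite divr_ge0 ?(ltW alpha_gt0)// mulr_ge0 ?rank_bound_ge0//.
  exact: ltW rank_const_gt0.
- move=> k; have r0 : 0 < (r k.+1)%:R :> R by rewrite ltr0n rank_gt0.
  rewrite /=; set y : R := k.+1%:R; have y0 : 0 < y by rewrite ltr0n.
  have -> : (r k.+1)%:R^-1 - (alpha * y)^-1 = ((alpha * y) - (r k.+1)%:R) * ((r k.+1)%:R^-1 * (alpha * y)^-1).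
  { by field; rewrite !gt_eqF. }
  have i0 : 0 <= (alpha * y)^-1 by rewrite invr_ge0 mulr_ge0 ?ltW.
  rewrite normrM distrC (ger0_norm (mulr_ge0 _ i0)) ?invr_ge0//.
  apply: (@le_trans _ _ (C * (rank_const / y * (alpha * y)^-1))).
  + apply: ler_pM => //; first by rewrite mulr_ge0// invr_ge0.
    by rewrite ler_wpM2r// inv_rank_le.
  + by rewrite le_eqVlt; apply/orP; left; apply/eqP; field; rewrite !gt_eqF.
- exact/is_cvg_seriesZ/is_cvg_series_inv_sqr.
Qed.

(* Every value j >= 2 in the range of r is first attained at exactly one index,
   where delta vanishes. *)
Lemma rank_sum (f : nat -> R) m :
  \sum_(0 <= k < m) delta r k.+1 * f (r k.+1) + \sum_(0 <= j < r m) f j.+1 =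
  f 1%N + \sum_(0 <= k < m) f (r k.+1).
Proof.
elim: m => [|m IH]; first by rewrite r_rank.1 !(big_geq (leqnn 0)) big_nat1 add0r addr0.
rewrite !big_nat_recr//= addrA -IH; have [h|h] := boolP (stays r m.+1).
- have d1 : delta r m.+1 = 1 :> R by rewrite /delta -[_ == _]/(stays r m.+1) h.
  by rewrite (stays_rank h) d1 mul1r addrAC.
- have d0 : delta r m.+1 = 0 :> R by rewrite /delta -[_ == _]/(stays r m.+1) (negbTE h).
  by rewrite (nstays_rank r_rank h) d0 mul0r addr0 big_nat_recr//= addrA.
Qed.

(** Multiplicative counterpart of [rank_sum]; the factor [1 + t] belongs to the initial value
    [r 0 = 1]. *)
Lemma rank_prod (t : R) m :
  compensator rate t m * \prod_(0 <= j < r m) (1 + t / j.+1%:R) =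
  (1 + t) * \prod_(0 <= k < m) (1 + t / (r k.+1)%:R).
Proof.
rewrite /compensator.
elim: m => [|m IH]; first by rewrite r_rank.1 !(big_geq (leqnn 0)) big_nat1 mul1r mulr1 divr1.
rewrite !big_nat_recr//= mulrA -IH /rate; have [h|h] := boolP (stays r m.+1).
- have d1 : delta r m.+1 = 1 :> R by rewrite /delta -[_ == _]/(stays r m.+1) h.
  by rewrite (stays_rank h) d1 mul1r mulrAC.
- have d0 : delta r m.+1 = 0 :> R by rewrite /delta -[_ == _]/(stays r m.+1) (negbTE h).
  rewrite (nstays_rank r_rank h) d0 mul0r mulr0 addr0 mulr1.
  by rewrite big_nat_recr//= mulrA.
Qed.

(** The drift is 1 plus the sum of the 1/r(k) minus the harmonic number of r(m). The sum contributes
    rho and H_m / alpha, the harmonic number contributes gamma + ln(alpha m), and this is what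
    remains beside (1/alpha - 1) ln m. *)
Definition kappa : R :=
  (beta - 1) * euler_gamma R + limn (rho_series r alpha) + 1 - ln alpha.

Lemma cvg_drift : (fun m => drift rate m - (beta - 1) * ln m.+1%:R) @ \oo --> kappa.
Proof.
pose eu n : R := series harmonic n - ln n%:R.
have euE : eu @ \oo --> euler_gamma R by exact: is_cvg_euler_gamma.
have h0 : (fun m => m.+1%:R^-1 : R) @ \oo --> (0 : R) by exact: cvg_harmonic.
have E m : drift rate m - (beta - 1) * ln m.+1%:R =
  1 + rho_series r alpha m + beta * (eu m.+1 - m.+1%:R^-1) - eu (r m) - ln ((r m)%:R / m.+1%:R).
{ have r0 : 0 < (r m)%:R :> R by rewrite ltr0n rank_gt0.
  have m0 : 0 < m.+1%:R :> R by rewrite ltr0n.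
  have := rank_sum (fun j => j%:R^-1) m; rewrite invr1.
  rewrite -[\sum_(0 <= j < r m) _]/(series harmonic (r m)).
  rewrite -[\sum_(0 <= k < m) delta _ _ * _]/(drift rate m).
  have -> : \sum_(0 <= k < m) (r k.+1)%:R^-1 = rho_series r alpha m + beta * series harmonic m.
  { rewrite /rho_series /series/= mulr_sumr -big_split/=; apply: eq_bigr => k _.
    by rewrite invfM subrK. }
  have -> : series harmonic m = eu m.+1 + ln m.+1%:R - m.+1%:R^-1 :> R.
  { by rewrite /eu subrK /series/= big_nat_recr//= addrK. }
  have -> : series harmonic (r m) = eu (r m) + ln (r m)%:R :> R by rewrite subrK.
  rewrite lnM ?posrE ?invr_gt0// lnV ?posrE//.
  move: (drift rate m) (eu (r m)) (eu m.+1) (rho_series r alpha m) => a b c d.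
  move: (ln (r m)%:R) (ln m.+1%:R) (m.+1%:R^-1) => e f g h.
  have -> : a = 1 + (d + alpha^-1 * (c + f - g)) - (b + e) by rewrite -h addrK.
  by ring. }
have -> : kappa = 1 + limn (rho_series r alpha) + beta * (euler_gamma R - 0) - euler_gamma R - ln alpha.
{ by rewrite /kappa; ring. }
rewrite (_ : (fun m => _) = (fun m => 1 + rho_series r alpha m +
  beta * (eu m.+1 - m.+1%:R^-1) - eu (r m) - ln ((r m)%:R / m.+1%:R))); last exact/funext.
apply: cvgB; last exact: (cvg_ln alpha_gt0 cvg_rank).
apply: cvgB; last exact: (cvg_comp _ _ cvg_rank_infty euE).
apply: cvgD.
- by apply: cvgD; [exact: cvg_cst|exact: is_cvg_rho].
- apply: cvgM; first exact: cvg_cst.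
  by apply: cvgB => //; rewrite cvg_shiftS.
Qed.

(** For x >= 0, 1 + x >= e^(x - x^2), since (1 + x)(1 - x + x^2) = 1 + x^3. The squares are
    summable, and the drift is (1/alpha - 1) ln m up to a bounded term. *)
Lemma compensator_ge (t : R) : 0 <= t -> exists2 c0 : R, 0 < c0 &
  forall m, c0 * m.+1%:R `^ (t * (beta - 1)) <= compensator rate t m.
Proof.
move=> t0; have [K [_ HK]] := cvg_seq_bounded (cvgP _ cvg_drift).
have {HK} drift_ge m : (beta - 1) * ln m.+1%:R - (K + 1) <= drift rate m.
{ have := HK (K + 1); rewrite ltrDl ltr01 => /(_ isT m I) /=.
  rewrite ler_norml => /andP[h _]; lra. }
exists (expR (- (t * (K + 1) + 2 * (t * rank_const) ^+ 2))); first exact: expR_gt0.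
move=> m; have m0 : 0 < m.+1%:R :> R by rewrite ltr0n.
rewrite /powR gt_eqF// -expRD.
apply: (@le_trans _ _ (expR (\sum_(0 <= k < m) (t * rate k - (t * rate k) ^+ 2)))).
- rewrite ler_expR sumrB -mulr_sumr -[\sum_(0 <= k < m) rate k]/(drift rate m).
  have : \sum_(0 <= k < m) (t * rate k) ^+ 2 <= 2 * (t * rank_const) ^+ 2.
  { under eq_bigr do rewrite exprMn; rewrite -mulr_sumr exprMn mulrCA.
    rewrite ler_wpM2l ?sqr_ge0//.
    exact: (sum_sqr_le rate_ge0 (ltW rank_const_gt0) rate_le). }
  have := ler_wpM2l t0 (drift_ge m); move: (ln _) (drift _ _) => a b.
  rewrite mulrBr mulrA; lra.
- rewrite expR_sum; apply: ler_prod => k _; rewrite expR_ge0/=.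
  set x := t * rate k; have x0 : 0 <= x by rewrite mulr_ge0// rate_ge0.
  have e1 := expR_ge1Dx (- (x - x ^+ 2)).
  rewrite -[x - x ^+ 2]opprK expRN -[leLHS]div1r ler_pdivrMr ?expR_gt0//.
  apply: (@le_trans _ _ ((1 + x) * (1 - (x - x ^+ 2)))); last first.
  { by rewrite ler_wpM2l// addr_ge0. }
  have -> : (1 + x) * (1 - (x - x ^+ 2)) = 1 + x ^+ 3 by ring.
  by rewrite lerDl exprn_ge0.
Qed.

End rank_asymptotics.

(** * Growth of the number of accepted candidates *)

Section path.
Context {R : realType}.
Variables (M : nat -> nat) (y : nat -> R) (alpha C : R).
Hypothesis alpha_gt0 : 0 < alpha.
Hypothesis alpha_le1 : alpha <= 1.
Hypothesis C_gt0 : 0 < C.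
Hypothesis M0 : M 0 = 0%N.
Hypothesis MS : forall n, M n.+1 = M n \/ M n.+1 = (M n).+1.
Hypothesis y_homo : forall m, y m <= y m.+1.
Local Notation beta := (alpha^-1).

Let a n : R := expR (y (M n)).
Let S m : R := \sum_(0 <= j < m) expR (y j).
Let G n : R := (M n)%:R - \sum_(0 <= k < n) expR (- y (M k)).

(* The right-hand side is o(n) when G n = o(n ^ alpha), while
   S m ~ alpha * C * m ^ (1 / alpha): this determines the growth of M. *)
Lemma path_sum n : S (M n) - n%:R = \sum_(0 <= k < n) (G k.+1 - G k) * a k.
Proof.
elim: n => [|n IH]; first by rewrite M0 /S !big_geq// subrr.
rewrite big_nat_recr//= -IH /G [in X in _ - X - _]big_nat_recr//= -natr1.
have aK : expR (- y (M n)) * a n = 1 by rewrite /a -expRD addrC subrr expR0.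
have -> : ((M n.+1)%:R - (\sum_(0 <= i < n) expR (- y (M i)) + expR (- y (M n))) -
  ((M n)%:R - \sum_(0 <= k < n) expR (- y (M k)))) * a n =
  ((M n.+1)%:R - (M n)%:R) * a n - expR (- y (M n)) * a n by ring.
rewrite aK; have [->|->] := MS n; first by rewrite subrr mul0r; ring.
rewrite /S [in LHS]big_nat_recr//= -/(S (M n)) -natr1 -/(a n).
ring.
Qed.

Lemma path_abel n : \sum_(0 <= k < n) (G k.+1 - G k) * a k =
  G n * a n - \sum_(0 <= k < n) G k.+1 * (a k.+1 - a k).
Proof.
elim: n => [|n IH]; first by rewrite /G M0 !big_geq// subrr mul0r subrr.
by rewrite !big_nat_recr//= IH; ring.
Qed.

Lemma a_homo n : a n <= a n.+1.
Proof. by rewrite ler_expR; have [->|->] := MS n. Qed.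

(** [a] is nondecreasing, so its total variation up to [n] is at most [a n], and the boundary term
    of the summation by parts costs as much again. *)
Lemma path_dist n (g : R) : (forall k, (k <= n)%N -> `|G k| <= g) ->
  `|S (M n) - n%:R| <= 2 * g * a n.
Proof.
move=> Gg; rewrite path_sum path_abel.
have g0 : 0 <= g by exact: le_trans (normr_ge0 _) (Gg 0%N _).
have a0 k : 0 <= a k by exact: expR_ge0.
apply: (le_trans (ler_normB _ _)).
have -> : 2 * g * a n = g * a n + g * a n by ring.
apply: lerD; first by rewrite normrM (ger0_norm (a0 n)) ler_wpM2r// Gg.
apply: (@le_trans _ _ (g * (a n - a 0%N))); last by rewrite ler_wpM2l// gerBl.
rewrite -(telescope_sumr a (leq0n n)) mulr_sumr (le_trans (ler_norm_sum _ _ _))//.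
rewrite big_nat [leRHS]big_nat; apply: ler_sum => k /andP[_ kn].
have d0 : 0 <= a k.+1 - a k by rewrite subr_ge0 a_homo.
by rewrite normrM (ger0_norm d0) ler_wpM2r// Gg.
Qed.

(** The error may grow with [x n] itself, as it does for [path_dist], whose bound involves [M n]. A
    crude eps first bounds [x]; afterwards the error is genuinely small. *)
Lemma cvg_ratio_of_dist (x : nat -> R) (L : R) : 0 < L -> (forall n, 0 <= x n) ->
  (forall eps, 0 < eps -> \forall n \near \oo, `|L * x n - 1| <= eps * (1 + x n)) ->
  x @ \oo --> L^-1.
Proof.
(* With eps = L/4 the hypothesis yields 3Lz/4 <= 1 + L/4 for z = [x n], hence z <= [X]. *)
move=> L0 x0 H; pose X := (2 + L) / L.
have X0 : 0 < X by rewrite divr_gt0// addr_gt0.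
apply/cvgrPdist_le => /= eps eps0.
pose e := Num.min (L / 4) (L * eps / (1 + X)).
have X1 : 0 < 1 + X by rewrite addr_gt0.
have e0 : 0 < e by rewrite lt_min !divr_gt0// mulr_gt0.
have [N _ HN] := H e e0; exists N => // n /= /HN /= {H HN}.
have xn := x0 n; move: (x n) xn => z z0 h.
have e1 : e <= L / 4 by rewrite ge_min lexx.
have e2 : e * (1 + X) <= L * eps by rewrite -ler_pdivlMr// ge_min lexx orbT.
have zX : z <= X.
{ rewrite ler_pdivlMr//; move: h; rewrite ler_norml => /andP[_ h].
  have : e * (1 + z) <= L / 4 * (1 + z) by rewrite ler_wpM2r// addr_ge0.
  move=> h2; have h3 : L * z - 1 <= L / 4 * (1 + z) by exact: le_trans h h2.
  have : 0 <= L * z by rewrite mulr_ge0// ltW.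
  lra. }
have -> : L^-1 - z = - (L^-1 * (L * z - 1)) by field; rewrite gt_eqF.
rewrite normrN normrM gtr0_norm ?invr_gt0// ler_pdivrMl//.
apply: (le_trans h); apply: le_trans e2; rewrite ler_wpM2l ?(ltW e0)//.
by rewrite lerD2l.
Qed.

Hypothesis M_infty : M @ \oo --> \oo.
Hypothesis y_growth : (fun m => expR (y m) / m.+1%:R `^ (beta - 1)) @ \oo --> C.
Hypothesis G_small : (fun n => G n / n.+1%:R `^ alpha) @ \oo --> (0 : R).

Let x n : R := (M n).+1%:R `^ beta / n.+1%:R.

Let beta_ge1 : 1 <= beta.
Proof. by rewrite -invr1 lef_pV2 ?posrE. Qed.

Lemma path_max_small (eta : R) : 0 < eta ->
  \forall n \near \oo, forall k, (k <= n)%N -> `|G k| <= eta * n.+1%:R `^ alpha.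
Proof.
move=> eta0; move/cvgr0Pnorm_le : G_small => /(_ _ eta0)[N _ HN].
pose K := \sum_(0 <= k < N) `|G k|.
have GK k : (k < N)%N -> `|G k| <= K.
{ move=> kN; rewrite /K (big_cat_nat (leq0n k) (ltnW kN))/=.
  rewrite [X in _ + X]big_ltn//= addrCA lerDl addr_ge0// sumr_ge0//. }
have [N2 _ HN2] := cvgry_ge (cvg_natS_powR alpha_gt0) (K / eta).
exists N2 => // n /= /HN2 /= h k kn; have [Nk|kN] := leqP N k.
- have /= := HN k Nk; have k0 : 0 < k.+1%:R `^ alpha :> R by rewrite powR_gt0.
  rewrite normrM (gtr0_norm (_ : 0 < (k.+1%:R `^ alpha)^-1)) ?invr_gt0// ler_pdivrMr//.
  move/le_trans; apply; rewrite ler_wpM2l ?(ltW eta0)//.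
  by apply: ge0_ler_powR; rewrite ?nnegrE ?(ltW alpha_gt0)// ler_nat ltnS.
- by rewrite (le_trans (GK k kN))// mulrC -ler_pdivrMr.
Qed.

Lemma powR_interp (z b : R) : 0 <= z -> 0 <= b <= 1 -> z `^ b <= 1 + z.
Proof.
move=> z0 /andP[b0 b1]; have [z1|z1] := leP 1 z.
- by rewrite (le_trans (ler1_powR z1 b1))// lerDr.
- apply: (@le_trans _ _ 1); last by rewrite lerDl.
  apply: (@le_trans _ _ (1 `^ b)); last by rewrite powR1.
  by apply: ge0_ler_powR; rewrite ?nnegrE//; exact: ltW.
Qed.

Lemma path_dist_small (eps : R) : 0 < eps ->
  \forall n \near \oo, `|S (M n) - n%:R| <= eps * n.+1%:R * (1 + x n).
Proof.
move=> eps0; have eta0 : 0 < eps / (4 * C) by rewrite divr_gt0// mulr_gt0.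
have [N1 _ H1] := path_max_small eta0.
have C2 : C < 2 * C by rewrite ltr_pMl// ltr1n.
have [N2 _ H2] := cvgr_le _ (cvg_comp _ _ M_infty y_growth) _ C2.
exists (maxn N1 N2) => // n /=; rewrite geq_max => /andP[/H1/= h1 /H2/= h2].
have n0 : 0 < n.+1%:R :> R by rewrite ltr0n.
have m0 : 0 < (M n).+1%:R `^ (beta - 1) :> R by rewrite powR_gt0.
have x0 : 0 <= x n by rewrite divr_ge0// powR_ge0.
have an : a n <= 2 * C * (M n).+1%:R `^ (beta - 1) by rewrite -ler_pdivrMr.
apply: (le_trans (path_dist h1)).
have -> : 2 * (eps / (4 * C) * n.+1%:R `^ alpha) * a n =
  (eps / (2 * C) * n.+1%:R `^ alpha) * a n by field; rewrite gt_eqF.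
apply: (@le_trans _ _ ((eps / (2 * C) * n.+1%:R `^ alpha) * (2 * C * (M n).+1%:R `^ (beta - 1)))).
{ by rewrite ler_wpM2l// mulr_ge0 ?powR_ge0// divr_ge0 ?mulr_ge0 ?ltW. }
(* beta - 1 = beta (1 - alpha), so this power is ((n+1) x_n)^(1 - alpha); the factor (n+1)^alpha
   from the bound on [G] completes it to n + 1. *)
have -> : (M n).+1%:R `^ (beta - 1) = n.+1%:R `^ (1 - alpha) * (x n) `^ (1 - alpha) :> R.
{ rewrite -powRM ?(ltW n0)// /x mulrC divfK ?gt_eqF// -powRrM; congr (_ `^ _).
  by rewrite mulrBr mulr1 mulVf ?gt_eqF. }
have -> : eps / (2 * C) * n.+1%:R `^ alpha * (2 * C * (n.+1%:R `^ (1 - alpha) * x n `^ (1 - alpha))) =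
  eps * (n.+1%:R `^ alpha * n.+1%:R `^ (1 - alpha)) * x n `^ (1 - alpha).
{ by field; rewrite gt_eqF. }
rewrite -powRD; last by rewrite addrCA subrr addr0 oner_eq0.
rewrite addrCA subrr addr0 powRr1 ?(ltW n0)// ler_wpM2l ?mulr_ge0 ?(ltW eps0)//.
by apply: powR_interp => //; rewrite subr_ge0 alpha_le1 gerBl ltW.
Qed.

(** [S m] is asymptotic to (C / beta) m^beta while [S (M n)] differs from n by a small multiple of
    n(1 + x_n). Hence [x] tends to beta / C, and its power alpha is the quotient sought. *)
Lemma path_growth : (fun n => (M n).+1%:R / n.+1%:R `^ alpha) @ \oo --> (alpha * C) `^ (- alpha).
Proof.
pose L := C / beta.
have L0 : 0 < L by rewrite divr_gt0// invr_gt0.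
have x0 n : 0 <= x n by rewrite divr_ge0// powR_ge0.
pose q n := S (M n) / (M n).+1%:R `^ beta.
have qL : q @ \oo --> L by exact: (cvg_comp _ _ M_infty (cvg_sum_powR beta_ge1 y_growth)).
have xL : x @ \oo --> L^-1.
{ apply: cvg_ratio_of_dist => // eps eps0; have e3 : 0 < eps / 3 by rewrite divr_gt0.
  have [N1 _ H1] := path_dist_small e3.
  move/cvgrPdist_le : qL => /(_ _ e3)[N2 _ H2].
  have [N3 _ H3] := cvgr_le _ (@cvg_harmonic R) _ e3.
  exists (maxn N1 (maxn N2 N3)) => // n /=; rewrite !geq_max.
  move=> /andP[/H1/= h1 /andP[/H2/= h2 /H3/= h3]].
  have n0 : 0 < n.+1%:R :> R by rewrite ltr0n.
  have xn := x0 n.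
  have m0 : 0 < (M n).+1%:R `^ beta :> R by rewrite powR_gt0.
  have e1 : L * x n - 1 = (L - q n) * x n + (S (M n) - n%:R) / n.+1%:R - n.+1%:R^-1.
  { have -> : n%:R = n.+1%:R - 1 :> R by rewrite -natr1 addrK.
    by rewrite /q /x; field; rewrite !gt_eqF. }
  rewrite e1; apply: (le_trans (ler_normB _ _)); apply: (le_trans (lerD (ler_normD _ _) (lexx _))).
  have i0 : 0 < n.+1%:R^-1 :> R by rewrite invr_gt0.
  have f1 : `|(L - q n) * x n| <= eps / 3 * x n by rewrite normrM (ger0_norm xn) ler_wpM2r.
  have f2 : `|(S (M n) - n%:R) / n.+1%:R| <= eps / 3 * (1 + x n).
  { by rewrite normrM (gtr0_norm i0) ler_pdivrMr// mulrAC. }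
  have f3 : `|n.+1%:R^-1| <= eps / 3 :> R by rewrite (gtr0_norm i0).
  apply: (le_trans (lerD (lerD f1 f2) f3)); move: (x n) xn => z z0; nra. }
have iL : 0 < L^-1 by rewrite invr_gt0.
have := @cvg_powR _ x L^-1 alpha iL xL.
have -> : L^-1 `^ alpha = (alpha * C) `^ (- alpha).
{ by rewrite powRN /L invrK mulrC -(@powR_inv1 _ (alpha * C)) ?mulr_ge0 ?ltW// -powRrM mulN1r powRN. }
apply: cvg_trans; apply: near_eq_cvg; apply: nearW => n.
rewrite /x powRM ?powR_ge0 ?invr_ge0// -powRrM mulVf ?gt_eqF// powRr1//.
by rewrite -[in LHS]powR_inv1// -!powRrM mulN1r powRN.
Qed.

Lemma path_growth_shift :
  (fun n => (M n)%:R / n%:R `^ alpha) @ \oo --> (alpha * C) `^ (- alpha).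
Proof.
rewrite -cvg_shiftS; set l := _ `^ (- alpha).
have h1 : (fun n => (M n.+1).+1%:R / n.+2%:R `^ alpha) @ \oo --> l.
{ by rewrite (cvg_shiftS (fun n => (M n).+1%:R / n.+1%:R `^ alpha)); exact: path_growth. }
have h2 : (fun n => (n.+2%:R `^ alpha)^-1) @ \oo --> (0 : R).
{ rewrite (cvg_shiftS (fun n => (n.+1%:R `^ alpha)^-1)).
  apply/gtr0_cvgV0; last exact: cvg_natS_powR.
  by apply: nearW => n; rewrite powR_gt0. }
have h3 : (fun n => ((n + 2)%:R / (n + 1)%:R) `^ alpha) @ \oo --> (1 : R).
{ rewrite -[X in _ --> X](_ : 1 `^ alpha = 1); last by rewrite powR1.
  apply: cvg_powR => //.
  exact: cvg_natS_div. }
rewrite -[l]mulr1 -[X in X * _]subr0.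
have h12 : (fun n => (M n.+1).+1%:R / n.+2%:R `^ alpha - (n.+2%:R `^ alpha)^-1) @ \oo --> l - 0.
{ exact: cvgB h1 h2. }
apply: cvg_trans (cvgM h12 h3).
apply: near_eq_cvg; apply: nearW => n /=.
rewrite addn2 addn1 powRM ?invr_ge0// -[in (n.+1%:R^-1) `^ _]powR_inv1// -powRrM mulN1r powRN.
by rewrite -natr1; field; rewrite !gt_eqF ?powR_gt0.
Qed.

End path.

(** * The counting martingale, moment bounds and the almost sure limit *)

Section hiring_dynamics.
Context {R : realType} (r : nat -> nat) (r_rank : rank_sequence r).
Variables (alpha C : R).
Hypothesis alpha_gt0 : 0 < alpha.
Hypothesis alpha_le1 : alpha <= 1.
Hypothesis rC : forall m, `|(r m)%:R - alpha * m%:R| <= C.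
Context d (T : measurableType d) (P : probability T R) (e : nat -> T -> R).
Hypothesis eD : exp_iid P predT e.
Local Notation beta := (alpha^-1).
Local Notation F n := (g_sigma_algebraType (cylinders e (fun i => (i < n)%N))).

Definition num n (w : T) : nat := cnt r (e^~ w) n.
Definition accept n (w : T) : R := expR (- thr r (e^~ w) n).
(** Built on the limiting overshoots [ov], so it does not depend on the time [n]: where delta_(k+1)
    = 1, this realizes E_(k+1) on the space of the candidates. *)
Definition waiting k (w : T) : R := increment r k (ov r (e^~ w)).
Local Notation Y := (walk waiting (rate r)).

Let beta_ge1 : 1 <= beta.
Proof. by rewrite -invr1 lef_pV2 ?posrE. Qed.

Lemma waiting_exp_iid : exp_iid P (fun k => stays r k.+1) waiting.
Proof. exact: (@increment_exp_iid _ r r_rank _ _ P (fun i w => ov r (e^~ w) i) (ov_exp_iid r eD)). Qed.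

Lemma waiting_ge0 k w : 0 <= waiting k w.
Proof. by apply: increment_ge0 => i; exact: ov_ge0. Qed.

Lemma thr_walk n w : thr r (e^~ w) n = Y (num n w) w.
Proof. exact: (thrE r_rank). Qed.

Lemma accept_gt0 n w : 0 < accept n w.
Proof. exact: expR_gt0. Qed.

Lemma accept_le1 n w : accept n w <= 1.
Proof. by rewrite -[leRHS]expR0 ler_expR oppr_le0 thr_ge0. Qed.

Lemma numS n w : num n.+1 w = if thr r (e^~ w) n < e n w then (num n w).+1 else num n w.
Proof. exact: cntS. Qed.

Lemma measurable_F_num n k (h : nat -> R) : (k <= n)%N ->
  measurable_fun setT ((fun w => h (num k w)) : F n -> R).
Proof.
move=> kn _ A mA; rewrite setTI.
have mk i : (i < k)%N -> measurable_fun setT (e i : F n -> R).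
{ by move=> ik; exact: (@measurable_cylinders _ _ _ e (fun i => (i < n)%N) i (leq_trans ik kn)). }
have [mc _] := @measurable_hire _ r _ (F n) e k mk.
rewrite (_ : _ @^-1` A = \bigcup_(m in [set m | A (h m)]) [set w | cnt r (e^~ w) k = m]).
- by apply: bigcup_measurable => m _; exact: mc.
- apply/seteqP; split=> w /=; first by exists (num k w).
  by move=> [m Ahm /= cm]; rewrite /num cm.
Qed.

Lemma measurable_F_accept n k : (k <= n)%N ->
  measurable_fun setT (accept k : F n -> R).
Proof.
move=> kn; apply: measurableT_comp => //; apply: measurableT_comp => //.
apply: (@measurable_thr _ r _ (F n) e k) => i ik.
exact: (@measurable_cylinders _ _ _ e (fun i => (i < n)%N) i (leq_trans ik kn)).
Qed.

Lemma measurable_num n (h : nat -> R) : measurable_fun setT (fun w => h (num n w)).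
Proof. by apply: (measurable_F_id eD (n := n)); exact: measurable_F_num. Qed.

Lemma measurable_accept n : measurable_fun setT (accept n).
Proof. by apply: (measurable_F_id eD (n := n)); exact: measurable_F_accept. Qed.

Lemma mean_step n (f1 f0 : F n -> R) :
  measurable_fun setT f1 -> measurable_fun setT f0 ->
  (forall w, 0 <= f1 w) -> (forall w, 0 <= f0 w) ->
  mean P (fun w => if thr r (e^~ w) n < e n w then f1 w else f0 w) =
  mean P (fun w => accept n w * f1 w + (1 - accept n w) * f0 w).
Proof.
move=> m1 m0 f1_ge0 f0_ge0; rewrite /mean.
have := @one_step _ r _ _ P e eD n (fun w => (f1 w)%:E) (fun w => (f0 w)%:E).
move=> H; rewrite -[RHS]H//; try exact/measurable_EFinP.
by apply: eq_integral => w _; case: ifP.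
Qed.

Lemma mean_numS n :
  mean P (fun w => (num n.+1 w)%:R) = (mean P (fun w => (num n w)%:R) + mean P (accept n))%E.
Proof.
rewrite -meanD//; last first.
{ by move=> w; rewrite ltW// accept_gt0. }
{ exact: measurable_accept. }
{ exact: (measurable_num n (fun m => m%:R)). }
transitivity (mean P (fun w => if thr r (e^~ w) n < e n w then (num n w).+1%:R else (num n w)%:R)).
{ by apply: eq_mean => w; rewrite numS; case: ifP. }
rewrite (@mean_step n (fun w => (num n w).+1%:R) (fun w => (num n w)%:R))//.
- by apply: eq_mean => w; rewrite -natr1; ring.
- exact: (measurable_F_num (fun m => m.+1%:R) (leqnn n)).
- exact: (measurable_F_num (fun m => m%:R) (leqnn n)).
Qed.

Definition compensated n (w : T) : R := (num n w)%:R - \sum_(0 <= k < n) accept k w.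

Lemma measurable_F_sum_accept n m : (m <= n.+1)%N ->
  measurable_fun setT ((fun w => \sum_(0 <= k < m) accept k w) : F n -> R).
Proof.
move=> mn; have -> : ((fun w => \sum_(0 <= k < m) accept k w) : F n -> R) =
  (fun w : F n => \sum_(k < m) accept k w).
{ by apply/funext => w; rewrite big_mkord. }
apply: measurable_sum => k; apply: measurable_F_accept.
by rewrite -ltnS (leq_trans _ mn).
Qed.

Lemma measurable_F_compensated n : measurable_fun setT (compensated n : F n -> R).
Proof.
apply: measurable_funB; last exact: measurable_F_sum_accept.
exact: (measurable_F_num (fun m => m%:R) (leqnn n)).
Qed.

Lemma measurable_compensated n : measurable_fun setT (compensated n).
Proof. by apply: (measurable_F_id eD (n := n)); exact: measurable_F_compensated. Qed.

(** Orthogonality of martingale increments: a step has conditional variance p(1 - p) <= p, with p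
    the acceptance probability, and the means of these p add up to the mean of the count. *)
Lemma mean_compensated_sqr n :
  (mean P (fun w => compensated n w ^+ 2)%R <= mean P (fun w => (num n w)%:R)%R)%E.
Proof.
elim: n => [|n IH].
{ rewrite (_ : (fun w => _) = (fun=> 0)); last first.
  { by apply/funext => w; rewrite /compensated big_geq// subr0 expr0n. }
  by rewrite (_ : mean P (fun=> 0) = 0%E) ?mean_cst// mean_ge0. }
pose f1 w := ((compensated n w - accept n w) + 1) ^+ 2.
pose f0 w := (compensated n w - accept n w) ^+ 2.
have mG := @measurable_F_compensated n; have mp := measurable_F_accept (leqnn n).
have -> : mean P (fun w => compensated n.+1 w ^+ 2) =
  mean P (fun w => if thr r (e^~ w) n < e n w then f1 w else f0 w).
{ apply: eq_mean => w; rewrite /f1 /f0 /compensated big_nat_recr//= numS.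
  by case: ifP => _; rewrite -?natr1; congr (_ ^+ 2); ring. }
rewrite (@mean_step n f1 f0)//; last first.
{ by move=> w; exact: sqr_ge0. }
{ by move=> w; exact: sqr_ge0. }
{ by apply: measurable_funX; exact: measurable_funB. }
{ by apply: measurable_funX; apply: measurable_funD => //; exact: measurable_funB. }
rewrite mean_numS.
have key w : accept n w * f1 w + (1 - accept n w) * f0 w =
  compensated n w ^+ 2 + accept n w * (1 - accept n w).
{ by rewrite /f1 /f0; ring. }
under eq_mean do rewrite key.
have mG2 : measurable_fun setT (fun w => compensated n w ^+ 2).
{ by apply: measurable_funX; exact: measurable_compensated. }
have pp w : 0 <= accept n w * (1 - accept n w).
{ by rewrite mulr_ge0 ?subr_ge0 ?accept_le1// ltW// accept_gt0. }
have mpp : measurable_fun setT (fun w => accept n w * (1 - accept n w)).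
{ apply: measurable_funM; first exact: measurable_accept.
  by apply: measurable_funB => //; exact: measurable_accept. }
rewrite meanD//; last by move=> w; exact: sqr_ge0.
apply: leeD => //; apply: mean_le => //; first exact: measurable_accept.
by move=> w; rewrite pp/= ler_piMr ?gerBl ?(ltW (accept_gt0 _ _)).
Qed.

(** The threshold is the walk at the random index M_n. By [compensator_ge] the quantity is below a
    multiple of [expwalk] with t = q at that index, and the integrable bound for all indices gives
    uniformity in n. *)
Lemma accept_growth (q : nat) : exists2 K : R, 0 <= K & forall n,
  (mean P (fun w => (accept n w * (num n w).+1%:R `^ (beta - 1)) ^+ q)%R <= K%:E)%E.
Proof.
have [c0 c0_gt0 Hc] := compensator_ge r_rank alpha_gt0 alpha_le1 rC (ler0n R q).
have [B [mB LB iB]] := expwalk_dominated waiting_exp_iid waiting_ge0 (rate_ge0 r)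
  (@rate_out _ r) (ltW (rank_const_gt0 alpha_gt0 rC)) (rate_le r_rank alpha_gt0 alpha_le1 rC) (ler0n R q).
have B0 w : (0 <= B w)%E.
{ apply: le_trans (LB w 0%N); rewrite lee_fin; apply: expwalk_ge0 => // k.
  exact: rate_ge0. }
have IB0 : (0 <= \int[P]_w B w)%E by exact: integral_ge0.
have fB : (\int[P]_w B w)%E \is a fin_num by rewrite ge0_fin_numE.
exists (c0^-1 * fine (\int[P]_w B w)%E).
{ by rewrite mulr_ge0 ?invr_ge0 ?(ltW c0_gt0)// fine_ge0. }
move=> n; rewrite EFinM fineK// -ge0_integralZl_EFin//; last first.
{ by rewrite invr_ge0 ltW. }
apply: ge0_le_integral => //.
- by move=> w _; rewrite lee_fin exprn_ge0// mulr_ge0 ?powR_ge0 ?(ltW (accept_gt0 _ _)).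
- apply/measurable_EFinP; apply: measurable_funX; apply: measurable_funM.
  + exact: measurable_accept.
  + exact: (measurable_num n (fun m => m.+1%:R `^ (beta - 1))).
- exact: emeasurable_funM.
- move=> w _; apply: (@le_trans _ _ (c0^-1%:E * (expwalk waiting (rate r) q%:R (num n w) w)%:E)%E).
  + rewrite -EFinM lee_fin ler_pdivlMl// exprMn mulrCA /expwalk /accept thr_walk.
    rewrite -expRM_natl mulrN ler_wpM2l ?expR_ge0//.
    by rewrite -powR_mulrn ?powR_ge0// -powRrM [_ * q%:R]mulrC Hc.
  + by rewrite lee_wpmul2l// lee_fin invr_ge0 ltW.
Qed.

Lemma exprD1_ge (x : R) (q : nat) : 0 <= x -> x ^+ q.+1 + x ^+ q <= (x + 1) ^+ q.+1.
Proof.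
move=> x0; have -> : x ^+ q.+1 + x ^+ q = (x + 1) * x ^+ q by rewrite exprS; ring.
rewrite [leRHS]exprS ler_wpM2l ?addr_ge0//.
by rewrite lerXn2r ?nnegrE ?addr_ge0// lerDl.
Qed.

(** Young's inequality without its constants, by comparing x with v / N. *)
Lemma young_step (x v N : R) (q : nat) : 0 <= x -> 0 <= v -> 0 < N ->
  x * v ^+ q <= v ^+ q.+1 / N + x ^+ q.+1 * N ^+ q.
Proof.
move=> x0 v0 N0; have [h|h] := leP x (v / N).
- apply: (@le_trans _ _ (v / N * v ^+ q)); first by rewrite ler_wpM2r// exprn_ge0.
  by rewrite exprS mulrAC lerDl mulr_ge0 ?exprn_ge0 ?(ltW N0).
- rewrite ltr_pdivrMr// in h.
  apply: (@le_trans _ _ (x * (x * N) ^+ q)).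
  + by rewrite ler_wpM2l// lerXn2r ?nnegrE ?mulr_ge0 ?(ltW N0) ?(ltW h).
  + by rewrite exprMn mulrA -exprS lerDr divr_ge0 ?exprn_ge0 ?(ltW N0).
Qed.

(** Recursion for the power q + 2 of V = (M + 1)^beta. An acceptance raises it by a relative amount
    O(1/M), on average a multiple of b V^(q+1), where b = p (M + 1)^(beta - 1) has bounded moments.
    Young's inequality splits this into V^(q+2)/n and b^(q+2) n^(q+1). The exponent is at least 2,
    so that n^(q+2) outgrows the linear homogeneous solution. *)
Lemma moment_nat (q : nat) : exists2 K : R, 0 <= K & forall n,
  (mean P (fun w => ((num n w).+1%:R `^ beta) ^+ q.+2)%R <= (K * n.+1%:R ^+ q.+2)%:E)%E.
Proof.
have [K0 K0_ge0 HK0] := accept_growth q.+2.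
pose bq := beta * q.+2%:R.
have bq1 : 1 <= bq by rewrite -[leLHS]mulr1 ler_pM// ler1n.
pose K1 := 2 `^ bq - 1 : R.
have K1_ge0 : 0 <= K1 by rewrite subr_ge0 (le_trans _ (le1r_powR _ bq1))// ler1n.
pose K2 := K1 ^+ q.+2 * K0.
have K2_ge0 : 0 <= K2 by rewrite mulr_ge0// exprn_ge0.
exists (1 + K2); first by rewrite addr_ge0.
pose v (m : nat) : R := m.+1%:R `^ beta.
have v_ge0 m : 0 <= v m by exact: powR_ge0.
pose b n w := accept n w * (num n w).+1%:R `^ (beta - 1).
have b_ge0 n w : 0 <= b n w by rewrite mulr_ge0 ?powR_ge0// ltW// accept_gt0.
have mv n : measurable_fun setT (fun w => v (num n w) ^+ q.+2).
{ exact: (measurable_num n (fun m => v m ^+ q.+2)). }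
have mb n : measurable_fun setT (fun w => b n w ^+ q.+2).
{ apply: measurable_funX; apply: measurable_funM; first exact: measurable_accept.
  exact: (measurable_num n (fun m => m.+1%:R `^ (beta - 1))). }
have step n : (mean P (fun w => v (num n.+1 w) ^+ q.+2)%R <=
  (1 + n.+1%:R^-1)%:E * mean P (fun w => v (num n w) ^+ q.+2)%R + (K2 * n.+1%:R ^+ q.+1)%:E)%E.
{ have -> : mean P (fun w => v (num n.+1 w) ^+ q.+2) =
    mean P (fun w => if thr r (e^~ w) n < e n w then v (num n w).+1 ^+ q.+2 else v (num n w) ^+ q.+2).
  { by apply: eq_mean => w; rewrite numS; case: ifP. }
  rewrite (@mean_step n (fun w => v (num n w).+1 ^+ q.+2) (fun w => v (num n w) ^+ q.+2)); last first.
  { by move=> w; rewrite exprn_ge0. }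
  { by move=> w; rewrite exprn_ge0. }
  { exact: (measurable_F_num (fun m => v m ^+ q.+2) (leqnn n)). }
  { exact: (measurable_F_num (fun m => v m.+1 ^+ q.+2) (leqnn n)). }
  have n0 : 0 < n.+1%:R :> R by rewrite ltr0n.
  have i0 : 0 <= 1 + n.+1%:R^-1 :> R by rewrite addr_ge0// invr_ge0.
  have pw w : accept n w * v (num n w).+1 ^+ q.+2 + (1 - accept n w) * v (num n w) ^+ q.+2 <=
    (1 + n.+1%:R^-1) * v (num n w) ^+ q.+2 + K1 ^+ q.+2 * n.+1%:R ^+ q.+1 * b n w ^+ q.+2.
  { set m := num n w; have m0 : 0 < m.+1%:R :> R by rewrite ltr0n.
    have mi : 0 <= (m.+1%:R^-1 : R) <= 1 by rewrite invr_ge0 ler0n/= invf_le1// ler1n.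
    have vS : v m.+1 ^+ q.+2 <= v m ^+ q.+2 * (1 + K1 * m.+1%:R^-1).
    { have -> : v m.+1 = v m * (1 + m.+1%:R^-1) `^ beta.
      { rewrite /v -powRM ?addr_ge0 ?invr_ge0//; congr (_ `^ _).
        by rewrite mulrDr mulr1 divff ?gt_eqF// natr1. }
      rewrite exprMn ler_wpM2l ?exprn_ge0// -powR_mulrn ?powR_ge0// -powRrM.
      exact: powR_le_chord. }
    have vb : accept n w * (v m ^+ q.+2 * m.+1%:R^-1) = b n w * v m ^+ q.+1.
    { rewrite /b -/m exprS /v -{1}(mulr_powRB1 (ltW m0) (lt_le_trans ltr01 beta_ge1)).
      by field; rewrite gt_eqF. }
    have y := @young_step (K1 * b n w) (v m) n.+1%:R q.+1 (mulr_ge0 K1_ge0 (b_ge0 n w)) (v_ge0 m) n0.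
    have p0 := ltW (accept_gt0 n w).
    apply: (@le_trans _ _ (v m ^+ q.+2 + K1 * b n w * v m ^+ q.+1)).
    - have -> : K1 * b n w * v m ^+ q.+1 = K1 * (b n w * v m ^+ q.+1) by rewrite mulrA.
      rewrite -vb.
      have := ler_wpM2l p0 vS; set A := accept n w; set V := v m ^+ q.+2.
      set V' := v m.+1 ^+ q.+2; move: (m.+1%:R^-1) => z h.
      rewrite -subr_ge0.
      have -> : V + K1 * (A * (V * z)) - (A * V' + (1 - A) * V) =
        A * (V * (1 + K1 * z)) - A * V' by ring.
      by rewrite subr_ge0.
    - rewrite [(1 + _) * _]mulrDl mul1r -addrA lerD2l; apply: (le_trans y).
      by rewrite exprMn le_eqVlt; apply/orP; left; apply/eqP; field; rewrite gt_eqF. }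
  apply: (@le_trans _ _ (mean P (fun w => (1 + n.+1%:R^-1) * v (num n w) ^+ q.+2 +
    K1 ^+ q.+2 * n.+1%:R ^+ q.+1 * b n w ^+ q.+2)%R)).
  { apply: mean_le.
    - apply: measurable_funD; apply: measurable_funM.
      + exact: measurable_accept.
      + exact: (measurable_num n (fun m => v m.+1 ^+ q.+2)).
      + by apply: measurable_funB => //; exact: measurable_accept.
      + exact: mv.
    - by apply: measurable_funD; apply: measurable_funM.
    - move=> w; rewrite pw andbT addr_ge0// mulr_ge0 ?exprn_ge0//.
      + by rewrite ltW// accept_gt0.
      + by rewrite subr_ge0 accept_le1. }
  have k0 : 0 <= K1 ^+ q.+2 * n.+1%:R ^+ q.+1 by rewrite mulr_ge0 ?exprn_ge0.
  rewrite meanD; last first.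
  { by move=> w; rewrite mulr_ge0// exprn_ge0. }
  { by move=> w; rewrite mulr_ge0// exprn_ge0. }
  { exact: measurable_funM. }
  { exact: measurable_funM. }
  rewrite !meanZ//; try by move=> w; rewrite exprn_ge0.
  apply: leeD => //.
  apply: (le_trans (lee_wpmul2l _ (HK0 n))); first by rewrite lee_fin.
  by rewrite -EFinM lee_fin /K2 mulrAC. }
elim=> [|n IH].
{ rewrite (_ : (fun w => _) = (fun=> 1)); last first.
  { by apply/funext => w; rewrite /num /cnt/= powR1 expr1n. }
  by rewrite mean_cst lee_fin expr1n mulr1 lerDl. }
apply: (le_trans (step n)).
have n0 : 0 < n.+1%:R :> R by rewrite ltr0n.
apply: (@le_trans _ _ ((1 + n.+1%:R^-1)%:E * ((1 + K2) * n.+1%:R ^+ q.+2)%:E + (K2 * n.+1%:R ^+ q.+1)%:E)%E).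
{ by rewrite leeD2r// lee_wpmul2l// lee_fin addr_ge0// invr_ge0. }
rewrite -EFinM -EFinD lee_fin -[n.+2%:R]natr1; set x : R := n.+1%:R.
have x1 : 1 <= x by rewrite ler1n.
have e1 : (1 + x^-1) * ((1 + K2) * x ^+ q.+2) = (1 + K2) * (x + 1) * x ^+ q.+1.
{ by rewrite exprS; field; rewrite gt_eqF. }
have e2 := exprD1_ge q (le_trans ler01 x1).
rewrite e1.
have e3 : x ^+ q.+1 <= (x + 1) * x ^+ q.
{ by rewrite exprS ler_wpM2r ?exprn_ge0 ?(le_trans ler01 x1)// lerDl. }
have e4 : (1 + K2) * ((x + 1) * (x ^+ q.+1 + x ^+ q)) <= (1 + K2) * ((x + 1) * (x + 1) ^+ q.+1).
{ by rewrite ler_wpM2l ?addr_ge0// ler_wpM2l ?addr_ge0// (le_trans ler01 x1). }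
rewrite [(x + 1) ^+ q.+2]exprS; apply: le_trans e4.
have -> : (1 + K2) * ((x + 1) * (x ^+ q.+1 + x ^+ q)) =
  (1 + K2) * (x + 1) * x ^+ q.+1 + (1 + K2) * ((x + 1) * x ^+ q) by ring.
rewrite lerD2l ler_pM ?exprn_ge0 ?(le_trans ler01 x1)// lerDr//.
Qed.

Lemma powR_le1D (u a : R) (q : nat) : 0 <= u -> 0 <= a <= q%:R -> u `^ a <= 1 + u ^+ q.
Proof.
move=> u0 /andP[a0 aq]; have [u1|u1] := leP 1 u.
- by rewrite ler_wpDl// -powR_mulrn// ler_powR.
- apply: (@le_trans _ _ 1); last by rewrite lerDl exprn_ge0.
  apply: (@le_trans _ _ (1 `^ a)); last by rewrite powR1.
  by apply: ge0_ler_powR; rewrite ?nnegrE//; exact: ltW.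
Qed.

(** Interpolation from the integer powers: u^a <= 1 + u^(q+2) with u = (M + 1)^beta / (n + 1) and a
    = alpha s. *)
Lemma moment_real (s : R) : 0 <= s -> exists2 K : R, 0 <= K & forall n,
  (mean P (fun w => (num n w).+1%:R `^ s)%R <= (K * n.+1%:R `^ (alpha * s))%:E)%E.
Proof.
move=> s0; pose q := Num.bound (alpha * s).
have as0 : 0 <= alpha * s by rewrite mulr_ge0 ?(ltW alpha_gt0).
have asq : alpha * s <= q.+2%:R.
{ by apply: (le_trans (ltW (archi_boundP as0))); rewrite ler_nat leqW. }
have [K K0 HK] := moment_nat q.
exists (1 + K); first by rewrite addr_ge0.
move=> n; have n0 : 0 < n.+1%:R :> R by rewrite ltr0n.
set Q := n.+1%:R `^ (alpha * s); have Q0 : 0 <= Q by exact: powR_ge0.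
have D0 : 0 <= Q / n.+1%:R ^+ q.+2 by rewrite divr_ge0// exprn_ge0.
have pw w : (num n w).+1%:R `^ s <=
    Q + Q / n.+1%:R ^+ q.+2 * ((num n w).+1%:R `^ beta) ^+ q.+2.
{ set v := _ `^ beta; have v0 : 0 <= v by exact: powR_ge0.
  have u0 : 0 <= v / n.+1%:R by rewrite divr_ge0.
  have -> : (num n w).+1%:R `^ s = Q * (v / n.+1%:R) `^ (alpha * s).
  { rewrite /Q -powRM// mulrC divfK ?gt_eqF// /v -powRrM mulrA mulVf ?gt_eqF//.
    by rewrite mul1r. }
  have := @powR_le1D (v / n.+1%:R) (alpha * s) q.+2 u0; rewrite as0 asq => /(_ isT) h.
  apply: (le_trans (ler_wpM2l Q0 h)); rewrite expr_div_n.
  by rewrite le_eqVlt; apply/orP; left; apply/eqP; ring. }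
have mv : measurable_fun setT (fun w => ((num n w).+1%:R `^ beta) ^+ q.+2).
{ exact: (measurable_num n (fun m => (m.+1%:R `^ beta) ^+ q.+2)). }
apply: (@le_trans _ _ (mean P (fun w => Q + Q / n.+1%:R ^+ q.+2 * ((num n w).+1%:R `^ beta) ^+ q.+2)%R)).
{ apply: mean_le.
  - exact: (measurable_num n (fun m => m.+1%:R `^ s)).
  - by apply: measurable_funD => //; exact: measurable_funM.
  - by move=> w; rewrite powR_ge0/=. }
rewrite meanD//; last first.
{ by move=> w; rewrite mulr_ge0 ?exprn_ge0 ?powR_ge0. }
{ exact: measurable_funM. }
rewrite mean_cst meanZ//.
apply: (le_trans (leeD2l _ (lee_wpmul2l _ (HK n)))); first by rewrite lee_fin.
rewrite -EFinM -EFinD lee_fin.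
by rewrite le_eqVlt; apply/orP; left; apply/eqP; field; rewrite gt_eqF.
Qed.

Lemma cvg0_of_sqr (u f : nat -> R) :
  (forall n, u n ^+ 2 <= f n) -> f @ \oo --> (0 : R) -> u @ \oo --> (0 : R).
Proof.
move=> uf f0; apply/cvgr0Pnorm_le => eps eps0.
move/cvgr0Pnorm_le : f0 => /(_ _ (exprn_gt0 2 eps0))[N _ HN].
exists N => // n /= /HN /= h.
rewrite -(@ler_pXn2r _ 2) ?nnegrE ?(ltW eps0)// real_normK ?num_real//.
exact: le_trans (uf n) (le_trans (ler_norm _) h).
Qed.

Lemma accept_homo w m n : (m <= n)%N -> accept n w <= accept m w.
Proof.
move=> mn; rewrite ler_expR lerN2 !thr_walk.
by apply: walk_homo; [exact: waiting_ge0|exact: rate_ge0|exact: cnt_homo].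
Qed.

(** Acceptance probabilities decrease along a path, so their average over [m, n) is at most their
    average over [0, m). *)
Lemma sum_accept_gap w m n : (0 < m)%N -> (m <= n)%N ->
  \sum_(0 <= k < n) accept k w - \sum_(0 <= k < m) accept k w <=
  (n%:R / m%:R - 1) * \sum_(0 <= k < m) accept k w.
Proof.
move=> m0 mn; rewrite (big_cat_nat (leq0n m) mn)/= addrAC subrr add0r.
have m0' : 0 < m%:R :> R by rewrite ltr0n.
apply: (@le_trans _ _ ((n%:R - m%:R) * accept m w)).
- apply: (@le_trans _ _ (\sum_(m <= k < n) accept m w)).
  + by rewrite [leLHS]big_nat [leRHS]big_nat; apply: ler_sum => k /andP[mk _]; exact: accept_homo.
  + by rewrite big_const_nat iter_addr_0 -[leLHS]mulr_natl natrB.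
- have -> : n%:R / m%:R - 1 = (n%:R - m%:R) * m%:R^-1 :> R by field; rewrite gt_eqF.
  rewrite -mulrA ler_wpM2l ?subr_ge0 ?ler_nat// ler_pdivlMl//.
  have -> : m%:R * accept m w = \sum_(0 <= k < m) accept m w.
  { by rewrite big_const_nat iter_addr_0 subn0 mulr_natl. }
  by rewrite [leLHS]big_nat [leRHS]big_nat; apply: ler_sum => k /andP[_ km]; exact/accept_homo/ltnW.
Qed.

Lemma pow_ratio (c k : nat) : (0 < c)%N ->
  (k.+2 ^ c)%:R / (k.+1 ^ c)%:R - 1 <= 2 ^+ c / k.+1%:R :> R.
Proof.
move=> c0; have k0 : 0 < k.+1%:R :> R by rewrite ltr0n.
have ki : 0 <= (k.+1%:R^-1 : R) <= 1 by rewrite invr_ge0 ler0n/= invf_le1// ler1n.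
have c1 : 1 <= c%:R :> R by rewrite ler1n.
have := powR_le_chord ki c1; rewrite !powR_mulrn//.
rewrite !natrX -expr_div_n.
have -> : k.+2%:R / k.+1%:R = 1 + k.+1%:R^-1 :> R by rewrite -natr1 mulrDl divff ?gt_eqF// mul1r.
move=> h; rewrite lerBlDl; apply: (le_trans h); rewrite lerD2l ler_wpM2r ?invr_ge0//.
by rewrite gerBl.
Qed.

(** Second moments give convergence along n = (k+1)^c. Between grid points the count and its
    compensator both increase, and the compensator grows over a block by a fraction O(1/k) of its
    value. *)
Lemma compensated_small :
  {ae P, forall w, (fun n => compensated n w / n.+1%:R `^ alpha) @ \oo --> (0 : R)}.
Proof.
(* The normalized variance is O(n^(-alpha)), and c alpha >= 2 makes it O(k^(-2)) along n =
   (k+1)^c. *)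
pose c := (Num.bound (2 / alpha)).+1.
have ca : 2 <= c%:R * alpha.
{ rewrite -ler_pdivrMr//; apply: (le_trans (ltW (archi_boundP _))).
  - by rewrite divr_ge0 ?(ltW alpha_gt0).
  - by rewrite ler_nat. }
pose N k := (k.+1 ^ c)%N; pose D n : R := n.+1%:R `^ alpha.
have D0 n : 0 < D n by rewrite powR_gt0.
have DN k : k.+1%:R ^+ 2 <= D (N k).
{ apply: (@le_trans _ _ ((N k)%:R `^ alpha)); last first.
  { by apply: ge0_ler_powR; rewrite ?nnegrE ?(ltW alpha_gt0)// ler_nat. }
  rewrite natrX -powR_mulrn// -powR_mulrn// -powRrM.
  by apply: ler_powR => //; rewrite ler1n. }
have [K1 K1_ge0 HK1] := moment_real (@ler01 R).
have [K2 K2_ge0 HK2] := moment_real (ler0n R 2).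
pose g k w := compensated (N k) w / D (N k).
(* Besides the martingale, the count divided by k must vanish on the scale n^alpha, since it bounds
   the growth of the compensator over a block. *)
pose m k w := (num (N k) w).+1%:R / (D (N k) * k.+1%:R).
pose f k w := g k w ^+ 2 + m k w ^+ 2.
have mg k : measurable_fun setT (fun w => g k w ^+ 2).
{ apply: measurable_funX; apply: measurable_funM => //; exact: measurable_compensated. }
have mm k : measurable_fun setT (fun w => m k w ^+ 2).
{ exact: (measurable_num (N k) (fun j => (j.+1%:R / (D (N k) * k.+1%:R)) ^+ 2)). }
have fa k : (mean P (f k) <= ((K1 + K2) * (k.+1%:R ^+ 2)^-1)%:E)%E.
{ have k0 : 0 < k.+1%:R :> R by rewrite ltr0n.
  have d0 := D0 (N k).
  rewrite meanD//; last first.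
  { by move=> w; exact: sqr_ge0. }
  { by move=> w; exact: sqr_ge0. }
  rewrite mulrDl EFinD; apply: leeD.
  - have -> : mean P (fun w => g k w ^+ 2) = mean P (fun w => (D (N k) ^+ 2)^-1 * compensated (N k) w ^+ 2).
    { by apply: eq_mean => w; rewrite /g expr_div_n mulrC. }
    rewrite meanZ ?invr_ge0 ?sqr_ge0//; last first.
    { by move=> w; exact: sqr_ge0. }
    { by apply: measurable_funX; exact: measurable_compensated. }
    have le1 : (mean P (fun w => compensated (N k) w ^+ 2)%R <= (K1 * D (N k))%:E)%E.
    { apply: (le_trans (mean_compensated_sqr (N k))).
      have := HK1 (N k); rewrite mulr1 => h; apply: le_trans h.
      apply: mean_le; first exact: (measurable_num (N k) (fun j => j%:R)).
      - exact: (measurable_num (N k) (fun j => j.+1%:R `^ 1)).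
      - by move=> w; rewrite ler0n/= powRr1// ler_nat. }
    apply: (le_trans (lee_wpmul2l _ le1)); first by rewrite lee_fin invr_ge0 sqr_ge0.
    rewrite -EFinM lee_fin.
    have -> : (D (N k) ^+ 2)^-1 * (K1 * D (N k)) = K1 / D (N k) by field; rewrite gt_eqF.
    by rewrite ler_wpM2l// lef_pV2 ?posrE// exprn_gt0.
  - have -> : mean P (fun w => m k w ^+ 2) =
      mean P (fun w => (D (N k) ^+ 2 * k.+1%:R ^+ 2)^-1 * (num (N k) w).+1%:R `^ 2%:R).
    { by apply: eq_mean => w; rewrite /m powR_mulrn// expr_div_n exprMn mulrC. }
    rewrite meanZ; last first.
    { by rewrite invr_ge0 mulr_ge0 ?sqr_ge0. }
    { by move=> w; exact: powR_ge0. }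
    { exact: (measurable_num (N k) (fun j => j.+1%:R `^ 2%:R)). }
    apply: (le_trans (lee_wpmul2l _ (HK2 (N k)))).
    { by rewrite lee_fin invr_ge0 mulr_ge0 ?sqr_ge0. }
    rewrite -EFinM lee_fin powRrM -/(D (N k)) powR_mulrn ?(ltW d0)//.
    by rewrite le_eqVlt; apply/orP; left; apply/eqP; field; rewrite !gt_eqF. }
have mf k : measurable_fun setT (f k) by exact: measurable_funD.
have f_ge0 k w : 0 <= f k w by rewrite addr_ge0 ?sqr_ge0.
have cs : cvgn (series (fun k => (K1 + K2) * (k.+1%:R ^+ 2)^-1)).
{ exact/is_cvg_seriesZ/is_cvg_series_inv_sqr. }
have [_ [_ _ _]] := ae_summable mf f_ge0 fa cs.
apply: filterS => w /cvg_series_cvg_0 f0.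
have g0 : (fun k => g k w) @ \oo --> (0 : R).
{ by apply: cvg0_of_sqr f0 => k; rewrite lerDl sqr_ge0. }
have m0 : (fun k => m k w) @ \oo --> (0 : R).
{ by apply: cvg0_of_sqr f0 => k; rewrite lerDr sqr_ge0. }
have ng0 : (fun k => `|g k w|) @ \oo --> (0 : R) by rewrite -(normr0 R); exact: cvg_norm.
pose A : R := 2 ^+ c.
apply: (@cvg_blocks _ c _ (fun k => `|g k w| + A * `|g k.+1 w| + A * (m k w + `|g k w|))) => //.
- move=> k n /andP[kn nk]; rewrite subr0.
  have k0 : 0 < k.+1%:R :> R by rewrite ltr0n.
  have nk0 := D0 (N k).
  have dn : D (N k) <= D n.
  { by apply: ge0_ler_powR; rewrite ?nnegrE ?(ltW alpha_gt0)// ler_nat ltnS. }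
  have NS : (N k <= N k.+1)%N by exact: leq_trans kn nk.
  have N0 : (0 < N k)%N by rewrite expn_gt0.
  rewrite normrM (gtr0_norm (_ : 0 < (D n)^-1)) ?invr_gt0//.
  apply: (@le_trans _ _ (`|compensated n w| / D (N k))).
  { by rewrite ler_wpM2l// lef_pV2 ?posrE. }
  rewrite ler_pdivrMr//.
  pose S j := \sum_(0 <= i < j) accept i w.
  have SS i j : (i <= j)%N -> S i <= S j.
  { move=> ij; rewrite /S (big_cat_nat (leq0n i) ij)/= lerDl sumr_ge0// => l _.
    by rewrite ltW// accept_gt0. }
  have gap : S (N k.+1) - S (N k) <= A / k.+1%:R * ((num (N k) w).+1%:R + `|compensated (N k) w|).
  { apply: (le_trans (sum_accept_gap w N0 NS)).
    apply: ler_pM.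
    - by rewrite subr_ge0 ler_pdivlMr ?ltr0n// mul1r ler_nat.
    - by rewrite sumr_ge0// => l _; rewrite ltW// accept_gt0.
    - exact: pow_ratio.
    - have -> : \sum_(0 <= i < N k) accept i w = (num (N k) w)%:R - compensated (N k) w.
      { by rewrite /compensated opprB addrC subrK. }
      by rewrite lerD ?ler_nat// -normrN ler_norm. }
  have := @sandwich_dist R (num n w)%:R (num (N k) w)%:R (num (N k.+1) w)%:R (S n) (S (N k)) (S (N k.+1)) 0 _.
  rewrite !subr0 !ler_nat => /(_ _ _ _ _ _ gap) => h.
  apply: (le_trans (h _ _ _ _)); rewrite ?SS//; try exact: cnt_homo.
  rewrite -![_%:R - S _]/(compensated _ w).
  have e1 : `|compensated (N k) w| = `|g k w| * D (N k).
  { by rewrite /g normrM (gtr0_norm (_ : 0 < (D (N k))^-1)) ?invr_gt0// divfK// gt_eqF. }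
  have e2 : `|compensated (N k.+1) w| <= A * `|g k.+1 w| * D (N k).
  { have d1 := D0 (N k.+1).
    have -> : `|compensated (N k.+1) w| = `|g k.+1 w| * D (N k.+1).
    { by rewrite /g normrM (gtr0_norm (_ : 0 < (D (N k.+1))^-1)) ?invr_gt0// divfK// gt_eqF. }
    rewrite [A * _]mulrC -mulrA ler_wpM2l//.
    apply: (@le_trans _ _ ((A * (N k).+1%:R) `^ alpha)).
    - apply: ge0_ler_powR; rewrite ?nnegrE ?(ltW alpha_gt0)//.
      + by rewrite mulr_ge0// exprn_ge0.
      + rewrite /A -natrX -natrM ler_nat mulnS /N.
        rewrite -addn1 addnC leq_add ?expn_gt0// -expnMn leq_exp2r//.
        by rewrite mulnS -addn2 addnC leq_add2l mul2n -addnn leq_addr.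
    - rewrite powRM ?exprn_ge0// ler_wpM2r ?(ltW nk0)//.
      by apply: ler1_powR => //; rewrite exprn_ege1// ler1n. }
  have e3 : (num (N k) w).+1%:R / k.+1%:R = m k w * D (N k).
  { by rewrite /m; field; rewrite !gt_eqF. }
  have m_ge0 : 0 <= m k w by rewrite /m divr_ge0 ?mulr_ge0 ?(ltW nk0).
  have A0 : 0 <= A by rewrite exprn_ge0.
  have e4 : A / k.+1%:R * ((num (N k) w).+1%:R + `|compensated (N k) w|) <=
    A * (m k w + `|g k w|) * D (N k).
  { have -> : A / k.+1%:R * ((num (N k) w).+1%:R + `|compensated (N k) w|) =
      A * ((num (N k) w).+1%:R / k.+1%:R + `|compensated (N k) w| / k.+1%:R) by field; rewrite gt_eqF.
    rewrite e3 -[leRHS]mulrA; apply: (ler_wpM2l A0); rewrite mulrDl lerD2l -e1 (ler_pdivrMr _ _ k0).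
    by apply: ler_peMr; rewrite ?normr_ge0// ler1n. }
  rewrite [leRHS]mulrDl [X in _ <= X + _]mulrDl -e1.
  exact: (lerD (lerD (lexx _) e2) e4).
- rewrite -[X in _ --> X](_ : 0 + A * 0 + A * (0 + 0) = 0); last by rewrite !addr0 !mulr0 !addr0.
  apply: cvgD; first (apply: cvgD => //; apply: cvgM; first exact: cvg_cst).
  + by rewrite (cvg_shiftS (fun k => `|g k w|)).
  + by apply: cvgM; [exact: cvg_cst|exact: cvgD].
Qed.

(** The limit given by [path_growth_shift] when e^(Y_m) is asymptotic to e^(z + kappa) m^(1/alpha -
    1). *)
Definition limit_constant (z : R) : R := (alpha * expR (z + kappa r alpha)) `^ (- alpha).

Lemma growth_rate (z : nat -> R) (l : R) :
  (fun m => z m - drift (rate r) m) @ \oo --> l ->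
  (fun m => expR (z m) / m.+1%:R `^ (beta - 1)) @ \oo --> expR (l + kappa r alpha).
Proof.
move=> zl.
apply: cvg_trans (cvg_expR (cvgD zl (cvg_drift r_rank alpha_gt0 alpha_le1 rC))).
apply: near_eq_cvg; apply: nearW => m /=.
rewrite /powR pnatr_eq0/= -expRN -expRD; congr expR; rewrite /=.
rewrite -[LHS]/(z m - drift (rate r) m + (drift (rate r) m - (beta - 1) * ln m.+1%:R)).
by rewrite addrA subrK.
Qed.

Lemma num_limit : {ae P, forall w, cvgn (fun m => Y m w - drift (rate r) m) /\
  (fun n => (num n w)%:R / n%:R `^ alpha) @ \oo -->
    limit_constant (limn (fun m => Y m w - drift (rate r) m))}.
Proof.
have cY := is_cvg_centered_walk waiting_exp_iid waiting_ge0 (rate_ge0 r)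
  (@rate_out _ r) (ltW (rank_const_gt0 alpha_gt0 rC)) (rate_le r_rank alpha_gt0 alpha_le1 rC).
have unb := exp_iid_unbounded eD.
move: cY unb compensated_small; apply: filterS3 => w cw uw sw; split=> //.
apply: (@path_growth_shift _ (num^~ w) (Y^~ w)) => //.
- exact: expR_gt0.
- by move=> n; rewrite numS; case: ifP => _; [right|left].
- by move=> m; apply: walk_homo => //; [exact: waiting_ge0|exact: rate_ge0].
- apply/cvgnyPge => A; have [n [cn _]] := cnt_surj r uw A.
  by exists n => // k /= nk; rewrite -cn; exact: cnt_homo.
- exact: growth_rate.
- apply: cvg_trans sw; apply: near_eq_cvg; apply: nearW => n.
  rewrite /compensated; congr ((_ - _) / _); apply: eq_bigr => k _.
  by rewrite /accept thr_walk.
Qed.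

End hiring_dynamics.

(** * Reduction to exponential values *)

(** [s] is the supremum of the points where f is at most u; continuity at [s] excludes both strict
    inequalities. *)
Lemma continuous_level_set (R : realType) (f : R -> R) (u : R) :
  {homo f : x y / x <= y} -> continuous f ->
  (exists b, u < f b) -> (exists a, f a <= u) ->
  exists2 s, f s = u & forall x, (f x <= u) = (x <= s).
Proof.
move=> f_homo f_cont [b ub] [a au].
pose S := [set x | f x <= u]; have S0 : S !=set0 by exists a.
have Sub : has_ubound S.
{ exists b => x /= fxu; rewrite leNgt; apply/negP => /ltW/f_homo h.
  by have := le_lt_trans (le_trans h fxu) ub; rewrite ltxx. }
have Ssup : has_sup S by split.
pose s := sup S.
have fs : f s = u.
{ apply/eqP; rewrite eq_le !leNgt; apply/andP; split; apply/negP => h.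
  - have /(f_cont s) : nbhs (f s) [set y | u < y] by exact: lt_nbhsr.
    move=> [eps /= eps0 He]; have [x /= fxu sx] := sup_adherent eps0 Ssup.
    suff : u < f x by rewrite ltNge fxu.
    apply: He; rewrite /ball /= ger0_norm; first by rewrite ltrBlDr -ltrBlDl.
    by rewrite subr_ge0; exact: ub_le_sup.
  - have /(f_cont s) : nbhs (f s) [set y | y < u] by exact: lt_nbhsl.
    move=> [eps /= eps0 He]; have e2 : 0 < eps / 2 by rewrite divr_gt0.
    have /ltW : f (s + eps / 2) < u.
    { apply: He; rewrite /ball /= opprD addNKr normrN gtr0_norm//.
      by rewrite ltr_pdivrMr// ltr_pMr// ltr1n. }
    move=> /(ub_le_sup Sub); rewrite -/s; lra. }
exists s => // x; apply/idP/idP; first exact: ub_le_sup.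
by move=> /f_homo; rewrite fs.
Qed.

Section exponential_transform.
Context d (T : measurableType d) (R : realType) (P : probability T R).
Variable X : nat -> {RV P >-> R}.
Hypothesis X_iid : iid X.
Hypothesis X_continuous : continuous (cdf (X 0%N)).

Let F (x : R) : R := fine (cdf (X 0%N) x).

Let FE x : (F x)%:E = cdf (X 0%N) x.
Proof. by rewrite fineK// fin_num_measure. Qed.

Let F_homo : {homo F : x y / x <= y}.
Proof. by move=> x y xy; rewrite -lee_fin !FE; exact: cdf_nondecreasing. Qed.

Let F01 x : 0 <= F x <= 1.
Proof. by rewrite -!lee_fin FE cdf_ge0 cdf_le1. Qed.

Let F_cont : continuous F.
Proof. by move=> x; apply: fine_cvg; rewrite /= FE; exact: X_continuous. Qed.

Let measurable_F : measurable_fun setT F.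
Proof. by apply: measurableT_comp => //; exact: cdf_measurable. Qed.

(* The set where F <= 0 may be empty. *)
Let law_F (u : R) : 0 <= u < 1 -> P [set w | F (X 0%N w) <= u] = u%:E.
Proof.
move=> /andP[u0 u1]; have Fb : exists b, u < F b.
{ have := cvg_cdfy1 (X 0%N) => /fine_cvgP[_] /(cvgr_gt 1) /(_ _ u1) h.
  by have [b hb] := filter_ex h; exists b. }
have [Fa|Fa] := pselect (exists a, F a <= u).
- have [s Fs HF] := continuous_level_set F_homo F_cont Fb Fa.
  rewrite -Fs FE; congr (P _); apply/seteqP.
  by split=> w /=; rewrite in_itv/= -HF Fs.
- have u0' : u = 0.
  { apply/eqP; rewrite eq_le u0 andbT leNgt; apply/negP => u_gt0.
    have := cvg_cdfNy0 (X 0%N) => /fine_cvgP[_] /(cvgr_le 0) /(_ _ u_gt0) h.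
    by have [a ha] := filter_ex h; apply: Fa; exists a. }
  rewrite u0' (_ : [set w | _] = set0) ?measure0//.
  by apply/seteqP; split=> w //= h; apply: Fa; exists (X 0%N w); rewrite u0'.
Qed.

Let measurable_FX c : measurable [set w | F (X 0%N w) <= c].
Proof.
rewrite (_ : [set w | _] = (F \o X 0%N) @^-1` `]-oo, c]%classic); last first.
{ by apply/seteqP; split=> w /=; rewrite in_itv. }
by rewrite -[X in measurable X]setTI; apply: measurableT_comp.
Qed.

(** The event F >= 1 has probability at most 2^(-n) for each n by [law_F]. On it the logarithm in
    [phi] would take its default value. *)
Let F_lt1 : {ae P, forall w, F (X 0%N w) < 1}.
Proof.
pose N := [set w | 1 <= F (X 0%N w)].
have mN : measurable N.
{ rewrite (_ : N = (F \o X 0%N) @^-1` `[1, +oo[%classic); last first.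
  { by apply/seteqP; split=> w /=; rewrite in_itv/= andbT. }
  by rewrite -[X in measurable X]setTI; apply: measurableT_comp. }
exists N; split=> //; last by move=> w /= /negP; rewrite -leNgt.
rewrite -[LHS]fineK ?fin_num_measure//; congr (_%:E).
apply: (@eq0_le_expr _ _ 2^-1) => [||n].
- by rewrite fine_ge0.
- by rewrite invr_ge0 ler0n invf_lt1// ltr1n.
- pose q : R := 2^-1 ^+ n; rewrite -/q.
  have q0 : 0 < q by rewrite exprn_gt0 ?invr_gt0.
  have q1 : q <= 1 by rewrite exprn_ile1 ?invr_ge0// invf_le1// ler1n.
  have uq : 0 <= 1 - q < 1 by apply/andP; split; lra.
  rewrite -lee_fin fineK ?fin_num_measure//.
  apply: (@le_trans _ _ (P (~` [set w | F (X 0%N w) <= 1 - q]))).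
  + apply: le_measure; rewrite ?inE//; first exact: measurableC.
    by move=> w; rewrite /N /= => h; apply/negP; rewrite -ltNge; lra.
  + by rewrite probability_setC// law_F// -EFinB lee_fin; lra.
Qed.

Let phi (x : R) : R := - ln (1 - F x).

Let measurable_phi : measurable_fun setT phi.
Proof.
apply: measurable_funN; apply: measurableT_comp; first exact: measurable_ln.
by apply: measurable_funB.
Qed.

Let phi_ge0 x : 0 <= phi x.
Proof.
have /andP[h0 h1] := F01 x; rewrite oppr_ge0.
have : 1 - F x <= 1 by lra.
exact: ln_le0.
Qed.

Let phi_law (A : set R) : measurable A -> P [set w | A (phi (X 0%N w))] = nu A.
Proof.
move=> mA; have mphi : measurable_fun setT (fun w => phi (X 0%N w)).
{ exact: measurableT_comp. }
have [m1 m1E] := pushforward_measureP P mphi.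
have m1A B : m1 B = P [set w | B (phi (X 0%N w))] by rewrite m1E.
have m1T : m1 setT = 1%E := eq_trans (m1A setT) (probability_setT P).
rewrite -m1A; apply: (@measure_rays_unique _ m1 nu) => //.
- by apply: (@le_lt_trans _ _ 1%E); rewrite ?ltry// le_eqVlt m1T eqxx.
- by apply: (eq_trans m1T); apply/esym; exact: (@probability_setT _ _ _ nu).
- move=> t; rewrite m1A [RHS]nu_ray; have [t0|t0] := ltP t 0.
  + rewrite oppr0 expR0 (_ : [set w | _] = setT) ?probability_setT//.
    by apply/seteqP; split=> w //= _; rewrite in_itv/= andbT (lt_le_trans t0).
  + have e1 : expR (- t) <= 1 by rewrite -[leRHS]expR0 ler_expR oppr_le0.
    transitivity (P (~` [set w | F (X 0%N w) <= 1 - expR (- t)])); last first.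
    { rewrite probability_setC// law_F; last by have := expR_gt0 (- t); lra.
      by rewrite -EFinB; congr (_%:E); ring. }
    apply: ae_eq_measure.
    * by rewrite -[X in measurable X]setTI; exact: mphi.
    * exact: measurableC.
    * apply: filterS F_lt1 => w F1 /=; rewrite in_itv/= andbT /phi ltrNr.
      have F1' : 0 < 1 - F (X 0%N w) by lra.
      rewrite -[X in ln _ < X](expRK (- t)) ltr_ln ?posrE ?expR_gt0//.
      split=> [h|/negP]; first by apply/negP; rewrite -ltNge; lra.
      by rewrite -ltNge; lra.
Qed.

Let X_law i (A : set R) : measurable A -> P (X i @^-1` A) = P (X 0%N @^-1` A).
Proof. exact: X_iid.2. Qed.

Let measurable_phi_preimage (A : set R) : measurable A -> measurable (phi @^-1` A).
Proof. by move=> mA; rewrite -[X in measurable X]setTI; exact: measurable_phi. Qed.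

Definition exponentialized i (w : T) : R := phi (X i w).

Lemma exponentialized_exp_iid : exp_iid P predT exponentialized.
Proof.
split=> [i|J A uJ _ mA]; first exact: measurableT_comp.
have := X_iid.1 [fset i in J]%fset (fun i => phi @^-1` A i).
rewrite (_ : [set` [fset i in J]%fset] = [set` J]); last first.
{ by apply/seteqP; split=> i /=; rewrite in_fset. }
move=> h; apply: (eq_trans (h _)); first by move=> i _; exact: measurable_phi_preimage.
rewrite (perm_big J)/=; last by apply: uniq_perm => [||i]; rewrite ?fset_uniq// in_fset.
apply: eq_bigr => i _; rewrite X_law; last exact: measurable_phi_preimage.
exact: phi_law.
Qed.

Let F_lt1_all : {ae P, forall w, forall i, F (X i w) < 1}.
Proof.
have mN : measurable [set x | 1 <= F x].
{ rewrite (_ : [set x | _] = F @^-1` `[1, +oo[%classic); last first.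
  { by apply/seteqP; split=> w /=; rewrite in_itv/= andbT. }
  by rewrite -[X in measurable X]setTI; exact: measurable_F. }
apply: ae_foralln => i; exists (X i @^-1` [set x | 1 <= F x]); split.
- by rewrite -[X in measurable X]setTI; exact: measurable_funP.
- apply: (eq_trans (X_law i mN)); have [N [mN' N0 h]] := F_lt1; apply/eqP.
  rewrite eq_le measure_ge0 andbT -N0; apply: le_measure; rewrite ?inE//.
  + by rewrite -[X in measurable X]setTI; exact: measurable_funP.
  + by move=> w /= h1; apply: h => /=; rewrite ltNge h1.
- by move=> w /= /negP; rewrite -leNgt.
Qed.

(** F is only nondecreasing and might identify different values. Almost surely the transformed
    values are pairwise distinct, and then both sequences are ordered alike. *)
Lemma num_accepted_exponentialized (r : nat -> nat) : rank_sequence r ->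
  {ae P, forall w, forall n, num_accepted r (fun i => X i w) n = cnt r (exponentialized^~ w) n}.
Proof.
move=> r_rank; move: F_lt1_all (exp_iid_gt0 exponentialized_exp_iid)
  (exp_iid_injective exponentialized_exp_iid).
apply: filterS3 => w F1 gt0 inj n.
rewrite -(num_accepted_cnt r_rank gt0 inj); apply: num_accepted_order => // i j _ _.
have lt1 k : 0 < 1 - F (X k w) by rewrite subr_gt0.
have -> : (exponentialized i w < exponentialized j w) = (F (X i w) < F (X j w)).
{ by rewrite ltrN2 ltr_ln ?posrE// ltrD2l ltrN2. }
apply/idP/idP => h.
- rewrite lt_neqAle F_homo ?ltW// andbT; apply/eqP => FE'.
  suff ij : i = j by move: h; rewrite ij ltxx.
  by apply: inj; rewrite /exponentialized /phi FE'.
- by rewrite ltNge; apply/negP => /F_homo; rewrite leNgt h.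
Qed.

End exponential_transform.

(** The count depends only on the pattern [c] of pairwise comparisons of the first [n] values, and
    each of the finitely many patterns is a measurable event. *)
Lemma measurable_num_accepted d (T : measurableType d) (R : realType)
    (r : nat -> nat) (x : nat -> T -> R) (n : nat) (A : set nat) : rank_sequence r ->
  (forall i, measurable_fun setT (x i)) ->
  measurable [set w | A (num_accepted r (x^~ w) n)].
Proof.
move=> r_rank mx.
pose I : finType := {ffun ('I_n * 'I_n) -> bool}.
pose D (c : I) := \bigcap_(p in [set: 'I_n * 'I_n]) [set w | (x p.1 w < x p.2 w) = c p].
have mD c : measurable (D c).
{ apply: fin_bigcap_measurable => [|p _]; first exact: finite_finset.
  have m1 := measurable_set_lt (mx p.1) (mx p.2); case: (c p) => //.
  rewrite (_ : [set w | _] = ~` [set w | x p.1 w < x p.2 w]); first exact: measurableC.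
  by apply/seteqP; split=> w /=; [move=> ->|move/negP/negbTE]. }
rewrite (_ : [set w | _] = \bigcup_(c in [set c | exists2 w, D c w & A (num_accepted r (x^~ w) n)]) D c).
{ by apply: fin_bigcup_measurable => //; exact: finite_finset. }
apply/seteqP; split=> w /=.
- move=> Aw; pose c : I := [ffun p : 'I_n * 'I_n => x p.1 w < x p.2 w].
  have Dw : D c w by move=> p _ /=; rewrite ffunE.
  by exists c => //; exists w.
- move=> [c /= [w' Dw' Aw'] Dw]; rewrite (@num_accepted_order _ _ _ (x^~ w'))// => i j i_n j_n.
  have := Dw (Ordinal i_n, Ordinal j_n) Logic.I; have := Dw' (Ordinal i_n, Ordinal j_n) Logic.I.
  by move=> /= -> ->.
Qed.

(** * Convergence of means *)

Lemma minr_dist_le (R : realDomainType) (a b A : R) : `|Num.min a A - Num.min b A| <= `|a - b|.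
Proof.
have h1 := ler_norm (a - b); have h2 : b - a <= `|a - b| by rewrite distrC ler_norm.
have h3 := normr_ge0 (a - b); rewrite ler_norml; move: `|a - b| h1 h2 h3 => N h1 h2 h3.
by case: (leP a A) => aA; case: (leP b A) => bA; apply/andP; split; lra.
Qed.

Lemma minr_gap (R : realFieldType) (x A : R) : 0 <= x -> 0 < A ->
  x <= Num.min x A + A^-1 * x ^+ 2.
Proof.
move=> x0 A0; case: (leP x A) => [_|Ax]; first by rewrite lerDl mulr_ge0 ?invr_ge0 ?sqr_ge0// ltW.
apply: (@le_trans _ _ (A^-1 * x ^+ 2)); last by rewrite lerDr ltW.
by rewrite ler_pdivlMl// expr2 ler_wpM2r// ltW.
Qed.

Section mean_convergence.
Context d (T : measurableType d) (R : realType) (P : probability T R).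
Implicit Types f g : T -> R.

Lemma mean_dominated (f : nat -> T -> R) g (B : T -> \bar R) :
  (forall n, measurable_fun setT (f n)) -> measurable_fun setT g ->
  (forall n w, 0 <= f n w) ->
  measurable_fun setT B -> (forall n w, ((f n w)%:E <= B w)%E) -> (\int[P]_w B w < +oo)%E ->
  {ae P, forall w, (fun n => f n w) @ \oo --> g w} ->
  (fun n => mean P (f n)) @ \oo --> mean P g.
Proof.
move=> mf mg f0 mB fB iB fg.
have B0 w : (0 <= B w)%E by apply: le_trans (fB 0%N w); rewrite lee_fin.
have [] := @dominated_convergence _ _ _ P setT measurableT (fun n w => (f n w)%:E)
  (fun w => (g w)%:E) B => //.
- by move=> n; apply/measurable_EFinP.
- exact/measurable_EFinP.
- by apply: filterS fg => w h _; apply: cvg_EFin => //; exact: nearW.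
- apply/integrableP; split=> //; under eq_integral do rewrite gee0_abs//; exact: iB.
- by apply: aeW => w n _; rewrite gee0_abs// lee_fin.
Qed.

Lemma mean_fin_num f : (forall w, 0 <= f w) -> (mean P f < +oo)%E -> mean P f \is a fin_num.
Proof. by move=> f0 ?; rewrite ge0_fin_numE// mean_ge0. Qed.

Lemma mean_sqr_le f (K : R) : measurable_fun setT f -> (forall w, 0 <= f w) ->
  (mean P (fun w => f w ^+ 2)%R <= K%:E)%E -> (mean P f < +oo)%E.
Proof.
move=> mf f0 fK; apply: (@le_lt_trans _ _ (1 + K)%:E); last exact: ltry.
apply: (@le_trans _ _ (mean P (fun w => 1 + f w ^+ 2)%R)).
- apply: mean_le => //; first by apply: measurable_funD => //; exact: measurable_funX.
  by move=> w; rewrite f0/=; have := sqr_ge0 (f w - 1); have := f0 w; nra.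
- rewrite meanD//; last by move=> w; exact: sqr_ge0.
  + by rewrite mean_cst EFinD leeD2l.
  + exact: measurable_funX.
Qed.

Lemma mean_minr_gap f (K A : R) : measurable_fun setT f -> (forall w, 0 <= f w) -> 0 < A ->
  (mean P (fun w => f w ^+ 2)%R <= K%:E)%E ->
  (mean P (fun w => Num.min (f w) A)%R <= mean P f <=
   mean P (fun w => Num.min (f w) A)%R + (A^-1 * K)%:E)%E.
Proof.
move=> mf f0 A0 fK.
have mm : measurable_fun setT (fun w => Num.min (f w) A) by exact: measurable_minr.
have m0 w : 0 <= Num.min (f w) A by rewrite le_min f0 ltW.
have A1 : 0 <= A^-1 by rewrite invr_ge0 ltW.
have m2 : measurable_fun setT (fun w => f w ^+ 2) by exact: measurable_funX.
apply/andP; split; first by apply: mean_le => // w; rewrite m0 ge_min lexx.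
apply: (@le_trans _ _ (mean P (fun w => Num.min (f w) A + A^-1 * f w ^+ 2)%R)).
- apply: mean_le => //; first by apply: measurable_funD => //; exact: measurable_funM.
  by move=> w; rewrite f0/= minr_gap.
- rewrite meanD//; last first.
  { by move=> w; rewrite mulr_ge0 ?sqr_ge0. }
  { exact: measurable_funM. }
  rewrite meanZ//; last by move=> w; exact: sqr_ge0.
  by rewrite leeD2l// EFinM lee_wpmul2l.
Qed.

Lemma mean_sqr_limit (f : nat -> T -> R) g (K : R) :
  (forall n, measurable_fun setT (f n)) -> measurable_fun setT g ->
  (forall n, (mean P (fun w => f n w ^+ 2)%R <= K%:E)%E) ->
  {ae P, forall w, (fun n => f n w) @ \oo --> g w} ->
  (mean P (fun w => g w ^+ 2)%R <= K%:E)%E.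
Proof.
move=> mf mg fK fg; pose u n w := ((f n w) ^+ 2)%:E.
have mu n : measurable_fun setT (u n) by apply/measurable_EFinP; exact: measurable_funX.
have u0 n w : (0 <= u n w)%E by rewrite lee_fin sqr_ge0.
have := fatou P measurableT mu (fun n w _ => u0 n w).
have -> : (\int[P]_w limn_einf (u^~ w) = mean P (fun w => g w ^+ 2)%R)%E.
{ apply: ge0_ae_eq_integral => //.
  (* The limit inferior inherits measurability from the limit superior of the opposites. *)
  - rewrite (_ : (fun w => _) = (fun w => - limn_esup (fun n => - u n w))%E); last first.
    { by apply/funext => w; rewrite limn_esupN oppeK. }
    apply: measurableT_comp => //; apply: measurable_fun_limn_esup => n.
    exact: measurableT_comp.
  - by apply/measurable_EFinP; exact: measurable_funX.
  - move=> w _; rewrite limn_einf_lim; apply: lime_ge; first exact: is_cvg_einfs.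
    by apply: nearW => n; apply: le_ereal_inf_tmp => _ [m _ <-].
  - by move=> w _; rewrite lee_fin sqr_ge0.
  - apply: filterS fg => w h _; apply: (@cvg_limn_einf_sup _ (u^~ w) _ _).1.
    apply: cvg_EFin; first exact: nearW.
    exact: (cvgM h h). }
rewrite limn_einf_lim => h; apply: (le_trans h); apply: lime_le; first exact: is_cvg_einfs.
by apply: nearW => n; apply: le_trans (fK n); apply: ereal_inf_lbound; exists n => /=.
Qed.

(** Bounded second moments give uniform integrability: truncation at level A costs at most K / A in
    every mean, and dominated convergence handles the truncated functions. Fatou's lemma extends the
    bound to g. *)
Lemma cvg_mean_sqr_bounded (f : nat -> T -> R) g (K : R) :
  (forall n, measurable_fun setT (f n)) -> measurable_fun setT g ->
  (forall n w, 0 <= f n w) -> (forall w, 0 <= g w) ->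
  (forall n, (mean P (fun w => f n w ^+ 2)%R <= K%:E)%E) ->
  {ae P, forall w, (fun n => f n w) @ \oo --> g w} ->
  mean P g \is a fin_num /\ (fun n => mean P (f n)) @ \oo --> mean P g.
Proof.
move=> mf mg f0 g0 fK fg.
have gK := mean_sqr_limit mf mg fK fg.
have K0 : 0 <= K by rewrite -lee_fin (le_trans _ gK)// mean_ge0// => w; exact: sqr_ge0.
have ff n := mean_fin_num (f0 n) (mean_sqr_le (mf n) (f0 n) (fK n)).
have gf := mean_fin_num g0 (mean_sqr_le mg g0 gK).
split=> //; rewrite -(fineK gf); apply: cvg_EFin; first exact: nearW.
apply/cvgrPdist_le => /= eps eps0.
(* Each truncation error is then at most eps / 2; the other half of eps goes to the truncated
   means. *)
pose A := 2 * (K + 1) / eps; have A0 : 0 < A by rewrite divr_gt0// mulr_gt0// ltr_wpDl.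
have AK : A^-1 * K <= eps / 2.
{ rewrite /A invf_div mulrAC ler_pdivrMr ?mulr_gt0 ?ltr_wpDl//.
  have -> : eps / 2 * (2 * (K + 1)) = eps * (K + 1) by field.
  by rewrite ler_wpM2l// ?(ltW eps0)// lerDl. }
pose m n w := Num.min (f n w) A; pose mg' w := Num.min (g w) A.
have mc : (fun n => mean P (m n)) @ \oo --> mean P mg'.
{ apply: (@mean_dominated _ _ (cst A%:E)) => //.
  - by move=> n; exact: measurable_minr.
  - exact: measurable_minr.
  - by move=> n w; rewrite le_min f0 ltW.
  - by move=> n w; rewrite lee_fin ge_min lexx orbT.
  - by rewrite integral_cst//= probability_setT mule1 ltry.
  - apply: filterS fg => w /cvgrPdist_le h; apply/cvgrPdist_le => /= e e0.
    by near=> n; apply: le_trans (minr_dist_le _ _ _) _; near: n; exact: h. }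
have gapg := mean_minr_gap mg g0 A0 gK.
have gapf n := mean_minr_gap (mf n) (f0 n) A0 (fK n).
have fin_m n : mean P (m n) \is a fin_num.
{ apply: mean_fin_num => [w|]; first by rewrite le_min f0 ltW.
  have /andP[h _] := gapf n; apply: le_lt_trans h _; rewrite ltey_eq; exact/orP/or_introl. }
have fin_g : mean P mg' \is a fin_num.
{ apply: mean_fin_num => [w|]; first by rewrite le_min g0 ltW.
  have /andP[h _] := gapg; apply: le_lt_trans h _; rewrite ltey_eq; exact/orP/or_introl. }
have e2 : 0 < eps / 2 by rewrite divr_gt0.
move: mc; rewrite -(fineK fin_g) => /fine_cvg/cvgrPdist_le/(_ _ e2).
apply: filterS => n /=.
move: (gapf n) gapg; rewrite -/(m n) -/mg' -(fineK (ff n)) -(fineK gf).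
rewrite -[mean P (m n)](fineK (fin_m n)) -[mean P mg'](fineK fin_g) -!EFinD !lee_fin.
rewrite [fine (_)%:E]/= !ler_distl => /andP[h1 h2] /andP[h3 h4] /andP[h5 h6].
by rewrite /=; apply/andP; split; lra.
Unshelve. all: by end_near.
Qed.

End mean_convergence.

(** * The auxiliary probability space *)

Section product_extension.
Context d (T : measurableType d) (R : realType) (P : probability T R).
Local Notation PP := ((P \x P)%E : probability (T * T)%type R).

Lemma product_probabilityE (A B : set T) : measurable A -> measurable B ->
  PP (A `*` B) = (P A * P B)%E.
Proof. exact: product_measure1E. Qed.

Lemma extends_probability_fst : extends_probability P PP fst.
Proof.
split=> [|A mA]; first exact: measurable_fst.
rewrite (_ : fst @^-1` A = A `*` setT); last first.
{ by apply/seteqP; split=> z //=; case. }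
by rewrite product_probabilityE// probability_setT mule1.
Qed.

Lemma ae_fst (Q : T -> Prop) : {ae P, forall w, Q w} -> {ae PP, forall z, Q z.1}.
Proof.
move=> [N [mN N0 QN]]; exists (fst @^-1` N); split.
- by rewrite -[X in measurable X]setTI; apply: measurable_fst.
- by rewrite (extends_probability_fst.2 _ mN).
- by move=> z /= h; apply: QN.
Qed.

(* The factors indexed outside D are taken from an independent copy. *)
Definition complete_family (D : pred nat) (U V : nat -> T -> R) k (z : T * T) : R :=
  if D k then U k z.1 else V k z.2.

Lemma complete_family_exp_iid (D : pred nat) (U V : nat -> T -> R) :
  exp_iid P D U -> exp_iid P predT V -> exp_iid PP predT (complete_family D U V).
Proof.
move=> [mU UD] [mV VD]; split=> [k|J A uJ _ mA].
- rewrite /complete_family; case: (D k).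
  + exact: measurableT_comp.
  + exact: measurableT_comp.
- rewrite (_ : \bigcap_(i in _) _ =
    (\bigcap_(i in [set` seq.filter D J]) (U i @^-1` A i)) `*`
    (\bigcap_(i in [set` seq.filter (predC D) J]) (V i @^-1` A i))); last first.
  { apply/seteqP; split=> z /=.
    - move=> h; split=> i /=; rewrite mem_filter/= => /andP[Di /h];
        by rewrite /complete_family /= ?Di ?(negbTE Di).
    - move=> [h1 h2] i /= iJ; rewrite /complete_family /=; case: ifP => Di.
      + by apply: (h1 i); rewrite /= mem_filter Di.
      + by apply: (h2 i); rewrite /= mem_filter /= Di. }
  rewrite product_probabilityE; try exact: measurable_bigcap_preimage.
  rewrite UD ?filter_uniq ?filter_all// VD ?filter_uniq//; last by apply/allP.
  by rewrite !big_filter [RHS](bigID D).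
Qed.

Lemma exp_iid_RV d' (T' : measurableType d') (P' : probability T' R) (E : nat -> T' -> R) :
  exp_iid P' predT E -> exists E' : nat -> {RV P' >-> R},
    [/\ forall k, E' k = E k :> (T' -> R), independent_seq E' &
        forall k, has_exponential_law 1 (E' k)].
Proof.
move=> [mE ED]; pose E' k : {RV P' >-> R} := mfun_Sub (mem_set (mE k)).
have law k A : measurable A -> P' (E k @^-1` A) = nu A.
{ move=> mA; have := ED [:: k] (fun=> A) erefl erefl (fun=> mA).
  rewrite big_seq1 => <-; congr (P' _); apply/seteqP; split=> w /=.
  - by move=> h j /=; rewrite inE => /eqP ->.
  - by move=> /(_ k); apply; rewrite /= inE. }
exists E'; split; [by []| |by move=> k A mA; exact: law]; move=> J A mA.
pose A' i := if i \in J then A i else setT.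
have mA' i : measurable (A' i) by rewrite /A'; case: ifP => // /mA.
transitivity (\prod_(i <- J) nu (A' i))%E.
- rewrite -ED ?fset_uniq//; last exact/allP.
  congr (P' _); apply: eq_bigcapr => i /= iJ; by rewrite /A' iJ.
- rewrite [LHS]big_seq [RHS]big_seq; apply: eq_bigr => i iJ.
  by rewrite /A' iJ; apply/esym; apply: law; exact: mA.
Qed.

End product_extension.

(** The coordinates drawn from the independent copy carry delta = 0, so Z depends on the original
    space only. *)
Lemma Z_series_walk d (T : measurableType d) (R : realType) (r : nat -> nat)
    (U V : nat -> T -> R) (z : T * T) :
  Z_series r (fun k => complete_family (fun k => stays r k.+1) U V k z) =
  (fun m => walk U (rate r) m z.1 - drift (rate r) m).
Proof.
apply/funext => m; rewrite /Z_series /series /= /walk /drift -sumrB.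
apply: eq_bigr => k _; rewrite /rate /complete_family.
by have [h|h] := boolP (stays r k.+1); [ring|rewrite /delta -[_ == _]/(stays r k.+1) (negbTE h); ring].
Qed.

(** The exponent is -alpha (ln alpha + z + kappa), where ln alpha cancels against its opposite in
    [kappa]. *)
Lemma limit_constantE (R : realType) (r : nat -> nat) (alpha z : R) : 0 < alpha ->
  limit_constant r alpha z =
  expR ((alpha - 1) * euler_gamma R - alpha * limn (rho_series r alpha) - alpha)
    * expR (- (alpha * z)).
Proof.
move=> a0; have e0 := expR_gt0 (z + kappa r alpha).
rewrite /limit_constant /powR gt_eqF ?mulr_gt0// lnM ?posrE// expRK -expRD.
by congr expR; rewrite /kappa; field; rewrite gt_eqF.
Qed.

(** * Moments of the limit *)

Lemma powR_div (R : realType) (a b t : R) : 0 <= a -> 0 <= b -> (a / b) `^ t = a `^ t / b `^ t.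
Proof. by move=> a0 b0; rewrite powRM ?invr_ge0// -{1}(powR_inv1 b0) -powRrM mulN1r powRN. Qed.

Section limit_moments.
Context {R : realType} (r : nat -> nat) (r_rank : rank_sequence r).
Variables (alpha C : R).
Hypothesis alpha_gt0 : 0 < alpha.
Hypothesis alpha_le1 : alpha <= 1.
Hypothesis rC : forall m, `|(r m)%:R - alpha * m%:R| <= C.
Context d (T : measurableType d) (P : probability T R) (e : nat -> T -> R).
Hypothesis eD : exp_iid P predT e.
Local Notation beta := (alpha^-1).
Local Notation Y := (walk (waiting r e) (rate r)).
Local Notation centered := (fun w m => Y m w - drift (rate r) m).

Definition scaled n (w : T) : R := (num r e n w)%:R / n%:R `^ alpha.
(** Taking a limit superior makes W a measurable function on the whole space; almost surely it is
    the limit. *)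
Definition scaled_limit (w : T) : R := fine (limn_esup (fun n => (scaled n w)%:E)).

Lemma measurable_scaled n : measurable_fun setT (scaled n).
Proof. exact: (measurable_num r eD n (fun m => m%:R / n%:R `^ alpha)). Qed.

Lemma measurable_scaled_limit : measurable_fun setT scaled_limit.
Proof.
apply: measurableT_comp => //; apply: measurable_fun_limn_esup => n.
by apply/measurable_EFinP; exact: measurable_scaled.
Qed.

Lemma limit_constant_gt0 z : 0 < limit_constant r alpha z.
Proof. by rewrite powR_gt0// mulr_gt0// expR_gt0. Qed.

Lemma scaled_limitP : {ae P, forall w, [/\ cvgn (centered w),
  scaled_limit w = limit_constant r alpha (limn (centered w)) &
  (fun n => scaled n w) @ \oo --> scaled_limit w]}.
Proof.
have := num_limit r_rank alpha_gt0 alpha_le1 rC eD; apply: filterS => w [cw nw].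
have h : scaled_limit w = limit_constant r alpha (limn (centered w)).
{ have ce : (fun n => (scaled n w)%:E) @ \oo --> (limit_constant r alpha (limn (centered w)))%:E.
  { by apply: cvg_EFin => //; exact: nearW. }
  by rewrite /scaled_limit (cvg_limn_einf_sup ce).2. }
by split=> //; rewrite h.
Qed.

(** Uniform integrability of the s-th powers comes from the moments of order 2s. The shift skips
    index 0, where the normalization degenerates. *)
Lemma cvg_mean_scaled (s : R) : 0 <= s ->
  mean P (fun w => scaled_limit w `^ s) \is a fin_num /\
  (fun n => mean P (fun w => scaled n w `^ s)) @ \oo --> mean P (fun w => scaled_limit w `^ s).
Proof.
move=> s0; rewrite -(cvg_shiftS (fun n => mean P (fun w => scaled n w `^ s))).
have s2 : 0 <= s * 2 by rewrite mulr_ge0.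
have [K K0 HK] := moment_real r_rank alpha_gt0 alpha_le1 rC eD s2.
pose t := alpha * (s * 2); have t0 : 0 <= t by rewrite mulr_ge0// ltW.
apply: (@cvg_mean_sqr_bounded _ _ _ _ _ _ (2 `^ t * K)).
- by move=> n; exact: (measurableT_comp (measurable_powR s) (measurable_scaled n.+1)).
- exact: (measurableT_comp (measurable_powR s) measurable_scaled_limit).
- by move=> n w; exact: powR_ge0.
- by move=> w; exact: powR_ge0.
- move=> n; have n0 : 0 < n.+1%:R :> R by rewrite ltr0n.
  have d0 : 0 < n.+1%:R `^ t by exact: powR_gt0.
  have Nt : n.+2%:R `^ t <= 2 `^ t * n.+1%:R `^ t :> R.
  { rewrite -powRM//; have n1 : 1 <= n.+1%:R :> R by rewrite ler1n.
    rewrite -[n.+2%:R]natr1; apply: (ge0_ler_powR t0); rewrite ?nnegrE ?mulr_ge0 ?addr_ge0//; lra. }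
  apply: (@le_trans _ _ (mean P (fun w => (n.+1%:R `^ t)^-1 * (num r e n.+1 w).+1%:R `^ (s * 2))%R)).
  + apply: mean_le.
    * by apply: measurable_funX; exact: (measurableT_comp (measurable_powR s) (measurable_scaled n.+1)).
    * by apply: measurable_funM => //; exact: (measurable_num r eD n.+1 (fun m => m.+1%:R `^ (s * 2))).
    * move=> w; rewrite sqr_ge0/=.
      have -> : (scaled n.+1 w `^ s) ^+ 2 = (n.+1%:R `^ t)^-1 * (num r e n.+1 w)%:R `^ (s * 2).
      { rewrite -powR_mulrn ?powR_ge0// -powRrM /scaled powR_div ?powR_ge0//.
        by rewrite mulrC -powRrM. }
      by rewrite ler_wpM2l ?invr_ge0 ?powR_ge0// ge0_ler_powR ?nnegrE// ler_nat.
  + rewrite meanZ ?invr_ge0 ?powR_ge0//; last first.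
    { exact: (measurable_num r eD n.+1 (fun m => m.+1%:R `^ (s * 2))). }
    apply: (le_trans (lee_wpmul2l _ (HK n.+1))); first by rewrite lee_fin invr_ge0 powR_ge0.
    rewrite -/t.
    rewrite -EFinM lee_fin ler_pdivrMl//.
    have -> : n.+1%:R `^ t * (2 `^ t * K) = K * (2 `^ t * n.+1%:R `^ t) by ring.
    by rewrite ler_wpM2l.
- have := scaled_limitP; apply: filterS => w [_ sE sc]; apply: cvg_powR.
  + by rewrite sE limit_constant_gt0.
  + by rewrite (cvg_shiftS (fun n => scaled n w)).
Qed.

Definition compensator_ratio (t : R) m := m.+1%:R `^ (t * (beta - 1)) / compensator (rate r) t m.

(** With t = alpha s, W^s = (alpha e^(Z + kappa))^(-t), so m^(t(beta - 1)) e^(-tY_m), whose mean is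
    the ratio on the left, tends almost surely to alpha^t W^s. The integrable bound of
    [expwalk_dominated] allows passing to means. *)
Lemma mean_scaled_limit (s : R) : 0 <= s ->
  (fun m => (compensator_ratio (alpha * s) m)%:E) @ \oo -->
  ((alpha `^ (alpha * s))%:E * mean P (fun w => scaled_limit w `^ s)%R)%E.
Proof.
move=> s0; pose t := alpha * s; rewrite -/t.
have t0 : 0 <= t by rewrite mulr_ge0// ltW.
have ratio m : (compensator_ratio t m)%:E =
  mean P (fun w => m.+1%:R `^ (t * (beta - 1)) * expR (- (t * Y m w))).
{ rewrite meanZ ?powR_ge0//.
  - by rewrite (mean_expR_walk (waiting_exp_iid r_rank eD) (rate_ge0 r) (@rate_out _ r)).
  - apply: measurableT_comp => //; apply: measurable_funN; apply: measurable_funM => //.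
    exact: (measurable_walk (waiting_exp_iid r_rank eD) (@rate_out _ r)). }
under eq_fun do rewrite ratio.
rewrite -meanZ ?powR_ge0//; last first.
{ by move=> w; exact: powR_ge0. }
{ exact: (measurableT_comp (measurable_powR s) measurable_scaled_limit). }
have [c0 c0_gt0 Hc] := compensator_ge r_rank alpha_gt0 alpha_le1 rC t0.
have [B [mB LB iB]] := expwalk_dominated (waiting_exp_iid r_rank eD) (@waiting_ge0 _ r _ _ e) (rate_ge0 r)
  (@rate_out _ r) (ltW (rank_const_gt0 alpha_gt0 rC)) (rate_le r_rank alpha_gt0 alpha_le1 rC) t0.
have B0 w : (0 <= B w)%E.
{ apply: le_trans (LB w 0%N); rewrite lee_fin; apply: expwalk_ge0 => // k.
  exact: rate_ge0. }
have c1 : 0 <= c0^-1 by rewrite invr_ge0 ltW.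
apply: (@mean_dominated _ _ _ _ _ _ (fun w => c0^-1%:E * B w)%E).
- move=> m; apply: measurable_funM => //.
  apply: measurableT_comp => //; apply: measurable_funN; apply: measurable_funM => //.
  exact: (measurable_walk (waiting_exp_iid r_rank eD) (@rate_out _ r)).
- apply: measurable_funM => //.
  exact: (measurableT_comp (measurable_powR s) measurable_scaled_limit).
- by move=> m w; rewrite mulr_ge0 ?powR_ge0 ?expR_ge0.
- exact: emeasurable_funM.
- move=> m w; apply: (@le_trans _ _ (c0^-1%:E * (expwalk (waiting r e) (rate r) t m w)%:E)%E).
  + rewrite -EFinM lee_fin ler_pdivlMl// /expwalk mulrA mulrC.
    by rewrite ler_wpM2l ?expR_ge0.
  + by rewrite lee_wpmul2l.
- rewrite ge0_integralZl_EFin// lte_mul_pinfty ?lee_fin//.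
- have := scaled_limitP; apply: filterS => w [cw sE _].
  have e0 := expR_gt0 (limn (centered w) + kappa r alpha).
  rewrite sE /limit_constant -powRrM mulNr -/t powRN powRM ?ltW//.
  rewrite invfM mulrA divff ?gt_eqF ?powR_gt0// mul1r -expRM -expRN.
  have cd : (fun m => - t * (centered w m + (drift (rate r) m - (beta - 1) * ln m.+1%:R))) @ \oo -->
    - t * (limn (centered w) + kappa r alpha).
  { apply: cvgMl_tmp; apply: cvgD => //.
    exact: (cvg_drift r_rank alpha_gt0 alpha_le1 rC). }
  have := cvg_expR cd.
  rewrite [_ * t]mulrC mulNr; apply: cvg_trans; apply: near_eq_cvg; apply: nearW => m /=.
  rewrite /powR gt_eqF// -expRD; by congr expR; ring.
Qed.

Lemma cvg_moment_product (s l : R) : 0 <= s ->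
  (fun m => compensator_ratio (alpha * s) m) @ \oo --> l ->
  (fun n => moment_product r alpha s n) @ \oo -->
    (1 + alpha * s) * (gam s)^-1 * gam (alpha * s) * (alpha `^ (alpha * s))^-1 * l.
Proof.
move=> s0 cl; pose t := alpha * s; rewrite -/t in cl *.
have t0 : 0 <= t by rewrite mulr_ge0// ltW.
pose Q u m : R := \prod_(0 <= k < m) (1 + u / k.+1%:R).
have Q0 u m : 0 <= u -> 0 < Q u m.
{ by move=> u0; apply: prodr_gt0 => k _; rewrite ltr_wpDr// divr_ge0. }
(* [rank_prod] trades the product over the r(k) for the compensator; what remains are two Gauss
   products, with parameter s up to n and with parameter alpha s up to r(n). *)
have E n : moment_product r alpha s n = (1 + t) * (Q s n / n.+1%:R `^ s) *
  (Q t (r n) / (r n).+1%:R `^ t)^-1 * (((r n).+1%:R / n.+1%:R) `^ t)^-1 * compensator_ratio t n.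
{ have n0 : 0 < n.+1%:R :> R by rewrite ltr0n.
  have r0 : 0 < (r n).+1%:R :> R by rewrite ltr0n.
  have c0 := compensator_gt0 (rate_ge0 r) t0 n.
  have mp : moment_product r alpha s n = Q s n / \prod_(0 <= k < n) (1 + t / (r k.+1)%:R).
  { rewrite /moment_product big_add1/= prodf_div; congr (_ / _).
    by apply: eq_bigr => k _; rewrite [s * _]mulrC. }
  have G0 : 0 < \prod_(0 <= k < n) (1 + t / (r k.+1)%:R).
  { by apply: prodr_gt0 => k _; rewrite ltr_wpDr// divr_ge0. }
  have := rank_prod r_rank t n; rewrite -/(Q t (r n)) => rp.
  have -> : moment_product r alpha s n = Q s n * ((1 + t) / (compensator (rate r) t n * Q t (r n))).
  { rewrite mp rp; congr (_ * _); field; rewrite !gt_eqF// ltr_wpDr//. }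
  rewrite powR_div// /compensator_ratio.
  have -> : t * (beta - 1) = s - t by rewrite /t; field; rewrite gt_eqF.
  rewrite (@powRD _ _ s (- t)) ?(gt_eqF n0) ?implybT// powRN.
  have p1 : 0 < n.+1%:R `^ s by exact: powR_gt0.
  have p2 : 0 < n.+1%:R `^ t by exact: powR_gt0.
  have p3 : 0 < (r n).+1%:R `^ t by exact: powR_gt0.
  have q1 := Q0 t (r n) t0.
  by field; rewrite !gt_eqF. }
under eq_fun do rewrite E.
have cQs := cvg_prod_gauss s0.
have cQt := cvg_comp _ _ (cvg_rank_infty r_rank alpha_gt0 alpha_le1 rC) (cvg_prod_gauss t0).
have gt0 := gam_gt0 t0.
have cr : (fun n => ((r n).+1%:R / n.+1%:R) `^ t) @ \oo --> alpha `^ t.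
{ apply: cvg_powR => //.
  rewrite -[X in _ --> X]addr0.
  apply: cvg_trans (cvgD (cvg_rank alpha_gt0 rC) (@cvg_harmonic R)).
  apply: near_eq_cvg; apply: nearW => n /=.
  by rewrite -[LHS]/((r n)%:R / n.+1%:R + n.+1%:R^-1) -[(r n).+1%:R]natr1 mulrDl mul1r. }
have -> : gam t = ((gam t)^-1)^-1 by rewrite invrK.
apply: cvgM => //; apply: cvgM; last by apply: cvgV => //; rewrite gt_eqF// powR_gt0.
apply: cvgM; last by apply: cvgV => //; rewrite invr_eq0 gt_eqF.
by apply: cvgMl_tmp; exact: cQs.
Qed.

End limit_moments.

(** The finitely many terms preceding the asymptotic bound are added to its constant. *)
Lemma eqO_nat_bounded (R : realType) (f : nat -> R^o) :
  f =O_\oo (fun _ : nat => 1 : R^o) -> exists C : R, forall m, `|f m| <= C.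
Proof.
move=> /eqO_exP[k k0 [N _ HN]].
exists (k + \sum_(0 <= j < N) `|f j|) => m; have [mN|mN] := ltnP m N.
- rewrite (big_cat_nat (leq0n m) (ltnW mN))/= (big_ltn mN).
  apply: ler_wpDl; first exact: ltW.
  apply: ler_wpDl; first exact: sumr_ge0.
  by rewrite lerDl sumr_ge0.
- have /= := HN m mN; rewrite normr1 mulr1 => h.
  by rewrite (le_trans h)// lerDl sumr_ge0.
Qed.

Lemma real_moment_mean d (T : measurableType d) (R : realType) (P : probability T R)
  (Y : T -> R) (s : R) : real_moment P Y s = mean P (fun w => Y w `^ s).
Proof. by rewrite /real_moment unlock. Qed.

Lemma ae_eq_mean d (T : measurableType d) (R : realType) (P : probability T R) (f g : T -> R) :
  measurable_fun setT f -> measurable_fun setT g ->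
  (forall w, 0 <= f w) -> (forall w, 0 <= g w) -> {ae P, forall w, f w = g w} ->
  mean P f = mean P g.
Proof.
move=> mf mg f0 g0 fg; apply: ge0_ae_eq_integral => //.
- exact/measurable_EFinP.
- exact/measurable_EFinP.
- by move=> w _; rewrite lee_fin.
- by move=> w _; rewrite lee_fin.
- by apply: filterS fg => w -> _.
Qed.

Theorem theorem1p2 (R : realType) (d : measure_display) (T : measurableType d)
    (P : probability T R) (X : nat -> {RV P >-> R})
    (X_iid : iid X) (X_continuous : continuous (cdf (X 0%N)))
    (r : nat -> nat) (r_rank : rank_sequence r)
    (alpha : R) (alpha_gt0 : 0 < alpha) (alpha_le1 : alpha <= 1)
    (r_alpha : (fun m : nat => (r m)%:R - alpha * m%:R : R^o) =O_\oo
               (fun _ : nat => 1 : R^o)) :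
  let M (n : nat) (w : T) : nat := num_accepted r (fun i => X i w) n in
  exists W : {RV P >-> R},
    [/\ {ae P, forall w,
           (fun n => (M n w)%:R / n%:R `^ alpha) @ \oo --> W w},
        cvgn (rho_series r alpha),
        exists (d' : measure_display) (T' : measurableType d')
            (P' : probability T' R) (p : T' -> T) (E : nat -> {RV P' >-> R}),
          [/\ extends_probability P P' p,
              independent_seq E,
              forall k, has_exponential_law 1 (E k) &
              {ae P', forall w,
                 cvgn (Z_series r (fun k => E k w)) /\
                 W (p w) =
                   expR ((alpha - 1) * euler_gamma R
                         - alpha * limn (rho_series r alpha) - alpha)
                   * expR (- (alpha * limn (Z_series r (fun k => E k w))))}] &
        forall s : R, 0 <= s ->
          [/\ (fun n : nat =>
                 (real_moment P (fun w => (M n w)%:R) s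
                  * ((n%:R `^ (alpha * s))^-1)%:E)%E) @ \oo
                --> real_moment P W s,
              cvgn (moment_product r alpha s) &
              real_moment P W s =
                (Gamma (s + 1) / Gamma (s * alpha + 2)
                 * limn (moment_product r alpha s))%:E]].
Proof.
move=> M; have [C rC] := eqO_nat_bounded r_alpha.
pose e := exponentialized X; have eD := exponentialized_exp_iid X_iid X_continuous.
have Me : {ae P, forall w, forall n, M n w = num r e n w}.
{ exact: num_accepted_exponentialized. }
have mM n (h : nat -> R) : measurable_fun setT (fun w => h (M n w)).
{ move=> _ A mA; rewrite setTI.
  exact: (@measurable_num_accepted _ T R r (fun i => X i) n [set m | A (h m)] r_rank). }
have limP := scaled_limitP r_rank alpha_gt0 alpha_le1 rC eD.
pose W : {RV P >-> R} := mfun_Sub (mem_set (measurable_scaled_limit r alpha eD)).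
have WE : W = scaled_limit r alpha e :> (T -> R) by [].
exists W; split.
- move: Me limP; apply: filterS2 => w Mw [_ _ sw].
  by under eq_fun do rewrite Mw.
- exact: (is_cvg_rho r_rank alpha_gt0 alpha_le1 rC).
(* On the square of the space, the variables with delta_k = 0 come from the second coordinate, where
   the exponentialized candidates serve as an i.i.d. Exp(1) supply. *)
- pose E := complete_family (fun k => stays r k.+1) (waiting r e) e.
  have [E' [E'E E'ind E'law]] :=
    exp_iid_RV (complete_family_exp_iid (waiting_exp_iid r_rank eD) eD).
  exists _, (T * T)%type, (P \x P)%E, fst, E'; split=> //.
  + exact: extends_probability_fst.
  + have := ae_fst limP; apply: filterS => z [cz sz _].
    have -> : (fun k => E' k z) = (fun k => E k z) by apply/funext => k; rewrite E'E.
    by rewrite Z_series_walk WE sz limit_constantE.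
- move=> s s0; have as0 : 0 <= alpha * s by rewrite mulr_ge0// ltW.
  have [fin_W cm] := cvg_mean_scaled r_rank alpha_gt0 alpha_le1 rC eD s0.
  have cr := mean_scaled_limit r_rank alpha_gt0 alpha_le1 rC eD s0.
  have a0 : 0 < alpha `^ (alpha * s) by exact: powR_gt0.
  rewrite !real_moment_mean WE.
  have mWs : measurable_fun setT (fun w => scaled_limit r alpha e w `^ s).
  { exact: (measurableT_comp (measurable_powR s) (measurable_scaled_limit r alpha eD)). }
  set mu := mean P _ in cm cr fin_W *; pose l := alpha `^ (alpha * s) * fine mu.
  have cl : compensator_ratio r alpha (alpha * s) @ \oo --> l.
  { by move: cr; rewrite -(fineK fin_W) -EFinM => /fine_cvg. }
  have cp := cvg_moment_product r_rank alpha_gt0 alpha_le1 rC s0 cl.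
  split.
  (* [M n] and [num] agree only almost everywhere, so they are exchanged inside the means. *)
  + apply: cvg_trans cm; apply: near_eq_cvg; apply: nearW => n.
    rewrite real_moment_mean muleC -meanZ ?invr_ge0 ?powR_ge0//; last first.
    { exact: (mM n (fun m => m%:R `^ s)). }
    apply: ae_eq_mean.
    * exact: (measurableT_comp (measurable_powR s) (measurable_scaled r alpha eD n)).
    * by apply: measurable_funM => //; exact: (mM n (fun m => m%:R `^ s)).
    * by move=> w; exact: powR_ge0.
    * by move=> w; rewrite mulr_ge0 ?invr_ge0 ?powR_ge0.
    * apply: filterS Me => w ->.
      by rewrite /scaled powR_div ?powR_ge0// mulrC -powRrM.
  + exact: cvgP cp.
  + rewrite -(fineK fin_W) (cvg_lim _ cp)//; congr (_%:E).
    (* The functional equation writes Gamma(s alpha + 2) as (alpha s + 1) times [gam (alpha * s)],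
       matching the factor 1 + alpha s in the limit of the products. *)
    have -> : s * alpha + 2 = alpha * s + 1 + 1 by ring.
    have gs := gam_gt0 s0; have gt := gam_gt0 as0.
    rewrite !Gamma_gam gamS// /l; field.
    by rewrite !gt_eqF// ltr_wpDl.
Qed.
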